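(* The moduli space $\mathcal{TLP}^-_6$ of marked future-directed negative light-like hexagons in $\mathrm{Ein}^{1,2}$ is a topological manifold homeomorphic to $$\{(s,t)\in\mathbb{R}^2 \mid s\ge0,\ st\ne2\}\big/\big((0,t)\sim(0,-t)\big).$$
   Context: $\mathbb{R}^{2,3}$ is $\mathbb{R}^5$ with a nondegenerate symmetric bilinear form $\langle\cdot,\cdot\rangle$ of signature $(2,3)$ (two positive directions), oriented, with volume form $\mathrm{dVol}$. $\mathrm{Ein}^{1,2}\subset\mathbb{P}(\mathbb{R}^{2,3})$ is the projectivization of the nonzero isotropic vectors; a photon is the projectivization of a totally isotropic plane. A light-like polygon $\Delta\subset \mathrm{Ein}^{1,2}$ is an oriented embedded closed one-dimensional simplicial complex with finitely many (cyclically ordered) vertices, each of whose edges is contained in a photon. It is negative if it lifts to a cone $\widetilde\Delta\subset\mathbb{R}^{2,3}\setminus\{0\}$ (a subset invariant under positive scalars) such that the inner product of any two non-collinear points of $\widetilde\Delta$ is non-positive, and vanishes iff their projections belong to the same edge of $\Delta$. One also requires that the closed curve $\widetilde\Delta/\mathbb{R}^+$ generates the fundamental group ($\cong\mathbb{Z}$) of the double cover $\{\text{isotropic vectors}\ne0\}/\mathbb{R}^+\cong S^1\times S^2$ of $\mathrm{Ein}^{1,2}$. Fix an oriented negative definite 3-plane $W=\mathrm{Span}(w_1,w_2,w_3)$. A negative light-like polygon is future-directed if $\mathrm{dVol}(v_i,v_{i+1},w_1,w_2,w_3)>0$ for all $v_i,v_{i+1}\in\widetilde\Delta$ projecting to consecutive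 vertices. $\mathcal{TLP}^-_k$ is the quotient by $\mathrm{SO}_0(2,3)$ (identity component of the isometry group) of the space of future-directed negative light-like polygons with $k$ vertices together with a marked vertex, topologized by its vertices (the rays of $\widetilde\Delta$ over them, up to a global sign). *)

(* Defs.v *)
From HB Require Import structures.
From mathcomp Require Import all_boot all_order all_algebra generic_quotient.
From mathcomp Require Import all_classical all_reals all_analysis.

Set Implicit Arguments.
Unset Strict Implicit.
Unset Printing Implicit Defensive.

Import Order.TTheory GRing.Theory Num.Theory.
Import numFieldNormedType.Exports.

Local Open Scope classical_set_scope.
Local Open Scope ring_scope.
Local Open Scope quotient_scope.

Section Topology.

Definition homeomorphic (X Y : topologicalType) : Prop :=
  exists (f : X -> Y) (g : Y -> X),
    [/\ continuous f, continuous g, cancel f g & cancel g f].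

Definition topological_manifold (R : realType) (n : nat)
    (X : topologicalType) : Prop :=
  [/\ hausdorff_space X, @second_countable X &
      forall x : X, exists (U : set X) (V : set 'rV[R]_n),
        [/\ open U, U x, open V &
            homeomorphic (set_type U) (set_type V)]].

Context {R : realType} {X : topologicalType}.

Definition is_arc (A : set X) (x y : X) : Prop :=
  exists f : R -> X,
    [/\ {within `[0, 1], continuous f},
        {in `[0, 1] &, injective f},
        f 0 = x, f 1 = y & A = f @` `[0, 1]].

(* Loops are 1-periodic maps of the line, i.e. maps of the circle R/Z. *)
Definition is_loop (f : R -> X) : Prop :=
  continuous f /\ forall t, f (t + 1) = f t.

Definition loop_homotopic (f g : R -> X) : Prop :=
  exists H : R * R -> X,
    [/\ continuous H,
        forall t, H (0, t) = f t, forall t, H (1, t) = g t,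
        forall s t, H (s, t + 1) = H (s, t) &
        forall s, H (s, 0) = f 0].

(* The fundamental group at f 0 is cyclic, generated by the class of f: every
   loop at f 0 is homotopic, relative to its base point, to t |-> f (n t),
   which is the n-th power (n-fold concatenation) of f. *)
Definition generates_pi1 (f : R -> X) : Prop :=
  forall g : R -> X, is_loop g -> g 0 = f 0 ->
    exists n : int, loop_homotopic g (fun t => f (n%:~R * t)).

End Topology.

Arguments is_arc R {X} A x y.

Section EinsteinUniverse.
Context {R : realType}.
Notation V := 'rV[R]_5.

Definition ip (u v : V) : R :=
  \sum_(i < 5) (if (i < 2)%N then u 0 i * v 0 i else - (u 0 i * v 0 i)).

(* The standard basis is orthonormal and positively oriented. *)
Definition dVol (a b c d e : V) : R :=
  \det (\matrix_(i < 5) nth (0 : V) [:: a; b; c; d; e] i).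

Definition negative_definite_frame (w1 w2 w3 : V) : Prop :=
  forall a b c : R, [|| a != 0, b != 0 | c != 0] ->
    let w := a *: w1 + b *: w2 + c *: w3 in ip w w < 0.

(* Isometries act on row vectors from the right. *)
Definition isometry : set 'M[R]_5 :=
  [set g | forall u v : V, ip (u *m g) (v *m g) = ip u v].

Definition SO0 : set 'M[R]_5 := connected_component isometry 1%:M.

Definition null_vectors : set V := [set v | v != 0 /\ ip v v = 0].

Definition null_vector : topologicalType := set_type null_vectors.

Lemma null_vectorP (v : null_vector) : val v != 0 /\ ip (val v) (val v) = 0.
Proof. by case: v => v /= /set_mem. Qed.

Definition same_ray (u v : null_vector) : bool :=
  `[< exists2 c : R, 0 < c & val v = c *: val u >].

Lemma same_ray_equiv : equiv_class_of same_ray.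
Proof.
split=> [u|u v|v u w].
- by apply/asboolP; exists 1; rewrite ?scale1r.
- suff sym x y : same_ray x y -> same_ray y x by apply/idP/idP; apply: sym.
  move=> /asboolP[c c0 E]; apply/asboolP; exists c^-1; rewrite ?invr_gt0 //.
  by rewrite E scalerA mulVf ?scale1r // gt_eqF.
- move=> /asboolP[c c0 Ec] /asboolP[d d0 Ed]; apply/asboolP; exists (d * c).
    exact: mulr_gt0.
  by rewrite Ed Ec scalerA.
Qed.

Canonical same_ray_rel := EquivRelPack same_ray_equiv.

Definition same_line (u v : null_vector) : bool :=
  `[< exists2 c : R, c != 0 & val v = c *: val u >].

Lemma same_line_equiv : equiv_class_of same_line.
Proof.
split=> [u|u v|v u w].
- by apply/asboolP; exists 1; rewrite ?scale1r ?oner_eq0.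
- suff sym x y : same_line x y -> same_line y x by apply/idP/idP; apply: sym.
  move=> /asboolP[c c0 E]; apply/asboolP; exists c^-1; rewrite ?invr_eq0 //.
  by rewrite E scalerA mulVf ?scale1r.
- move=> /asboolP[c c0 Ec] /asboolP[d d0 Ed]; apply/asboolP; exists (d * c).
    by rewrite mulf_neq0.
  by rewrite Ed Ec scalerA.
Qed.

Canonical same_line_rel := EquivRelPack same_line_equiv.

Definition Ein : topologicalType :=
  quotient_topology {eq_quot same_line_rel}.

(* The double cover of Ein by rays of null vectors. *)
Definition EinHat : topologicalType :=
  quotient_topology {eq_quot same_ray_rel}.

Definition line (v : null_vector) : Ein := \pi_({eq_quot same_line_rel}) v.
Definition ray (v : null_vector) : EinHat := \pi_({eq_quot same_ray_rel}) v.

Definition double_cover (r : EinHat) : Ein :=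
  line (repr (r : {eq_quot same_ray_rel})).

Lemma lineP (u v : null_vector) :
  line u = line v <-> exists2 c : R, c != 0 & val v = c *: val u.
Proof.
split=> [/(@eqmodP _ same_line_rel)/asboolP //|E].
by apply/(@eqmodP _ same_line_rel)/asboolP.
Qed.

Lemma rayP (u v : null_vector) :
  ray u = ray v <-> exists2 c : R, 0 < c & val v = c *: val u.
Proof.
split=> [/(@eqmodP _ same_ray_rel)/asboolP //|E].
by apply/(@eqmodP _ same_ray_rel)/asboolP.
Qed.

Lemma double_cover_ray (v : null_vector) : double_cover (ray v) = line v.
Proof.
rewrite /double_cover; apply/lineP.
have /rayP[c c0 E] : ray (repr (ray v : {eq_quot same_ray_rel})) = ray v.
  exact: reprK.
by exists c; rewrite ?gt_eqF.
Qed.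

(* The default value of insubd is never used when g is an isometry. *)
Definition act_null (g : 'M[R]_5) (v : null_vector) : null_vector := insubd v (val v *m g).

Definition act_Ein (g : 'M[R]_5) (x : Ein) : Ein :=
  line (act_null g (repr (x : {eq_quot same_line_rel}))).

Definition is_photon (A : set Ein) : Prop :=
  exists U : {vspace V},
    [/\ \dim U = 2, {in U &, forall u v, ip u v = 0} &
        A = [set line v | v in [set v : null_vector | val v \in U]]].

Lemma isometryM (g h : 'M[R]_5) :
  isometry g -> isometry h -> isometry (g *m h).
Proof. by move=> ig ih u v; rewrite !mulmxA ih ig. Qed.

Lemma isometry1 : isometry 1%:M.
Proof. by move=> u v; rewrite !mulmx1. Qed.

Lemma ip_delta (u : V) (i : 'I_5) :
  ip u (delta_mx 0 i) = if (i < 2)%N then u 0 i else - u 0 i.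
Proof.
rewrite /ip (bigD1 i) //= big1 ?addr0; last first.
  move=> j jNi; rewrite !mxE /= (negbTE jNi) !mulr0 oppr0.
  by case: ifP.
by rewrite !mxE !eqxx !mulr1.
Qed.

Lemma isometry_unit (g : 'M[R]_5) : isometry g -> g \in unitmx.
Proof.
move=> ig; rewrite -row_free_unit; apply/row_freeP.
suff: kermx g = 0.
  by move/eqP; rewrite kermx_eq0 => /row_freeP.
apply/row_matrixP => k; rewrite row0.
set u := row k _.
have ug : u *m g = 0 by apply: (sub_kermxP _); rewrite row_sub.
apply/rowP => i; rewrite [RHS]mxE.
have := ig u (delta_mx 0 i); rewrite ug ip_delta.
rewrite /ip big1 => [|j _]; last by rewrite !mxE !mul0r oppr0; case: ifP.
by case: ifP => _ /esym // /eqP; rewrite oppr_eq0 => /eqP.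
Qed.

Lemma isometryV (g : 'M[R]_5) : isometry g -> isometry (invmx g).
Proof.
move=> ig u v; have gu := isometry_unit ig.
by rewrite -{2}(mulmxKV gu u) -{2}(mulmxKV gu v) ig.
Qed.

Lemma SO0_isometry (g : 'M[R]_5) : SO0 g -> isometry g.
Proof. exact: connected_component_sub. Qed.

Lemma SO0_1 : SO0 1%:M.
Proof. exact: connected_component_refl isometry1. Qed.

Lemma mulmxr_continuous (h : 'M[R]_5) :
  continuous (fun g : 'M[R]_5 => g *m h).
Proof.
move=> g A [P gP sPA].
have entry i j : \forall x \near g, P i j ((x *m h) i j).
  have sum_cont : continuous (fun x : 'M[R]_5 => \sum_k x i k * h k j).
    apply: continuous_big => [|k _]; first exact: add_continuous.
    move=> x; apply: (@continuous_comp _ _ _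
      (fun x : 'M[R]_5 => x i k) ( *%R^~ (h k j))).
      exact: coord_continuous.
    exact: mulrr_continuous.
  have gE : (g *m h) i j = \sum_k g i k * h k j by rewrite mxE.
  have := gP i j; rewrite gE => /(sum_cont g).
  by apply: (@filterS _ (nbhs g) (nbhs_filter g)) => x /=; rewrite mxE.
have all_entries : \forall x \near g, forall i j, P i j ((x *m h) i j).
  apply: (@filter_forall _ _ _ (nbhs g) (nbhs_filter g)) => i.
  apply: (@filter_forall _ _ _ (nbhs g) (nbhs_filter g)) => j.
  exact: entry.
by apply: (@filterS _ (nbhs g) (nbhs_filter g) _ _ _ all_entries) => x Px; exact: sPA.
Qed.

Lemma SO0_translate (g h : 'M[R]_5) :
  isometry h -> SO0 g -> SO0 (g *m h) -> (fun x => x *m h) @` SO0 `<=` SO0.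
Proof.
move=> ih Sg Sgh.
rewrite [X in _ `<=` X](same_connected_component Sgh).
apply: connected_component_max; first by exists g.
- by move=> _ [x Sx <-]; apply: isometryM => //; exact: SO0_isometry.
- apply: connected_continuous_connected; first exact: component_connected.
  exact/continuous_subspaceT/mulmxr_continuous.
Qed.

Lemma SO0M (g h : 'M[R]_5) : SO0 g -> SO0 h -> SO0 (g *m h).
Proof.
move=> Sg Sh; apply: (@SO0_translate 1%:M h); last by exists g.
- exact: SO0_isometry.
- exact: SO0_1.
- by rewrite mul1mx.
Qed.

Lemma SO0V (g : 'M[R]_5) : SO0 g -> SO0 (invmx g).
Proof.
move=> Sg; have ig := SO0_isometry Sg.
apply: (@SO0_translate g (invmx g)) => //; first exact: isometryV.
  by rewrite mulmxV ?isometry_unit//; exact: SO0_1.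
by exists 1%:M; [exact: SO0_1|rewrite mul1mx].
Qed.

Lemma val_act_null (g : 'M[R]_5) (v : null_vector) :
  isometry g -> val (act_null g v) = val v *m g.
Proof.
move=> ig; rewrite /act_null val_insubd ifT //.
have [v0 vv] := null_vectorP v; apply/mem_set; split; last by rewrite ig.
apply: contra v0 => /eqP vg0; apply/eqP.
by rewrite -(mulmxK (isometry_unit ig) (val v)) vg0 mul0mx.
Qed.

Lemma act_Ein_line (g : 'M[R]_5) (v : null_vector) :
  isometry g -> act_Ein g (line v) = line (act_null g v).
Proof.
move=> ig; rewrite /act_Ein; apply/lineP.
have /lineP[c c0 E] : line (repr (line v : {eq_quot same_line_rel})) = line v.
  exact: reprK.
by exists c => //; rewrite !val_act_null // E scalemxAl.
Qed.

Lemma line_surj (x : Ein) : exists v, x = line v.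
Proof.
by exists (repr (x : {eq_quot same_line_rel})); rewrite /line reprK.
Qed.

Lemma act_Ein1 (x : Ein) : act_Ein 1%:M x = x.
Proof.
have [v ->] := line_surj x; rewrite act_Ein_line; last exact: isometry1.
by congr line; apply: val_inj; rewrite val_act_null ?mulmx1 //; exact: isometry1.
Qed.

Lemma act_EinM (g h : 'M[R]_5) (x : Ein) : isometry g -> isometry h ->
  act_Ein (g *m h) x = act_Ein h (act_Ein g x).
Proof.
move=> ig ih; have igh := isometryM ig ih; have [v ->] := line_surj x.
rewrite !act_Ein_line //; congr line; apply: val_inj.
by rewrite !val_act_null // mulmxA.
Qed.

End EinsteinUniverse.

Arguments Ein R : clear implicits.
Arguments EinHat R : clear implicits.
Arguments null_vector R : clear implicits.

Section LightlikePolygons.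
Context {R : realType}.
Notation V := 'rV[R]_5.

(* A closed polygon with k vertices, given by its vertices and edges: edge i
   joins vertex i to its cyclic successor.  The numbering records both the
   orientation and the marked vertex, which is vertex number 0. *)
Record marked_polygon (k : nat) := MarkedPolygon {
  vertex : 'I_k -> Ein R;
  edge : 'I_k -> set (Ein R) }.

Definition polygon_support k (P : marked_polygon k) : set (Ein R) :=
  \bigcup_i edge P i.

(* The first four conditions say that the edges and vertices form an embedded
   simplicial complex which is a cycle. *)
Definition lightlike_polygon k (P : marked_polygon k) : Prop :=
  [/\ (3 <= k)%N,
      injective (vertex P),
      forall i, is_arc R (edge P i) (vertex P i) (vertex P (ordS i)),
      forall i j, i != j -> edge P i `&` edge P j =
        [set vertex P i; vertex P (ordS i)] `&`
        [set vertex P j; vertex P (ordS j)] &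
      forall i, exists2 A, is_photon A & edge P i `<=` A].

(* The cones over the continuous sections of the double cover above D. *)
Definition is_lift (D : set (Ein R)) (C : set (null_vector R)) : Prop :=
  exists s : Ein R -> EinHat R,
    [/\ {within D, continuous s}, forall x, D x -> double_cover (s x) = x &
        C = [set v | (s @` D) (ray v)]].

Definition negative_lift k (P : marked_polygon k)
    (C : set (null_vector R)) : Prop :=
  forall u v : null_vector R, C u -> C v -> line u <> line v ->
    ip (val u) (val v) <= 0 /\
    (ip (val u) (val v) = 0 <->
       exists i, edge P i (line u) /\ edge P i (line v)).

Definition generating_lift (C : set (null_vector R)) : Prop :=
  exists f : R -> EinHat R,
    [/\ is_loop f, {in `[0, 1[ &, injective f}, f @` `[0, 1[ = ray @` C &
        generates_pi1 f].

Definition future_directed (w1 w2 w3 : V) k (P : marked_polygon k)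
    (C : set (null_vector R)) : Prop :=
  forall (i : 'I_k) (u v : null_vector R), C u -> C v ->
    line u = vertex P i -> line v = vertex P (ordS i) ->
    0 < dVol (val u) (val v) w1 w2 w3.

(* A polygon together with a lift to a cone and the rays of that cone lying
   over its vertices. *)
Record lifted_polygon (k : nat) := LiftedPolygon {
  polygon : marked_polygon k;
  cone : set (null_vector R);
  vertex_ray : 'I_k -> EinHat R }.

HB.instance Definition _ k := gen_eqMixin (lifted_polygon k).
HB.instance Definition _ k := gen_choiceMixin (lifted_polygon k).

Definition future_negative_lifted (w1 w2 w3 : V) k : set (lifted_polygon k) :=
  [set L | [/\ lightlike_polygon (polygon L),
      is_lift (polygon_support (polygon L)) (cone L),
      negative_lift (polygon L) (cone L),
      generating_lift (cone L) &
      future_directed w1 w2 w3 (polygon L) (cone L)] /\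
    forall i, (ray @` cone L) (vertex_ray L i) /\
      double_cover (vertex_ray L i) = vertex (polygon L) i].

Definition lifted_vertices w1 w2 w3 k
    (L : set_type (future_negative_lifted w1 w2 w3 (k := k))) :
    {ptws 'I_k -> EinHat R} := vertex_ray (val L).

Definition lifted_space w1 w2 w3 k : topologicalType :=
  initial_topology (@lifted_vertices w1 w2 w3 k).

Definition translate_polygon k (g : 'M[R]_5) (P : marked_polygon k) :
    marked_polygon k :=
  MarkedPolygon (fun i => act_Ein g (vertex P i))
    (fun i => act_Ein g @` edge P i).

(* The relation ignores the lifts: it first identifies the (two) lifts of a
   polygon, and then the polygons in a same SO0-orbit. *)
Definition tlp_rel w1 w2 w3 k (L M : lifted_space w1 w2 w3 k) : bool :=
  `[< exists2 g, SO0 g &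
        polygon (val M) = translate_polygon g (polygon (val L)) >].

Lemma translate_polygon1 k (P : marked_polygon k) :
  translate_polygon 1%:M P = P.
Proof.
case: P => p e; congr MarkedPolygon; apply/funext => i /=.
  exact: act_Ein1.
rewrite (_ : act_Ein 1%:M = id) ?image_id //; apply/funext => x.
exact: act_Ein1.
Qed.

Lemma translate_polygonM k g h (P : marked_polygon k) :
  isometry g -> isometry h ->
  translate_polygon (g *m h) P = translate_polygon h (translate_polygon g P).
Proof.
move=> ig ih; congr MarkedPolygon; apply/funext => i /=; first exact: act_EinM.
by rewrite image_comp; apply: eq_imagel => x _; exact: act_EinM.
Qed.

Lemma tlp_rel_equiv w1 w2 w3 k : equiv_class_of (@tlp_rel w1 w2 w3 k).
Proof.
split=> [L|L M|M L N].
- by apply/asboolP; exists 1%:M; [exact: SO0_1|rewrite translate_polygon1].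
- suff sym x y : tlp_rel x y -> @tlp_rel w1 w2 w3 k y x.
    by apply/idP/idP; apply: sym.
  move=> /asboolP[g Sg E]; apply/asboolP; exists (invmx g); first exact: SO0V.
  have ig := SO0_isometry Sg.
  rewrite E -translate_polygonM //; last exact: isometryV.
  by rewrite mulmxV ?translate_polygon1 // isometry_unit.
- move=> /asboolP[g Sg E] /asboolP[h Sh F]; apply/asboolP.
  exists (g *m h); first exact: SO0M.
  by rewrite F E translate_polygonM //; exact: SO0_isometry.
Qed.

Canonical tlp_equiv w1 w2 w3 k := EquivRelPack (@tlp_rel_equiv w1 w2 w3 k).

Definition TLP w1 w2 w3 k : topologicalType :=
  quotient_topology {eq_quot @tlp_equiv w1 w2 w3 k}.

End LightlikePolygons.

Section HexagonModel.
Variable R : realType.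

Definition half_plane_minus_hyperbola : set (R * R) :=
  [set p | 0 <= p.1 /\ p.1 * p.2 != 2].

Definition fold_rel (p q : set_type half_plane_minus_hyperbola) : bool :=
  (val p == val q) ||
  [&& (val p).1 == 0, (val q).1 == 0 & (val q).2 == - (val p).2].

Lemma fold_rel_equiv : equiv_class_of fold_rel.
Proof.
rewrite /fold_rel; split=> [p|p q|q p r].
- by rewrite eqxx.
- by rewrite eq_sym andbCA [(val p).2 == _]eq_sym eqr_oppLR.
- move=> /orP[/eqP->//|/and3P[p0 q0 /eqP qp]].
  move=> /orP[/eqP<-|/and3P[_ r0 /eqP rq]]; first by rewrite p0 q0 qp eqxx orbT.
  apply/orP; left; apply/eqP; move: rq; rewrite qp opprK.
  by case: (val p) (val r) p0 r0 => [a b] [c d] /= /eqP-> /eqP-> ->.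
Qed.

Canonical fold_equiv := EquivRelPack fold_rel_equiv.

Definition folded_half_plane_minus_hyperbola : topologicalType :=
  quotient_topology {eq_quot fold_equiv}.

End HexagonModel.

(* Main.v *)
(* The isotropic lifts v_0, ..., v_5 of the vertices of a negative hexagon have
   negative products, except for equal or adjacent vertices, whose product is 0.
   Scaling them, one may assume that the products of distinct vertices of the same
   parity are -2; then p = (v_0 + v_3) / 2, q = (v_4 + v_1) / 2, r = (v_2 + v_5) / 2
   are orthogonal to m1 = (v_0 - v_3) / 2, m2 = (v_4 - v_1) / 2, m3 = (v_2 - v_5) / 2,
   and the hexagon is determined up to isometry by x, y, z > 0, where -2x, -2y, -2z
   are the products of opposite vertices.  Since the dimension is 5, one of the two
   Gram determinants x y z - x - y - z + 2 and x y z - x - y - z - 2 vanishes, and the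
   signature gives 1 <= x y.  These are the two components of the moduli space.  The
   second condition leaves the free parameters x, y with x y > 1.  The first one reads
   (x y - 1) (z (x + y + 2) - 4) = (x - y) ^ 2, that is, s ^ 2 t ^ 2 = (x - y) ^ 2 with
   s = sqrt (x y - 1) and t of sign that of x - y, which is undetermined if s = 0:
   this is the half plane folded along its boundary, and (s ^ 2 - t ^ 2, s t) is a
   global coordinate on it.  An explicit normal form for each pair of parameters
   provides a continuous inverse.  The isometry between two future-directed hexagons
   with the same x, y, z is, up to sign, in the identity component.

   The hexagon built from a normal form lifts to a loop which projects to the unit
   circle of the positive definite plane with degree 1, hence generates the
   fundamental group of the double cover S^1 x S^2.  Conversely the edges of a
   light-like polygon are arcs in circles, and negativity forces them to be the short
   ones, so that the polygon is determined by its vertices. *)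

Require Import Defs.
From mathcomp Require Import all_boot all_order all_algebra generic_quotient.
From mathcomp Require Import all_classical all_reals all_analysis.
From mathcomp Require Import ring lra zify.
(* isometry is shadowed by mathcomp-analysis. *)
Import Defs.

Set Implicit Arguments.
Unset Strict Implicit.
Unset Printing Implicit Defensive.

Import Order.TTheory GRing.Theory Num.Theory.
Import numFieldNormedType.Exports.

Local Open Scope classical_set_scope.
Local Open Scope ring_scope.
Local Open Scope quotient_scope.

(** * Manifolds and homeomorphisms *)

(** The pair (s ^ 2 - t ^ 2, s t) is, up to a factor 2 in the second entry, the complex square of s
    + i t. Squaring is what folds the half plane s >= 0 along its boundary onto a full plane.

    The inverse of the invariants is never shown continuous by itself. Three continuous maps are
    closed up into a cycle instead: the invariants send the moduli space to [chart_domain], an open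
    subset of the plane; square roots lead from there to the folded half plane; normal forms lead
    back to the moduli space. The cycle is the identity on [chart_domain] and on the folded half
    plane, and the invariants separate orbits, so all three spaces are homeomorphic and the manifold
    property is that of an open subset of the plane.

    The delicate place is s = 0 in the second component. There the part of m1 orthogonal to m1 - m2
    becomes isotropic, and orthonormalising it would divide by s. The second normal form therefore
    uses null coordinates in a plane of signature (1, 1), in which nothing degenerates. *)

Section GeneralTopology.

(** This serves where two formulas meet at a point: at the integers when a path is made periodic,
    and on the fold of the model. *)
Lemma continuous_at_either (X Y : topologicalType) (F F1 F2 : X -> Y) (x : X) :
  {for x, continuous F1} -> {for x, continuous F2} ->
  F1 x = F x -> F2 x = F x ->
  (\forall y \near x, F y = F1 y \/ F y = F2 y) -> {for x, continuous F}.
Proof.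
move=> c1 c2 e1 e2 H A /= nA; change (nbhs x (F @^-1` A)).
have n1 : nbhs x (F1 @^-1` A) by apply: c1; rewrite /= e1.
have n2 : nbhs x (F2 @^-1` A) by apply: c2; rewrite /= e2.
near=> y; rewrite /preimage/=.
have [->|->] : F y = F1 y \/ F y = F2 y by near: y.
- by near: y.
- by near: y.
Unshelve. all: by end_near. Qed.

Lemma continuous_near_eq (X Y : topologicalType) (F F1 : X -> Y) (x : X) :
  {for x, continuous F1} -> (\forall y \near x, F y = F1 y) ->
  {for x, continuous F}.
Proof.
move=> c1 H; have e : F x = F1 x by exact: nbhs_singleton H.
apply: (continuous_at_either c1 c1) => //.
by apply: filterS H => y ->; left.
Qed.

Lemma continuous_into_set_type (X Y : topologicalType) (A : set Y)
    (f : X -> set_type A) : continuous (fun x => val (f x)) -> continuous f.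
Proof. exact: continuous_comp_initial. Qed.

Lemma val_continuous (X : topologicalType) (A : set X) :
  continuous (val : set_type A -> X).
Proof. exact: initial_continuous. Qed.

Lemma homeomorphic_sym (X Y : topologicalType) :
  homeomorphic X Y -> homeomorphic Y X.
Proof. by move=> [f [g [cf cg fK gK]]]; exists g, f. Qed.

Lemma homeomorphic_trans (X Y Z : topologicalType) :
  homeomorphic X Y -> homeomorphic Y Z -> homeomorphic X Z.
Proof.
move=> [f [g [cf cg fK gK]]] [f' [g' [cf' cg' fK' gK']]].
exists (f' \o f), (g \o g'); split; last 2 first.
- by move=> x /=; rewrite fK' fK.
- by move=> x /=; rewrite gK gK'.
- by move=> x; apply: continuous_comp; [exact: cf|exact: cf'].
- by move=> x; apply: continuous_comp; [exact: cg'|exact: cg].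
Qed.

Lemma rational_row_dense (R : realType) n (v : 'rV[R]_n) (e : R) : 0 < e ->
  exists q : 'rV[rat]_n, ball (map_mx ratr q : 'rV[R]_n) e v.
Proof.
move=> e0.
have /choice[q qP] : forall i, exists r : rat, v 0 i - e < ratr r < v 0 i + e.
  move=> i; have /rat_in_itvoo[r] : v 0 i - e < v 0 i + e by lra.
  by rewrite in_itv; exists r.
exists (\row_i q i); apply: ball_sym; split=> // i j; rewrite !mxE (ord1 i) /ball /= ltr_norml.
by have := qP j; lra.
Qed.

Lemma open_euclidean_second_countable (R : realType) n (V : set 'rV[R]_n)
    (X : topologicalType) :
  homeomorphic X (set_type V) -> @second_countable X.
Proof.
move=> [f [g [cf cg fK gK]]].
pose phi x := val (f x).
have cphi : continuous phi.
  by move=> x; apply: continuous_comp; [exact: cf|exact: val_continuous].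
pose U (qk : 'rV[rat]_n * nat) :=
  phi @^-1` (ball (map_mx ratr qk.1 : 'rV[R]_n) (qk.2.+1%:R^-1 : R))°%classic.
exists (range U).
  exact: sub_countable (card_image_le _ _) (countableP _).
split=> [_ [qk _ <-]|x A nA].
  by apply: open_comp => [y _|]; [exact: cphi|exact: open_interior].
have : nbhs (f x) (g @^-1` A) by apply: cg; rewrite fK.
rewrite nbhsE => -[_ [[W oW <-] /= Wx] WA].
have /nbhs_ballP[e /= e0 eW] : nbhs (phi x) W by exact: open_nbhs_nbhs.
have [k kP] : exists k : nat, k.+1%:R^-1 < e / 2.
  have e2 : 0 < e / 2 by lra.
  have := near_infty_natSinv_lt (PosNum e2).
  by move=> [N _ NP]; exists N; apply: NP => /=.
have k0 : 0 < k.+1%:R^-1 / 2 :> R by rewrite divr_gt0 ?invr_gt0 ?ltr0n.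
(* A centre within half of the radius makes [phi x] an interior point of the ball, and the ball
   still lies in [W]. *)
have [q qP] := rational_row_dense (phi x) k0.
exists (U (q, k)).
  split; first by exists (q, k).
  rewrite /U /= /preimage/= /interior; apply/nbhs_ballP.
  exists (k.+1%:R^-1 / 2) => //= y By.
  by rewrite [k.+1%:R^-1]splitr; apply: ball_triangle By.
move=> y /= /interior_subset Uy; rewrite -(fK y); apply: WA => /=; apply: eW.
have ke : k.+1%:R^-1 / 2 + k.+1%:R^-1 <= e.
  by move: e0 kP k0; set u := _^-1; move=> e0 kP k0; lra.
apply: (le_ball ke); exact: ball_triangle (ball_sym qP) Uy.
Qed.

Lemma open_euclidean_manifold (R : realType) n (V : set 'rV[R]_n)
    (X : topologicalType) :
  open V -> homeomorphic X (set_type V) -> topological_manifold R n X.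
Proof.
move=> oV hom; split; last 2 first.
- exact: open_euclidean_second_countable hom.
- move=> x; exists setT, V; split => //; first exact: openT.
  apply: homeomorphic_trans hom.
  exists val, (fun y => SigSub (mem_set (I : setT y))); split => //.
  + exact: val_continuous.
  + by apply: continuous_into_set_type => y; exact: cvg_id.
  + by move=> y; apply: val_inj.
- case: hom => f [g [cf cg fK gK]].
  have c : continuous (fun x => val (f x)).
    by move=> z; apply: continuous_comp; [exact: cf|exact: val_continuous].
  move=> x y xy; apply/(can_inj fK)/val_inj.
  apply: (@norm_hausdorff _ 'rV[R]_n) => A B nA nB.
  have [z [Az Bz]] := xy _ _ (c x _ nA) (c y _ nB).
  by exists (val (f z)).
Qed.

End GeneralTopology.

(** * Pointwise continuity *)

Section RealContinuity.
Context {R : realType} {X : topologicalType}.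
Implicit Types (f g : X -> R) (x : X).

Lemma cont_cst (Y : topologicalType) (a : Y) x :
  {for x, continuous (fun _ : X => a)}.
Proof. exact: cvg_cst. Qed.

Lemma contD f g x : {for x, continuous f} -> {for x, continuous g} ->
  {for x, continuous (fun y => f y + g y)}.
Proof. by move=> cf cg; exact: (continuousD cf cg). Qed.

Lemma contN f x : {for x, continuous f} -> {for x, continuous (fun y => - f y)}.
Proof. by move=> cf; exact: (continuousN cf). Qed.

Lemma contM f g x : {for x, continuous f} -> {for x, continuous g} ->
  {for x, continuous (fun y => f y * g y)}.
Proof. by move=> cf cg; exact: (continuousM cf cg). Qed.

Lemma contX f n x : {for x, continuous f} ->
  {for x, continuous (fun y => f y ^+ n)}.
Proof.
move=> cf; elim: n => [|n IH].
  exact: (@cont_cst R 1 x).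
have -> : (fun y => f y ^+ n.+1) = (fun y => f y * f y ^+ n).
  by apply/funext => y; rewrite exprS.
exact: contM.
Qed.

Lemma contV f x : f x != 0 -> {for x, continuous f} ->
  {for x, continuous (fun y => (f y)^-1)}.
Proof. by move=> f0 cf; exact: (continuousV f0 cf). Qed.

Lemma cont_sqrt f x : {for x, continuous f} ->
  {for x, continuous (fun y => Num.sqrt (f y))}.
Proof. by move=> cf; apply: (continuous_comp cf); exact: sqrt_continuous. Qed.

Lemma cont_norm f x : {for x, continuous f} ->
  {for x, continuous (fun y => `|f y|)}.
Proof. by move=> cf; apply: (continuous_comp cf); exact: norm_continuous. Qed.

Lemma cont_max f g x : {for x, continuous f} -> {for x, continuous g} ->
  {for x, continuous (fun y => Num.max (f y) (g y))}.
Proof.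
move=> cf cg.
have -> : (fun y => Num.max (f y) (g y)) =
    (fun y => (f y + g y + `|f y - g y|) / 2).
  by apply/funext => y; exact: maxr_absE.
apply: contM; last exact: cont_cst.
by apply: contD; [exact: contD|apply: cont_norm; apply: contD => //; exact: contN].
Qed.

Lemma cont_min f g x : {for x, continuous f} -> {for x, continuous g} ->
  {for x, continuous (fun y => Num.min (f y) (g y))}.
Proof.
move=> cf cg.
have -> : (fun y => Num.min (f y) (g y)) =
    (fun y => (f y + g y - `|f y - g y|) / 2).
  by apply/funext => y; exact: minr_absE.
apply: contM; last exact: cont_cst.
by apply: contD; [exact: contD|apply: contN; apply: cont_norm; apply: contD => //; exact: contN].
Qed.

Lemma cont_cos f x : {for x, continuous f} ->
  {for x, continuous (fun y => cos (f y))}.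
Proof. by move=> cf; apply: (continuous_comp cf); exact: continuous_cos. Qed.

Lemma cont_sin f x : {for x, continuous f} ->
  {for x, continuous (fun y => sin (f y))}.
Proof. by move=> cf; apply: (continuous_comp cf); exact: continuous_sin. Qed.

Lemma cont_coord m n (A : X -> 'M[R]_(m, n)) i j x :
  {for x, continuous A} -> {for x, continuous (fun y => A y i j)}.
Proof.
move=> cA; apply: (@continuous_comp _ _ _ A (fun M : 'M[R]_(m, n) => M i j)) => //.
exact: coord_continuous.
Qed.

Lemma cont_mx m n (A : X -> 'M[R]_(m, n)) x :
  (forall i j, {for x, continuous (fun y => A y i j)}) ->
  {for x, continuous A}.
Proof.
move=> c U /= [P gP sPA].
have all_entries : \forall y \near x, forall i j, P i j (A y i j).
  apply: (@filter_forall _ _ _ (nbhs x) (nbhs_filter x)) => i.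
  apply: (@filter_forall _ _ _ (nbhs x) (nbhs_filter x)) => j.
  exact: c.
change (nbhs x (A @^-1` U)); apply: filterS all_entries => y Py; exact: sPA.
Qed.

Lemma cont_fst (Y Z : topologicalType) (f : X -> Y * Z) x :
  {for x, continuous f} -> {for x, continuous (fun y => (f y).1)}.
Proof. by move=> cf; apply: (continuous_comp cf); exact: cvg_fst. Qed.

Lemma cont_snd (Y Z : topologicalType) (f : X -> Y * Z) x :
  {for x, continuous f} -> {for x, continuous (fun y => (f y).2)}.
Proof. by move=> cf; apply: (continuous_comp cf); exact: cvg_snd. Qed.

Lemma cont_pair (Y Z : topologicalType) (f : X -> Y) (g : X -> Z) x :
  {for x, continuous f} -> {for x, continuous g} ->
  {for x, continuous (fun y => (f y, g y))}.
Proof. by move=> cf cg; exact: cvg_pair. Qed.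

Lemma continuous_pointwise (Y : topologicalType) (f : X -> Y) :
  (forall x, {for x, continuous f}) -> continuous f.
Proof. by []. Qed.

Lemma cont_id x : {for x, continuous (fun y : X => y)}.
Proof. exact: cvg_id. Qed.

Lemma cont_det n (A : X -> 'M[R]_n) x :
  {for x, continuous A} -> {for x, continuous (fun y => \det (A y))}.
Proof.
move=> cA; apply: cvg_big => [|s _]; first exact: add_continuous.
apply: contM; first exact: cont_cst.
apply: cvg_big => [|i _]; first exact: mul_continuous.
exact: cont_coord.
Qed.

End RealContinuity.

Lemma addrl_continuous (R : realType) (a x : R) :
  {for x, continuous (+%R a)}.
Proof. by apply: (contD (f := fun=> a)); [exact: cont_cst|exact: cont_id]. Qed.

Ltac cont_atom :=
  lazymatch goal with
  | |- {for _, continuous (GRing.mul _)} => exact: mulrl_continuous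
  | |- {for _, continuous (Algebra.add _)} => exact: addrl_continuous
  | |- {for _, continuous (Algebra.opp)} => exact: opp_continuous
  | |- {for _, continuous cos} => exact: continuous_cos
  | |- {for _, continuous sin} => exact: continuous_sin
  | |- {for _, continuous fst} => exact: cvg_fst
  | |- {for _, continuous snd} => exact: cvg_snd
  | |- {for _, continuous val} => exact: val_continuous
  end.

Ltac cont_step :=
  lazymatch goal with
  | |- {for _, continuous (fun y => _ + _)} => apply: contD
  | |- {for _, continuous (fun y => - _)} => apply: contN
  | |- {for _, continuous (fun y => _ * _)} => apply: contM
  | |- {for _, continuous (fun y => _ ^-1)} => apply: contV
  | |- {for _, continuous (fun y => _ ^+ _)} => apply: contX
  | |- {for _, continuous (fun y => Num.sqrt _)} => apply: cont_sqrt
  | |- {for _, continuous (fun y => `| _ |)} => apply: cont_norm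
  | |- {for _, continuous (fun y => Num.max _ _)} => apply: cont_max
  | |- {for _, continuous (fun y => Num.min _ _)} => apply: cont_min
  | |- {for _, continuous (fun y => cos _)} => apply: cont_cos
  | |- {for _, continuous (fun y => sin _)} => apply: cont_sin
  | |- {for _, continuous (fun y => fun_of_matrix _ _ _)} => apply: cont_coord
  | |- {for _, continuous (fun y => (_, _))} => apply: cont_pair
  end.

(** An inverse is first looked up among the hypotheses, where its non-vanishing has already been
    dealt with. *)
Ltac cont :=
  repeat first
    [ lazymatch goal with
      | |- {for _, continuous (fun y => _ ^-1)} => eassumption
      | |- _ => cont_step
      end
    | exact: cont_cst | exact: cont_id | cont_atom | eassumption | cont_step
    | apply: cont_fst | apply: cont_snd ].

(** * Constant sign of non-vanishing functions *)

Section ConnectedSign.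
Context {R : realType}.

Lemma connected_nonvanishing_gt0 (X : topologicalType) (A : set X)
    (f : X -> R) (x y : X) :
  connected A -> {within A, continuous f} -> (forall z, A z -> f z != 0) ->
  A x -> A y -> 0 < f x -> 0 < f y.
Proof.
move=> cA cf f0 Ax Ay fx; rewrite ltNge; apply/negP => fy.
have := connected_continuous_connected cA cf.
move/connected_intervalP/(_ (f y) (f x) (ex_intro2 _ _ y Ay erefl)).
move/(_ (ex_intro2 _ _ x Ax erefl) 0); rewrite fy ltW // => /(_ isT)[z Az fz].
by have := f0 z Az; rewrite fz eqxx.
Qed.

Lemma segment_nonvanishing_gt0 (f : R -> R) :
  {within `[0, 1], continuous f} -> (forall t, 0 <= t <= 1 -> f t != 0) ->
  0 < f 0 -> forall t, 0 <= t <= 1 -> 0 < f t.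
Proof.
move=> cf f0 fx t t01.
apply: (connected_nonvanishing_gt0 (@segment_connected R 0 1) cf (x := 0)) => //=.
by rewrite in_itv /= lexx ler01.
Qed.

End ConnectedSign.

(** * The quadratic form *)

Section Quadric.
Context {R : realType}.
Notation V := 'rV[R]_5.
Implicit Types (u v w : V) (g h : 'M[R]_5).

Definition k0 : 'I_5 := @Ordinal 5 0 isT.
Definition k1 : 'I_5 := @Ordinal 5 1 isT.
Definition k2 : 'I_5 := @Ordinal 5 2 isT.
Definition k3 : 'I_5 := @Ordinal 5 3 isT.
Definition k4 : 'I_5 := @Ordinal 5 4 isT.

Lemma ord5_ind (P : 'I_5 -> Prop) :
  P k0 -> P k1 -> P k2 -> P k3 -> P k4 -> forall k, P k.
Proof.
move=> p0 p1 p2 p3 p4 [[|[|[|[|[|//]]]]] lt5].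
- by rewrite (_ : Ordinal lt5 = k0) //; apply: val_inj.
- by rewrite (_ : Ordinal lt5 = k1) //; apply: val_inj.
- by rewrite (_ : Ordinal lt5 = k2) //; apply: val_inj.
- by rewrite (_ : Ordinal lt5 = k3) //; apply: val_inj.
- by rewrite (_ : Ordinal lt5 = k4) //; apply: val_inj.
Qed.

Lemma row5P u v : u 0 k0 = v 0 k0 -> u 0 k1 = v 0 k1 -> u 0 k2 = v 0 k2 ->
  u 0 k3 = v 0 k3 -> u 0 k4 = v 0 k4 -> u = v.
Proof. by move=> *; apply/rowP; apply: ord5_ind. Qed.

Definition vec5 (a b c d e : R) : V := \row_j nth 0 [:: a; b; c; d; e] j.

Lemma vec5E a b c d e :
  (vec5 a b c d e 0 k0 = a) * (vec5 a b c d e 0 k1 = b) *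
  (vec5 a b c d e 0 k2 = c) * (vec5 a b c d e 0 k3 = d) *
  (vec5 a b c d e 0 k4 = e).
Proof. by rewrite !mxE. Qed.

Lemma sum5E (W : nmodType) (F : 'I_5 -> W) : \sum_i F i = F k0 + F k1 + F k2 + F k3 + F k4.
Proof.
rewrite !big_ord_recl big_ord0 addr0 !addrA.
by congr (F _ + F _ + F _ + F _ + F _); apply: val_inj.
Qed.

Lemma ipE u v : ip u v = u 0 k0 * v 0 k0 + u 0 k1 * v 0 k1
  - u 0 k2 * v 0 k2 - u 0 k3 * v 0 k3 - u 0 k4 * v 0 k4.
Proof. by rewrite /ip sum5E /=. Qed.

Lemma ipC u v : ip u v = ip v u.
Proof. by rewrite !ipE; ring. Qed.

Lemma ipDl u v w : ip (u + v) w = ip u w + ip v w.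
Proof. by rewrite !ipE !mxE; ring. Qed.

Lemma ipDr u v w : ip w (u + v) = ip w u + ip w v.
Proof. by rewrite !ipE !mxE; ring. Qed.

Lemma ipZl a u v : ip (a *: u) v = a * ip u v.
Proof. by rewrite !ipE !mxE; ring. Qed.

Lemma ipZr a u v : ip u (a *: v) = a * ip u v.
Proof. by rewrite !ipE !mxE; ring. Qed.

Lemma ipNl u v : ip (- u) v = - ip u v.
Proof. by rewrite !ipE !mxE; ring. Qed.

Lemma ipNr u v : ip u (- v) = - ip u v.
Proof. by rewrite !ipE !mxE; ring. Qed.

Lemma ip0l v : ip 0 v = 0.
Proof. by rewrite !ipE !mxE; ring. Qed.

Lemma ip0r v : ip v 0 = 0.
Proof. by rewrite !ipE !mxE; ring. Qed.

Definition ip_simp := (ipDl, ipDr, ipZl, ipZr, ipNl, ipNr, ip0l, ip0r).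

Lemma cont_ip (X : topologicalType) (f g : X -> V) (x : X) :
  {for x, continuous f} -> {for x, continuous g} ->
  {for x, continuous (fun y => ip (f y) (g y))}.
Proof.
move=> cf cg; rewrite (_ : (fun y => _) = (fun y =>
  f y 0 k0 * g y 0 k0 + f y 0 k1 * g y 0 k1 - f y 0 k2 * g y 0 k2
  - f y 0 k3 * g y 0 k3 - f y 0 k4 * g y 0 k4)); last first.
  by apply/funext => y; exact: ipE.
have cM k : {for x, continuous (fun y => f y 0 k * g y 0 k)}.
  by apply: contM; exact: cont_coord.
exact: contD (contD (contD (contD (cM _) (cM _)) (contN (cM _))) (contN (cM _))) (contN (cM _)).
Qed.

Lemma cont_scale (X : topologicalType) (a : X -> R) (f : X -> V) (x : X) :
  {for x, continuous a} -> {for x, continuous f} ->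
  {for x, continuous (fun y => a y *: f y)}.
Proof.
move=> ca cf; apply: cont_mx => i j.
rewrite (_ : (fun y => _) = (fun y => a y * f y i j)); last first.
  by apply/funext => y; rewrite mxE.
by cont.
Qed.

Lemma cont_add_row (X : topologicalType) (f g : X -> V) (x : X) :
  {for x, continuous f} -> {for x, continuous g} ->
  {for x, continuous (fun y => f y + g y)}.
Proof.
move=> cf cg; apply: cont_mx => i j.
rewrite (_ : (fun y => _) = (fun y => f y i j + g y i j)); last first.
  by apply/funext => y; rewrite mxE.
by cont.
Qed.

Lemma cont_vec5 (X : topologicalType) (a b c d e : X -> R) (x : X) :
  {for x, continuous a} -> {for x, continuous b} -> {for x, continuous c} ->
  {for x, continuous d} -> {for x, continuous e} ->
  {for x, continuous (fun y => vec5 (a y) (b y) (c y) (d y) (e y))}.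
Proof.
move=> ca cb cc cd ce; apply: cont_mx => i; apply: ord5_ind;
  rewrite (ord1 i); set F := (F in {for _, continuous F}).
- by rewrite (_ : F = a) //; apply/funext => y; rewrite /F vec5E.
- by rewrite (_ : F = b) //; apply/funext => y; rewrite /F vec5E.
- by rewrite (_ : F = c) //; apply/funext => y; rewrite /F vec5E.
- by rewrite (_ : F = d) //; apply/funext => y; rewrite /F vec5E.
- by rewrite (_ : F = e) //; apply/funext => y; rewrite /F vec5E.
Qed.

Lemma sqr_sum3_eq0 (a b c : R) : a * a + b * b + c * c = 0 ->
  [/\ a = 0, b = 0 & c = 0].
Proof.
move=> H; have a0 := sqr_ge0 a; have b0 := sqr_ge0 b; have c0 := sqr_ge0 c.
rewrite !expr2 in a0 b0 c0.
by split; apply/eqP; rewrite -sqrf_eq0 expr2; apply/eqP; lra.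
Qed.

Lemma sqr_sum2_eq0 (a b : R) : a * a + b * b = 0 -> a = 0 /\ b = 0.
Proof.
move=> H; have [] := @sqr_sum3_eq0 a b 0; last by [].
by rewrite mulr0 addr0.
Qed.

Lemma posfree_ip_le0 u : u 0 k0 = 0 -> u 0 k1 = 0 ->
  ip u u <= 0 /\ (ip u u = 0 -> u = 0).
Proof.
move=> u0 u1; rewrite ipE u0 u1.
have a0 := sqr_ge0 (u 0 k2); have b0 := sqr_ge0 (u 0 k3).
have c0 := sqr_ge0 (u 0 k4); rewrite !expr2 in a0 b0 c0.
split; first by lra.
move=> H; have [] := @sqr_sum3_eq0 (u 0 k2) (u 0 k3) (u 0 k4); first by lra.
by move=> e2 e3 e4; apply: row5P; rewrite ?u0 ?u1 ?e2 ?e3 ?e4 mxE.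
Qed.

(* The form has two positive directions only. *)
Lemma ip_lt0_orth u1 u2 w : 0 < ip u1 u1 ->
  0 < ip u1 u1 * ip u2 u2 - ip u1 u2 ^+ 2 ->
  ip u1 w = 0 -> ip u2 w = 0 -> ip w w <= 0 /\ (ip w w = 0 -> w = 0).
Proof.
set a := ip u1 u1; set b := ip u1 u2; set c := ip u2 u2 => a0 ac o1 o2.
have Q al be : 0 <= al ^+ 2 * a + 2 * al * be * b + be ^+ 2 * c /\
    (al ^+ 2 * a + 2 * al * be * b + be ^+ 2 * c = 0 -> al = 0 /\ be = 0).
  set q := _ + _ + _.
  have aq : a * q = (a * al + b * be) ^+ 2 + (a * c - b ^+ 2) * be ^+ 2.
    by rewrite /q; ring.
  have s1 := sqr_ge0 (a * al + b * be); have s2 := sqr_ge0 be.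
  have s3 : 0 <= (a * c - b ^+ 2) * be ^+ 2 by rewrite mulr_ge0 // ltW.
  split; first by rewrite -(pmulr_rge0 _ a0) aq addr_ge0.
  move=> q0; rewrite q0 mulr0 in aq.
  have e1 : (a * c - b ^+ 2) * be ^+ 2 = 0 by lra.
  have be0 : be = 0.
    move/eqP: e1; rewrite mulf_eq0 gt_eqF //= sqrf_eq0 => /eqP; exact.
  split => //; have : (a * al + b * be) ^+ 2 = 0 by lra.
  move/eqP; rewrite sqrf_eq0 be0 mulr0 addr0 mulf_eq0 gt_eqF //= => /eqP; exact.
(* Minors of the positive coordinates: [al *: u1 + be *: u2 + ga *: w] has no positive coordinates,
   hence a non-positive square, while [u1] and [u2] contribute a non-negative one. *)
pose ga := u1 0 k0 * u2 0 k1 - u1 0 k1 * u2 0 k0.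
pose al := u2 0 k0 * w 0 k1 - u2 0 k1 * w 0 k0.
pose be := w 0 k0 * u1 0 k1 - w 0 k1 * u1 0 k0.
have ga0 : ga != 0.
  (* If [ga] vanished, combinations of [u1] and [u2] without positive coordinates would force [u1]
     itself to have none, against [0 < ip u1 u1]. *)
  apply/eqP => ga0.
  have F (x y : R) : x * u1 0 k0 + y * u2 0 k0 = 0 ->
      x * u1 0 k1 + y * u2 0 k1 = 0 -> y = 0.
    move=> e0 e1; have [q0 q1] := Q x y.
    have [l0 _] : let z := x *: u1 + y *: u2 in ip z z <= 0 /\ (ip z z = 0 -> z = 0).
      by apply: posfree_ip_le0; rewrite !mxE.
    have := l0; rewrite !ip_simp (ipC u2 u1) -/a -/b -/c => l1.
    by have [] : x = 0 /\ y = 0 by apply: q1; apply/eqP; rewrite eq_le q0 andbT; lra.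
  have u10 : u1 0 k0 = 0.
    by apply: (F (- u2 0 k0)); [ring|rewrite -[RHS]ga0 /ga; ring].
  have u11 : u1 0 k1 = 0.
    by apply: (F (- u2 0 k1)); [rewrite -[RHS]oppr0 -ga0 /ga; ring|ring].
  by have [] := posfree_ip_le0 u10 u11; rewrite -/a => l _; lra.
have [q0 q1] := Q al be.
pose z := al *: u1 + be *: u2 + ga *: w.
have zz : ip z z = al ^+ 2 * a + 2 * al * be * b + be ^+ 2 * c
    + ga ^+ 2 * ip w w.
  rewrite /z !ip_simp (ipC u2 u1) (ipC w u1) (ipC w u2) o1 o2 -/a -/b -/c; ring.
have [z0 z1] : ip z z <= 0 /\ (ip z z = 0 -> z = 0).
  by apply: posfree_ip_le0; rewrite /z !mxE /al /be /ga; ring.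
have g2 : 0 < ga ^+ 2 by rewrite lt0r sqrf_eq0 ga0 sqr_ge0.
split; first by rewrite -(pmulr_rle0 _ g2); lra.
move=> w0; move: zz; rewrite w0 mulr0 addr0 => zz.
have [al0 be0] : al = 0 /\ be = 0.
  by apply: q1; apply/eqP; rewrite eq_le q0 andbT -zz.
have : z = 0 by apply: z1; rewrite zz al0 be0; ring.
rewrite /z al0 be0 !scale0r !add0r => /eqP.
by rewrite scaler_eq0 (negbTE ga0) /= => /eqP.
Qed.

End Quadric.

Ltac cont ::=
  repeat first
    [ lazymatch goal with
      | |- {for _, continuous (fun y => _ ^-1)} => eassumption
      | |- {for _, continuous (fun y => ip _ _)} => apply: cont_ip
      | |- {for _, continuous (fun y => vec5 _ _ _ _ _)} => apply: cont_vec5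
      | |- {for _, continuous (fun y => _ *: _)} => apply: cont_scale
      | |- _ => cont_step
      end
    | exact: cont_cst | exact: cont_id | cont_atom | eassumption | cont_step
    | apply: cont_fst | apply: cont_snd ].

(** * Isometries in the identity component *)

Section Isometries.
Context {R : realType}.
Notation V := 'rV[R]_5.
Implicit Types (u v w : V) (g h : 'M[R]_5).

Definition sg (k : 'I_5) : R := if (k < 2)%N then 1 else -1.

Lemma ip_sg u v : ip u v = \sum_k sg k * (u 0 k * v 0 k).
Proof. by apply: eq_bigr => k _; rewrite /sg; case: ifP => _; ring. Qed.

Lemma isometry_path (c : R -> 'M[R]_5) (t : R) : continuous c ->
  (forall s, isometry (c s)) -> c 0 = 1%:M -> SO0 (c t).
Proof.
move=> cc ic c0; apply: (@connected_component_max _ _ (range c) 1%:M).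
- by exists 0.
- by move=> _ [s _ <-].
- apply: connected_continuous_connected; last exact: continuous_subspaceT.
  by apply/connected_intervalP => x y _ _ z _.
- by exists t.
Qed.

Definition plane_mx (i j : 'I_5) (a b c d : R) : 'M[R]_5 :=
  1%:M + (a - 1) *: delta_mx i i + b *: delta_mx i j + c *: delta_mx j i
  + (d - 1) *: delta_mx j j.

Lemma mul_row_delta u (i j k : 'I_5) :
  (u *m delta_mx i j) 0 k = u 0 i * (k == j)%:R.
Proof.
rewrite mxE (bigD1 i) //= big1 ?addr0 => [|l /negbTE li].
  by rewrite mxE eqxx.
by rewrite mxE li mulr0.
Qed.

Lemma plane_mxE i j a b c d u (k : 'I_5) : i != j ->
  (u *m plane_mx i j a b c d) 0 k =
  if k == i then a * u 0 i + c * u 0 j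
  else if k == j then b * u 0 i + d * u 0 j else u 0 k.
Proof.
move=> ij; rewrite /plane_mx !mulmxDr mulmx1 -!scalemxAr.
have rowD (x y : V) : (x + y) 0 k = x 0 k + y 0 k by rewrite mxE.
have rowZ r (x : V) : (r *: x) 0 k = r * x 0 k by rewrite mxE.
rewrite !rowD !rowZ !mul_row_delta.
have [->|ki] := eqVneq k i.
  by rewrite (negbTE ij) /= ?mulr1n ?mulr0n; ring.
by have [->|kj] := eqVneq k j; rewrite /= ?mulr1n ?mulr0n; ring.
Qed.

Lemma plane_mx_isometry i j a b c d : i != j ->
  sg i * a * a + sg j * b * b = sg i -> sg i * c * c + sg j * d * d = sg j ->
  sg i * a * c + sg j * b * d = 0 -> isometry (plane_mx i j a b c d).
Proof.
move=> ij e1 e2 e3 u v; rewrite !ip_sg.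
rewrite (bigD1 i) // (bigD1 j) 1?eq_sym //= [RHS](bigD1 i) // [in RHS](bigD1 j) 1?eq_sym //=.
rewrite !addrA; congr (_ + _); last first.
  apply: eq_bigr => k /andP[ki kj].
  by rewrite !plane_mxE // (negbTE ki) (negbTE kj).
rewrite !plane_mxE // !eqxx eq_sym (negbTE ij).
transitivity ((sg i * a * a + sg j * b * b) * (u 0 i * v 0 i)
  + (sg i * c * c + sg j * d * d) * (u 0 j * v 0 j)
  + (sg i * a * c + sg j * b * d) * (u 0 i * v 0 j + u 0 j * v 0 i)); first ring.
by rewrite e1 e2 e3; ring.
Qed.

Lemma plane_mx_continuous i j (a b c d : R -> R) : continuous a ->
  continuous b -> continuous c -> continuous d ->
  continuous (fun t => plane_mx i j (a t) (b t) (c t) (d t)).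
Proof.
move=> ca cb cc cd t; apply: cont_mx => k l.
rewrite (_ : (fun y => _) = fun y => (1%:M : 'M[R]_5) k l
  + (a y - 1) * (delta_mx i i : 'M[R]_5) k l
  + b y * (delta_mx i j : 'M[R]_5) k l + c y * (delta_mx j i : 'M[R]_5) k l
  + (d y - 1) * (delta_mx j j : 'M[R]_5) k l); last first.
  by apply/funext => y; rewrite /plane_mx !mxE.
by cont; [exact: ca|exact: cb|exact: cc|exact: cd].
Qed.

Lemma plane_mx1 i j : plane_mx i j 1 0 0 1 = 1%:M.
Proof. by rewrite /plane_mx !subrr !scale0r !addr0. Qed.

Lemma rotation_SO0 i j t : i != j -> sg i = sg j ->
  SO0 (plane_mx i j (cos t) (sin t) (- sin t) (cos t)).
Proof.
move=> ij sij.
apply: (@isometry_path (fun t => plane_mx i j (cos t) (sin t) (- sin t) (cos t))).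
- apply: plane_mx_continuous => s; try exact: continuous_cos.
  + exact: continuous_sin.
  + by apply: contN; exact: continuous_sin.
- move=> s; have cs := cos2Dsin2 s.
  by apply: plane_mx_isometry; rewrite // -sij -[RHS]mulr1 -?cs; ring.
- by rewrite cos0 sin0 oppr0 plane_mx1.
Qed.

Lemma polar_angle (a b : R) : a ^+ 2 + b ^+ 2 = 1 ->
  exists t, a = cos t /\ b = sin t.
Proof.
move=> ab; have b2 := sqr_ge0 b; have a2 := sqr_ge0 a.
have a1 : -1 <= a <= 1 by rewrite -ler_norml -sqrtr_sqr -sqrtr1 ler_sqrt //; lra.
have e : sin (acos a) = `|b|.
  by rewrite sin_acos // -sqrtr_sqr; congr Num.sqrt; lra.
have [b0|b0] := leP 0 b.
  by exists (acos a); rewrite acosK ?in_itv // e ger0_norm.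
by exists (- acos a); rewrite cosN sinN acosK ?in_itv // e ltr0_norm ?opprK.
Qed.

(** The bookkeeping of the reduction by rotations and boosts: basis vectors already aligned outside
    the plane of [i] and [j] are not moved. *)
Definition acts_on (i j : 'I_5) h := forall v,
  (forall k, k != i -> k != j -> (v *m h) 0 k = v 0 k) /\
  (v 0 i = 0 -> v 0 j = 0 -> v *m h = v).

Lemma plane_mx_acts_on i j a b c d : i != j -> acts_on i j (plane_mx i j a b c d).
Proof.
move=> ij v; split=> [k /negbTE ki /negbTE kj|vi vj].
  by rewrite plane_mxE // ki kj.
apply/rowP => k; rewrite plane_mxE //.
have [->|ki] := eqVneq k i; first by rewrite vi vj; ring.
by have [->|kj] := eqVneq k j; first by rewrite vi vj; ring.
Qed.

Lemma kill_rotation u i j : i != j -> sg i = sg j ->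
  exists h, [/\ SO0 h, acts_on i j h, (u *m h) 0 j = 0 & 0 <= (u *m h) 0 i].
Proof.
move=> ij sij; set r := Num.sqrt (u 0 i ^+ 2 + u 0 j ^+ 2).
have q0 : 0 <= u 0 i ^+ 2 + u 0 j ^+ 2 by rewrite addr_ge0 ?sqr_ge0.
have r2 : r ^+ 2 = u 0 i ^+ 2 + u 0 j ^+ 2 by rewrite sqr_sqrtr.
have [r0|rN0] := eqVneq r 0.
  exists 1%:M; split.
  - exact: SO0_1.
  - by move=> v; rewrite mulmx1.
  - rewrite mulmx1; apply: (@sqr_sum2_eq0 _ (u 0 i) (u 0 j) _).2.
    by rewrite -!expr2 -r2 r0 expr0n.
  - rewrite mulmx1 (@sqr_sum2_eq0 _ (u 0 i) (u 0 j) _).1 //.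
    by rewrite -!expr2 -r2 r0 expr0n.
have [|t [ct st]] := @polar_angle (u 0 i / r) (- u 0 j / r).
  by rewrite !expr_div_n sqrrN -mulrDl -r2 divff // sqrf_eq0.
exists (plane_mx i j (cos t) (sin t) (- sin t) (cos t)); split.
- exact: rotation_SO0.
- exact: plane_mx_acts_on.
- rewrite plane_mxE // eqxx eq_sym (negbTE ij) -ct -st; ring.
- rewrite plane_mxE // eqxx -ct -st.
  rewrite (_ : _ + _ = r) ?sqrtr_ge0 //.
  transitivity ((u 0 i ^+ 2 + u 0 j ^+ 2) / r); first ring.
  by rewrite -r2; field.
Qed.

Lemma kill_boost u i j : i != j -> sg i = 1 -> sg j = -1 ->
  u 0 j ^+ 2 < u 0 i ^+ 2 ->
  exists h, [/\ SO0 h, acts_on i j h, (u *m h) 0 j = 0 & 0 <= (u *m h) 0 i * u 0 i].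
Proof.
move=> ij si sj lt; set p := u 0 i; set q := u 0 j.
have p0 : p != 0.
  by apply/eqP => p0; move: lt; rewrite -/p p0 expr0n /= ltNge sqr_ge0.
set r := Num.sqrt (p ^+ 2 - q ^+ 2).
have r2 : r ^+ 2 = p ^+ 2 - q ^+ 2 by rewrite sqr_sqrtr // subr_ge0 ltW.
have r0 : 0 < r by rewrite sqrtr_gt0 subr_gt0.
(* The hyperbolic sine of the boost that kills the coordinate [j]. The factor [Num.sg p] is there
   because the hyperbolic cosine [ch] is positive for either sign of [p]. Multiplying [sh] by [t]
   gives a path from the identity. *)
pose sh := - q * Num.sg p / r.
pose ch (t : R) := Num.sqrt (1 + (sh * t) ^+ 2).
have ch2 t : ch t * ch t = 1 + (sh * t) ^+ 2.
  by rewrite -expr2 sqr_sqrtr // addr_ge0 ?sqr_ge0.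
have sgp : Num.sg p * Num.sg p = 1 by rewrite -expr2 sqr_sg p0.
have ch1 : ch 1 = `|p| / r.
  rewrite /ch mulr1 /sh !expr_div_n exprMn expr2 (expr2 (Num.sg p)) sgp.
  rewrite (_ : 1 + _ = (p / r) ^+ 2) ?sqrtr_sqr ?normf_div ?(gtr0_norm r0) //.
  rewrite expr_div_n r2; field.
  by rewrite -r2 sqrf_eq0 gt_eqF.
exists (plane_mx i j (ch 1) (sh * 1) (sh * 1) (ch 1)); split.
- apply: (@isometry_path (fun t => plane_mx i j (ch t) (sh * t) (sh * t) (ch t))).
  + have cch : continuous ch.
      apply: continuous_pointwise => t; rewrite /ch; cont.
    have cs : continuous (fun t : R => sh * t) by apply: continuous_pointwise => t'; cont.
    exact: plane_mx_continuous.
  + move=> t; apply: plane_mx_isometry; rewrite // si sj; last by ring.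
      * by transitivity (ch t * ch t - (sh * t) ^+ 2); [ring|rewrite ch2; ring].
      * by transitivity ((sh * t) ^+ 2 - ch t * ch t); [ring|rewrite ch2; ring].
  + by rewrite mulr0 /ch mulr0 expr0n addr0 sqrtr1 plane_mx1.
- exact: plane_mx_acts_on.
- rewrite plane_mxE // eqxx eq_sym (negbTE ij) -/p -/q ch1 mulr1 normrEsg /sh; ring.
- rewrite plane_mxE // eqxx -/p -/q ch1 mulr1 /sh normrEsg.
  rewrite (_ : _ * p = (Num.sg p * p) * ((p ^+ 2 - q ^+ 2) / r)); last by ring.
  by rewrite -normrEsg -r2 mulr_ge0 // divr_ge0 ?sqr_ge0 // ltW.
Qed.

End Isometries.

(** * Reduction of isometries to two signs *)

Section Reduction.
Context {R : realType}.
Notation V := 'rV[R]_5.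
Implicit Types (u v w : V) (g h : 'M[R]_5).

Definition bas (k : 'I_5) : V := delta_mx 0 k.

Lemma basE k i : bas k 0 i = (i == k)%:R.
Proof. by rewrite mxE eqxx. Qed.

Lemma ip_bas u k : ip u (bas k) = sg k * u 0 k.
Proof. by rewrite ip_delta /sg; case: ifP => _; ring. Qed.

Lemma acts_on_bas i j h k : acts_on i j h -> k != i -> k != j -> bas k *m h = bas k.
Proof.
move=> ah ki kj; apply: (ah (bas k)).2; rewrite basE eq_sym.
- by rewrite (negbTE ki).
- by rewrite (negbTE kj).
Qed.

Lemma sqr_eq1 (a : R) : a * a = 1 -> a = 1 \/ a = -1.
Proof.
by move/eqP; rewrite -expr2 sqrf_eq1 => /orP[/eqP|/eqP]; [left|right].
Qed.

Lemma sqr_eq1_pos (a : R) : 0 <= a -> a * a = 1 -> a = 1.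
Proof. by move=> a0 /sqr_eq1[//|a1]; move: a0; rewrite a1 => ?; lra. Qed.

Lemma kill_negative u : exists h, [/\ SO0 h, bas k0 *m h = bas k0,
  bas k1 *m h = bas k1 & [/\ (u *m h) 0 k0 = u 0 k0, (u *m h) 0 k1 = u 0 k1,
  (u *m h) 0 k3 = 0, (u *m h) 0 k4 = 0 & 0 <= (u *m h) 0 k2]].
Proof.
have [h1 [S1 a1 z1 _]] := @kill_rotation _ u k2 k3 isT erefl.
have [h2 [S2 a2 z2 p2]] := @kill_rotation _ (u *m h1) k2 k4 isT erefl.
exists (h1 *m h2); rewrite !mulmxA; split.
- exact: SO0M.
- by rewrite (acts_on_bas a1) // (acts_on_bas a2).
- by rewrite (acts_on_bas a1) // (acts_on_bas a2).
- split => //.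
  + by rewrite (a2 _).1 // (a1 _).1.
  + by rewrite (a2 _).1 // (a1 _).1.
  + by rewrite (a2 _).1.
Qed.

Lemma align0 u : ip u u = 1 -> exists2 h, SO0 h & u *m h = bas k0.
Proof.
move=> uu; have [h1 [S1 _ _ [_ _ z3 z4 _]]] := kill_negative u.
have [h2 [S2 a2 z1 p0]] := @kill_rotation _ (u *m h1) k0 k1 isT erefl.
pose w := u *m h1 *m h2.
have w3 : w 0 k3 = 0 by rewrite /w (a2 _).1.
have w4 : w 0 k4 = 0 by rewrite /w (a2 _).1.
have ww : ip w w = 1 by rewrite /w (SO0_isometry S2) (SO0_isometry S1).
have lt : w 0 k2 ^+ 2 < w 0 k0 ^+ 2.
  by move: ww; rewrite ipE w3 w4 [w 0 k1]z1 => ww; rewrite !expr2; lra.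
have [h3 [S3 a3 y2 y0]] := @kill_boost _ w k0 k2 isT erefl erefl lt.
have y1 : (w *m h3) 0 k1 = 0 by rewrite (a3 _).1.
have y3 : (w *m h3) 0 k3 = 0 by rewrite (a3 _).1.
have y4 : (w *m h3) 0 k4 = 0 by rewrite (a3 _).1.
have w0 : 0 < w 0 k0.
  rewrite lt0r p0 andbT; apply/eqP => w0; move: lt.
  by rewrite w0 expr0n /= ltNge sqr_ge0.
exists (h1 *m h2 *m h3); first by apply: SO0M => //; exact: SO0M.
rewrite !mulmxA -/w; apply: row5P; rewrite basE ?y1 ?y2 ?y3 ?y4 //.
apply: sqr_eq1_pos; first by rewrite -(pmulr_lge0 _ w0).
have := SO0_isometry S3 w w; rewrite ww ipE y1 y2 y3 y4 => <-; ring.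
Qed.

(** Only one positive direction is left once [bas k0] is fixed, and boosts do not reverse it: hence
    the undetermined sign [d]. *)
Lemma align1 u : u 0 k0 = 0 -> ip u u = 1 ->
  exists h, [/\ SO0 h, bas k0 *m h = bas k0 &
    exists d, (d = 1 \/ d = -1) /\ u *m h = d *: bas k1].
Proof.
move=> u0 uu; have [h1 [S1 f0 _ [e0 _ z3 z4 _]]] := kill_negative u.
pose w := u *m h1.
have ww : ip w w = 1 by rewrite /w (SO0_isometry S1).
have lt : w 0 k2 ^+ 2 < w 0 k1 ^+ 2.
  by move: ww; rewrite ipE [w 0 k3]z3 [w 0 k4]z4 [w 0 k0]e0 u0 => ww; rewrite !expr2; lra.
have [h3 [S3 a3 y2 y0]] := @kill_boost _ w k1 k2 isT erefl erefl lt.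
have x0 : (w *m h3) 0 k0 = 0 by rewrite (a3 _).1 // [w 0 k0]e0.
have y3 : (w *m h3) 0 k3 = 0 by rewrite (a3 _).1.
have y4 : (w *m h3) 0 k4 = 0 by rewrite (a3 _).1.
exists (h1 *m h3); rewrite !mulmxA; split; first exact: SO0M.
  by rewrite f0 (acts_on_bas a3).
exists ((w *m h3) 0 k1); split.
  apply: sqr_eq1.
  have := SO0_isometry S3 w w; rewrite ww ipE x0 y2 y3 y4 => <-; ring.
by apply: row5P; rewrite [RHS]mxE basE /= -/w ?x0 ?y2 ?y3 ?y4; ring.
Qed.

Lemma align2 u : u 0 k0 = 0 -> u 0 k1 = 0 -> ip u u = -1 ->
  exists h, [/\ SO0 h, bas k0 *m h = bas k0, bas k1 *m h = bas k1 &
    u *m h = bas k2].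
Proof.
move=> u0 u1 uu; have [h1 [S1 f0 f1 [e0 e1 z3 z4 p2]]] := kill_negative u.
exists h1; split => //.
have ww : ip (u *m h1) (u *m h1) = -1 by rewrite (SO0_isometry S1).
apply: row5P; rewrite basE ?e0 ?e1 ?u0 ?u1 ?z3 ?z4 //.
apply: sqr_eq1_pos => //; move: ww; rewrite ipE e0 e1 u0 u1 z3 z4; lra.
Qed.

Lemma align3 u : u 0 k0 = 0 -> u 0 k1 = 0 -> u 0 k2 = 0 -> ip u u = -1 ->
  exists h, [/\ SO0 h, bas k0 *m h = bas k0, bas k1 *m h = bas k1,
    bas k2 *m h = bas k2 & u *m h = bas k3].
Proof.
move=> u0 u1 u2 uu.
have [h [S a z p]] := @kill_rotation _ u k3 k4 isT erefl.
exists h; split; rewrite ?(acts_on_bas a) //.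
have ww : ip (u *m h) (u *m h) = -1 by rewrite (SO0_isometry S).
have e0 : (u *m h) 0 k0 = 0 by rewrite (a _).1.
have e1 : (u *m h) 0 k1 = 0 by rewrite (a _).1.
have e2 : (u *m h) 0 k2 = 0 by rewrite (a _).1.
apply: row5P; rewrite basE ?e0 ?e1 ?e2 ?z //.
by apply: sqr_eq1_pos => //; move: ww; rewrite ipE e0 e1 e2 z; lra.
Qed.

Lemma row_basE u : u = u 0 k0 *: bas k0 + u 0 k1 *: bas k1 + u 0 k2 *: bas k2
  + u 0 k3 *: bas k3 + u 0 k4 *: bas k4.
Proof. by rewrite {1}(row_sum_delta u) sum5E. Qed.

(** Rotations and boosts bring the images of the basis vectors back one after the other. What cannot
    be undone in this way, the signs [d1] and [d4], labels the four components of the isometry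
    group. *)
Lemma isometry_reduce g : isometry g ->
  exists h d1 d4, [/\ SO0 h, d1 = 1 \/ d1 = -1, d4 = 1 \/ d4 = -1 &
    forall u, u *m (g *m h) =
      vec5 (u 0 k0) (d1 * u 0 k1) (u 0 k2) (u 0 k3) (d4 * u 0 k4)].
Proof.
move=> ig.
have gip x y (h : 'M[R]_5) : SO0 h -> ip (x *m g *m h) (y *m g *m h) = ip x y.
  by move=> Sh; rewrite (SO0_isometry Sh) ig.
have b k l : ip (bas k) (bas l) = sg l * (k == l)%:R :> R.
  by rewrite ip_bas basE eq_sym.
have orth u d k : d = 1 \/ d = -1 -> ip u (d *: bas k) = 0 -> u 0 k = 0.
  rewrite ipZr ip_bas /sg => -[->|->]; case: ifP => _; lra.
have orth1 u k : ip u (bas k) = 0 -> u 0 k = 0.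
  by rewrite ip_bas /sg; case: ifP => _; lra.
have [|h0 S0 E0] := @align0 (bas k0 *m g).
  by rewrite ig b; rewrite /sg /=; ring.
have [||h1 [S1 f10 [d1 [D1 E1]]]] := @align1 (bas k1 *m g *m h0).
- by apply: orth1; rewrite -E0 gip // b mulr0.
- by rewrite gip // b /sg /=; ring.
have [|||h2 [S2 f20 f21 E2]] := @align2 (bas k2 *m g *m h0 *m h1).
- by apply: orth1; rewrite -f10 -E0 (SO0_isometry S1) gip // b mulr0.
- by apply: (orth _ d1) => //; rewrite -E1 (SO0_isometry S1) gip // b mulr0.
- by rewrite (SO0_isometry S1) gip // b /sg /=; ring.
have [||||h3 [S3 f30 f31 f32 E3]] := @align3 (bas k3 *m g *m h0 *m h1 *m h2).
- by apply: orth1; rewrite -f20 -f10 -E0 (SO0_isometry S2) (SO0_isometry S1) gip // b mulr0.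
- apply: (orth _ d1) => //; rewrite -f21 scalemxAl -E1 (SO0_isometry S2).
  by rewrite (SO0_isometry S1) gip // b mulr0.
- apply: orth1; rewrite -E2 (SO0_isometry S2) (SO0_isometry S1).
  by rewrite gip // b mulr0.
- by rewrite (SO0_isometry S2) (SO0_isometry S1) gip // b /sg /=; ring.
pose h := h0 *m h1 *m h2 *m h3.
have Sh : SO0 h by do 3 (apply: SO0M => //).
have F0 : bas k0 *m g *m h = bas k0 by rewrite /h !mulmxA E0 f10 f20 f30.
have F1 : bas k1 *m g *m h = d1 *: bas k1.
  by rewrite /h !mulmxA E1 -scalemxAl f21 -scalemxAl f31.
have F2 : bas k2 *m g *m h = bas k2 by rewrite /h !mulmxA E2 f32.
have F3 : bas k3 *m g *m h = bas k3 by rewrite /h !mulmxA E3.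
pose w := bas k4 *m g *m h.
have w0 : w 0 k0 = 0 by apply: orth1; rewrite -F0 gip // b mulr0.
have w1 : w 0 k1 = 0 by apply: (orth _ d1) => //; rewrite -F1 gip // b mulr0.
have w2 : w 0 k2 = 0 by apply: orth1; rewrite -F2 gip // b mulr0.
have w3 : w 0 k3 = 0 by apply: orth1; rewrite -F3 gip // b mulr0.
exists h, d1, (w 0 k4); split => //.
  have : ip w w = -1 by rewrite gip // b /sg /=; ring.
  by rewrite ipE w0 w1 w2 w3 => e; apply: sqr_eq1; lra.
move=> u; have F4 : bas k4 *m g *m h = w 0 k4 *: bas k4.
  by apply: row5P; rewrite [RHS]mxE basE -/w ?w0 ?w1 ?w2 ?w3 /=; ring.
rewrite {1}(row_basE u) mulmxA !mulmxDl -!scalemxAl F0 F1 F2 F3 F4.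
by apply: row5P; rewrite vec5E !mxE /=; ring.
Qed.

(** This is minus the reflection in the last coordinate, a product of two half turns. It absorbs the
    sign [d4] at the price of a global sign. *)
Lemma half_turn_SO0 : exists2 h, SO0 h & forall u, u *m h =
  vec5 (- u 0 k0) (- u 0 k1) (- u 0 k2) (- u 0 k3) (u 0 k4).
Proof.
have S1 := @rotation_SO0 R k0 k1 pi isT erefl.
have S2 := @rotation_SO0 R k2 k3 pi isT erefl.
exists (plane_mx k0 k1 (cos pi) (sin pi) (- sin pi) (cos pi) *m
  plane_mx k2 k3 (cos pi) (sin pi) (- sin pi) (cos pi)); first exact: SO0M.
move=> u; rewrite mulmxA cospi sinpi.
by apply: row5P; rewrite vec5E !plane_mxE //=; ring.
Qed.

End Reduction.

(** * Time orientation of isotropic planes *)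

Section TimeOrientation.
Context {R : realType}.
Notation V := 'rV[R]_5.
Implicit Types (u v w : V) (g h : 'M[R]_5).

Definition isotropic_pair u v : Prop :=
  [/\ ip u u = 0, ip u v = 0, ip v v = 0 &
      forall a b : R, a *: u + b *: v = 0 -> a = 0 /\ b = 0].

Lemma isotropic_pair_isometry g u v : isometry g ->
  isotropic_pair u v -> isotropic_pair (u *m g) (v *m g).
Proof.
move=> ig [uu uv vv f]; split; rewrite ?ig // => a b.
rewrite !scalemxAl -mulmxDl => e; apply: f.
by rewrite -[LHS](mulmxK (isometry_unit ig)) e mul0mx.
Qed.

Lemma isotropic_pair_scale u u' (a b : R) : a != 0 -> b != 0 ->
  isotropic_pair u u' -> isotropic_pair (a *: u) (b *: u').
Proof.
move=> a0 b0 [uu uv vv ind]; split; rewrite ?ipZl ?ipZr ?uu ?uv ?vv ?mulr0 // => c d.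
rewrite !scalerA => /ind[/eqP + /eqP].
by rewrite !mulf_eq0 (negbTE a0) (negbTE b0) !orbF => /eqP-> /eqP->.
Qed.

Definition pdet u v : R := u 0 k0 * v 0 k1 - u 0 k1 * v 0 k0.

Variables w1 w2 w3 : V.
Hypothesis wneg : negative_definite_frame w1 w2 w3.

(** A linear relation would produce a vector common to a totally isotropic plane and a negative
    definite space; only 0 is. *)
Lemma dVol_isotropic_neq0 (x1 x2 x3 u v : V) :
  negative_definite_frame x1 x2 x3 -> isotropic_pair u v ->
  dVol u v x1 x2 x3 != 0.
Proof.
move=> xneg [uu uv vv f]; apply/det0P => -[c c0 cM].
have E : c 0 k0 *: u + c 0 k1 *: v
    + (c 0 k2 *: x1 + c 0 k3 *: x2 + c 0 k4 *: x3) = 0.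
  apply/rowP => i; have := congr1 (fun A : V => A 0 i) cM.
  by rewrite !mxE sum5E !mxE /= => <-; ring.
set w := (X in _ + X) in E.
have Ew : w = - (c 0 k0 *: u + c 0 k1 *: v).
  by apply/eqP; rewrite -addr_eq0 addrC E.
have ww : ip w w = 0.
  by rewrite Ew !ip_simp (ipC v u) uu uv vv; ring.
have [z|nz] := boolP [|| c 0 k2 != 0, c 0 k3 != 0 | c 0 k4 != 0].
  by have := xneg _ _ _ z; rewrite /= -/w ww ltxx.
move: nz; rewrite !negb_or !negbK => /and3P[/eqP c2 /eqP c3 /eqP c4].
have [|c00 c01] := f (c 0 k0) (c 0 k1).
  by rewrite -[LHS]opprK -Ew /w c2 c3 c4 !scale0r !addr0 oppr0.
move/eqP: c0; apply; apply: row5P; rewrite ?c00 ?c01 ?c2 ?c3 ?c4 mxE //.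
Qed.

Lemma cont_dVol (X : topologicalType) (a b c d e : X -> V) (x : X) :
  {for x, continuous a} -> {for x, continuous b} -> {for x, continuous c} ->
  {for x, continuous d} -> {for x, continuous e} ->
  {for x, continuous (fun y => dVol (a y) (b y) (c y) (d y) (e y))}.
Proof.
move=> ca cb cc cd ce; apply: cont_det; apply: cont_mx => i j.
move: i; apply: ord5_ind; set F := (F in {for _, continuous F}).
- by rewrite (_ : F = fun y => a y 0 j); [cont|apply/funext => y; rewrite /F !mxE].
- by rewrite (_ : F = fun y => b y 0 j); [cont|apply/funext => y; rewrite /F !mxE].
- by rewrite (_ : F = fun y => c y 0 j); [cont|apply/funext => y; rewrite /F !mxE].
- by rewrite (_ : F = fun y => d y 0 j); [cont|apply/funext => y; rewrite /F !mxE].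
- by rewrite (_ : F = fun y => e y 0 j); [cont|apply/funext => y; rewrite /F !mxE].
Qed.

(** The volume depends continuously on [h] in the connected set [SO0] and never vanishes there by
    [dVol_isotropic_neq0]. *)
Lemma SO0_dVol_gt0 h u v : isotropic_pair u v -> SO0 h ->
  0 < dVol u v w1 w2 w3 -> 0 < dVol (u *m h) (v *m h) w1 w2 w3.
Proof.
move=> uv Sh p.
have cS : connected (@SO0 R) by exact: component_connected.
apply: (@connected_nonvanishing_gt0 _ _ _
  (fun h : 'M[R]_5 => dVol (u *m h) (v *m h) w1 w2 w3) 1%:M h cS) => //.
- apply: continuous_subspaceT; apply: continuous_pointwise => g.
  have cM (x : V) : {for g, continuous (fun y : 'M[R]_5 => x *m y)}.
    apply: cont_mx => i j; rewrite (ord1 i).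
    rewrite (_ : (fun y => _) = fun y : 'M[R]_5 => x 0 k0 * y k0 j + x 0 k1 * y k1 j
      + x 0 k2 * y k2 j + x 0 k3 * y k3 j + x 0 k4 * y k4 j); last first.
      by apply/funext => y; rewrite mxE sum5E.
    by cont.
  by apply: cont_dVol; rewrite //; exact: cont_cst.
- move=> g Sg; apply: dVol_isotropic_neq0 => //.
  by apply: isotropic_pair_isometry => //; exact: SO0_isometry.
- exact: SO0_1.
- by rewrite !mulmx1.
Qed.

Lemma dVol_posfree u v x1 x2 x3 :
  (forall x : V, x \in [:: x1; x2; x3] -> x 0 k0 = 0 /\ x 0 k1 = 0) ->
  dVol u v x1 x2 x3 = pdet u v * dVol (bas k0) (bas k1) x1 x2 x3.
Proof.
move=> x0.
(* The size [2 + 3] exposes the block of positive coordinates of [u] and [v]; the block below it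
   vanishes. *)
pose M u v : 'M[R]_(2 + 3) := \matrix_(i < 5) nth (0 : V) [:: u; v; x1; x2; x3] i.
have D u' v' : dVol u' v' x1 x2 x3 = \det (ulsubmx (M u' v')) * \det (drsubmx (M u v)).
  have Md : drsubmx (M u' v') = drsubmx (M u v).
    by apply/matrixP => i j; rewrite !mxE.
  suff M0 : dlsubmx (M u' v') = 0.
    rewrite /dVol -[\matrix_i _]/(M u' v').
    have := submxK (M u' v'); rewrite M0 => {1}<-.
    by rewrite [LHS](@det_ublock R 2 3) Md.
  apply/matrixP => i j; rewrite !mxE /=.
  have J : j = ord0 \/ j = ord_max.
    by case: j => -[|[|//]] ?; [left|right]; apply: val_inj.
  have L0 : lshift 3 (ord0 : 'I_2) = k0 by apply: val_inj.
  have L1 : lshift 3 (ord_max : 'I_2) = k1 by apply: val_inj.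
  case: i => -[|[|[|//]]] ? /=.
  - have [e0 e1] : x1 0 k0 = 0 /\ x1 0 k1 = 0 by apply: x0; rewrite !inE eqxx.
    by case: J => ->; rewrite ?L0 ?L1 ?e0 ?e1.
  - have [e0 e1] : x2 0 k0 = 0 /\ x2 0 k1 = 0 by apply: x0; rewrite !inE eqxx orbT.
    by case: J => ->; rewrite ?L0 ?L1 ?e0 ?e1.
  - have [e0 e1] : x3 0 k0 = 0 /\ x3 0 k1 = 0 by apply: x0; rewrite !inE eqxx !orbT.
    by case: J => ->; rewrite ?L0 ?L1 ?e0 ?e1.
have E u' v' : \det (ulsubmx (M u' v')) = pdet u' v'.
  rewrite (expand_det_row _ ord0) !big_ord_recl big_ord0 /cofactor !det_mx11 !mxE /=.
  transitivity (u' 0 k0 * (1 * v' 0 k1) + (u' 0 k1 * (-1 * v' 0 k0) + 0)).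
    congr (u' 0 _ * (_ * v' 0 _) + (u' 0 _ * (_ * v' 0 _) + _));
      by [apply: val_inj | rewrite expr0 | rewrite expr1].
  by rewrite /pdet; ring.
rewrite (D u v) (D (bas k0) (bas k1)) !E.
by rewrite [pdet (bas _) _]/pdet !basE /=; ring.
Qed.

(** A path from W, at [t = 1], to its projection on the negative coordinates, at [t = 0], through
    negative definite spaces. *)
Definition squash (t : R) w : V :=
  vec5 (t * w 0 k0) (t * w 0 k1) (w 0 k2) (w 0 k3) (w 0 k4).

Lemma squash_negative t : 0 <= t <= 1 ->
  negative_definite_frame (squash t w1) (squash t w2) (squash t w3).
Proof.
move=> /andP[t0 t1] a b c abc /=; set x := a *: w1 + b *: w2 + c *: w3.
have -> : a *: squash t w1 + b *: squash t w2 + c *: squash t w3 = squash t x.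
  by apply: row5P; rewrite /x /squash !mxE /=; ring.
have := wneg abc; rewrite /= -/x !ipE /squash !vec5E.
have s0 := sqr_ge0 (x 0 k0); have s1 := sqr_ge0 (x 0 k1).
have tt : t * t <= 1 by rewrite -[1]mulr1 ler_pM.
have p0 : 0 <= (1 - t * t) * x 0 k0 ^+ 2 by rewrite mulr_ge0 // subr_ge0.
have p1 : 0 <= (1 - t * t) * x 0 k1 ^+ 2 by rewrite mulr_ge0 // subr_ge0.
by move: p0 p1; rewrite !expr2 => p0 p1 H; lra.
Qed.

(* The negative definite 3-planes transverse to every isotropic plane form a
   connected set, so the orientation against W is, up to a sign depending only
   on W, that of the projection to the positive coordinates. *)
Lemma time_orientation : exists2 e : R, e = 1 \/ e = -1 &
  forall u v, isotropic_pair u v -> 0 < dVol u v w1 w2 w3 <-> 0 < e * pdet u v.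
Proof.
pose f u v t := dVol u v (squash t w1) (squash t w2) (squash t w3).
have f1 u v : f u v 1 = dVol u v w1 w2 w3.
  rewrite /f; congr dVol; by apply: row5P; rewrite vec5E ?mul1r.
pose C := dVol (bas k0) (bas k1) (squash 0 w1) (squash 0 w2) (squash 0 w3).
have f0 u v : f u v 0 = pdet u v * C.
  apply: dVol_posfree => x; rewrite !inE => /or3P[] /eqP->;
    by rewrite !vec5E !mul0r.
have cf u v : continuous (f u v).
  apply: continuous_pointwise => t; rewrite /f /squash.
  by apply: cont_dVol; cont.
have fN0 u v t : isotropic_pair u v -> 0 <= t <= 1 -> f u v t != 0.
  by move=> uv t01; apply: dVol_isotropic_neq0 => //; exact: squash_negative.
have C0 : C != 0.
  have iso : isotropic_pair (vec5 1 0 1 0 0) (vec5 0 1 0 1 0).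
    split; rewrite ?ipE ?vec5E; try ring.
    move=> a b ab; have := congr1 (fun A : V => A 0 k0) ab.
    have := congr1 (fun A : V => A 0 k1) ab.
    by rewrite !mxE /= => ? ?; split; lra.
  have := fN0 _ _ 0 iso; rewrite lexx ler01 => /(_ isT).
  by rewrite f0 mulf_eq0 negb_or => /andP[].
exists (Num.sg C); first by case: sgrP C0 => //; [left|right].
move=> u v uv.
have pos : 0 < Num.sg C * pdet u v <-> 0 < f u v 0.
  rewrite f0; case: sgrP C0 => // C0 _.
  - by rewrite mul1r pmulr_lgt0.
  - by rewrite mulN1r oppr_gt0 nmulr_lgt0.
rewrite pos -f1; split=> [p|p].
- have c : {within `[0, 1], continuous (fun t => f u v (1 - t))}.
    apply: continuous_subspaceT; apply: continuous_pointwise => t.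
    by apply: (@continuous_comp _ _ _ (fun t : R => 1 - t) (f u v)); [cont|exact: cf].
  have := @segment_nonvanishing_gt0 _ (fun t => f u v (1 - t)) c.
  rewrite subr0 => /(_ _ p 1); rewrite subrr; apply; last by rewrite lexx ler01.
  by move=> t t01; apply: fN0 => //; lra.
- have c : {within `[0, 1], continuous (f u v)} by exact: continuous_subspaceT.
  apply: (segment_nonvanishing_gt0 c _ p); last by rewrite lexx ler01.
  by move=> t t01; apply: fN0.
Qed.

(** Two positive volumes force [d1 = 1] in [isometry_reduce], since [d1 = -1] would reverse [pdet].
    The case [d4 = -1] is minus the half turn of [half_turn_SO0]. The global sign is harmless
    because polygons live in projective space. *)
Lemma SO0_up_to_sign g u v : isometry g -> isotropic_pair u v ->
  0 < dVol u v w1 w2 w3 -> 0 < dVol (u *m g) (v *m g) w1 w2 w3 ->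
  exists2 h, SO0 h & (forall x : V, x *m h = x *m g) \/ (forall x : V, x *m h = - (x *m g)).
Proof.
move=> ig uv p pg; have [h [d1 [d4 [Sh D1 D4 E]]]] := isometry_reduce ig.
have [e e1 eP] := time_orientation.
have uvg := isotropic_pair_isometry ig uv.
have := SO0_dVol_gt0 uvg Sh pg; rewrite -!mulmxA.
have uvgh := isotropic_pair_isometry (isometryM ig (SO0_isometry Sh)) uv.
move/(eP _ _ uvgh).1; rewrite !E /pdet !vec5E.
move/(eP _ _ uv).1: p; rewrite /pdet => p.
case: D1 => d1E; last by rewrite d1E => q; lra.
move=> _; have hu := isometry_unit (SO0_isometry Sh).
case: D4 => d4E.
  exists (invmx h); first exact: SO0V.
  left=> x; rewrite -[RHS](mulmxK hu) -(mulmxA x) E d1E d4E !mul1r.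
  by congr (_ *m _); apply: row5P; rewrite vec5E.
have [k Sk kE] := @half_turn_SO0 R.
exists (k *m invmx h); first by apply: SO0M => //; exact: SO0V.
right=> x; rewrite mulmxA -[RHS](mulmxK hu) mulNmx -(mulmxA x g h) E d1E d4E kE.
by congr (_ *m _); apply: row5P; rewrite [RHS]mxE !vec5E; ring.
Qed.

End TimeOrientation.

(** * Rays of isotropic vectors *)

Section Rays.
Context {R : realType}.
Notation V := 'rV[R]_5.

Lemma ray_continuous : continuous (@ray R).
Proof. exact: pi_continuous. Qed.

Lemma line_continuous : continuous (@line R).
Proof. exact: pi_continuous. Qed.

Lemma ray_surj (r : EinHat R) : exists v, r = ray v.
Proof. by exists (repr (r : {eq_quot same_ray_rel})); rewrite /ray reprK. Qed.

Lemma EinHat_continuous (X : topologicalType) (f : EinHat R -> X) :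
  continuous (f \o @ray R) -> continuous f.
Proof. by move/quotient_continuous. Qed.

Lemma null_vector_lift (X : Type) (f : X -> V) :
  (forall x, null_vectors (f x)) ->
  exists F : X -> null_vector R, forall x, val (F x) = f x.
Proof. by move=> H; exists (fun x => SigSub (mem_set (H x))). Qed.

Lemma null_vector_lift_continuous (X : topologicalType) (f : X -> V)
  (F : X -> null_vector R) : (forall x, val (F x) = f x) -> continuous f ->
  continuous F.
Proof.
move=> Ff cf; apply: continuous_into_set_type.
by rewrite (_ : (fun x => val (F x)) = f) //; apply/funext.
Qed.

Definition tnorm (v : V) : R := Num.sqrt (v 0 k0 ^+ 2 + v 0 k1 ^+ 2).

Lemma tnormZ c v : 0 <= c -> tnorm (c *: v) = c * tnorm v.
Proof.
move=> c0; rewrite /tnorm !mxE !exprMn -mulrDr sqrtrM ?sqr_ge0 //.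
by rewrite sqrtr_sqr ger0_norm.
Qed.

Lemma tnorm_sqr v : tnorm v ^+ 2 = v 0 k0 ^+ 2 + v 0 k1 ^+ 2.
Proof. by rewrite sqr_sqrtr // addr_ge0 ?sqr_ge0. Qed.

Lemma tnorm_gt0 v : null_vectors v -> 0 < tnorm v.
Proof.
move=> [v0 vv]; rewrite sqrtr_gt0 lt0r addr_ge0 ?sqr_ge0 // andbT.
apply: contra v0 => /eqP e.
have [e0 e1] : v 0 k0 = 0 /\ v 0 k1 = 0 by apply: sqr_sum2_eq0; rewrite -!expr2.
by apply/eqP; apply: (posfree_ip_le0 e0 e1).2.
Qed.

Lemma null_valP (v : null_vector R) : null_vectors (val v).
Proof. exact: null_vectorP. Qed.

(** This is the identification of the double cover with S^1 x S^2: the positive coordinates lie on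
    the unit circle and, by isotropy, the negative ones on the unit sphere. *)
Definition unit_rep (r : EinHat R) : V :=
  let v := val (repr (r : {eq_quot same_ray_rel})) in (tnorm v)^-1 *: v.

Lemma unit_rep_ray v : unit_rep (ray v) = (tnorm (val v))^-1 *: val v.
Proof.
rewrite /unit_rep.
have /rayP[c c0 ->] : ray (repr (ray v : {eq_quot same_ray_rel})) = ray v.
  exact: reprK.
set w := repr _; have w0 := tnorm_gt0 (null_valP w).
rewrite tnormZ ?ltW // scalerA; congr (_ *: _).
by field; rewrite !gt_eqF.
Qed.

Lemma unit_repP r : null_vectors (unit_rep r) /\
  unit_rep r 0 k0 ^+ 2 + unit_rep r 0 k1 ^+ 2 = 1.
Proof.
have [v ->] := ray_surj r; rewrite unit_rep_ray.
have v0 := tnorm_gt0 (null_valP v); have [vN0 vv] := null_vectorP v.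
split; first split.
- by rewrite scaler_eq0 invr_eq0 gt_eqF.
- by rewrite !ip_simp vv !mulr0.
- rewrite -tnorm_sqr tnormZ ?invr_ge0 ?ltW // mulVf ?expr1n //.
  by rewrite gt_eqF.
Qed.

Lemma ray_unit_rep v r : val v = unit_rep r -> ray v = r.
Proof.
have [w ->] := ray_surj r; rewrite unit_rep_ray => E; symmetry; apply/rayP.
by exists (tnorm (val w))^-1; rewrite // invr_gt0; exact: tnorm_gt0 (null_valP w).
Qed.

Lemma unit_rep_inj : injective unit_rep.
Proof.
move=> r r' E; have [F FE] := @null_vector_lift _ _ (fun r => (unit_repP r).1).
by rewrite -(ray_unit_rep (FE r)) -(ray_unit_rep (etrans (FE r) E)).
Qed.

Lemma cont_tnorm (X : topologicalType) (f : X -> V) (x : X) :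
  {for x, continuous f} -> {for x, continuous (fun y => tnorm (f y))}.
Proof. by move=> cf; rewrite /tnorm; cont. Qed.

Lemma unit_rep_continuous : continuous unit_rep.
Proof.
apply: EinHat_continuous; apply: continuous_pointwise => v.
rewrite (_ : _ \o _ = fun v => (tnorm (val v))^-1 *: val v); last first.
  by apply/funext => w; rewrite /= unit_rep_ray.
have cv : {for v, continuous (val : null_vector R -> V)} by exact: val_continuous.
apply: cont_scale => //; apply: contV; last exact: cont_tnorm.
by rewrite gt_eqF // tnorm_gt0 //; exact: null_valP.
Qed.

End Rays.

Section Loops.
Context {R : realType} {X : topologicalType}.

Lemma loop_int (f : R -> X) (n : int) t : is_loop f -> f (t + n%:~R) = f t.
Proof.
move=> [_ per]; have perN (k : nat) u : f (u + k%:R) = f u.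
  by elim: k => [|k IH]; rewrite ?addr0 // -addn1 natrD addrA per.
by case: n => k; [exact: perN|rewrite NegzE -(perN k.+1) rmorphN /= subrK].
Qed.

(** Near an integer [m] the floor is [m] or [m - 1], and the two resulting translates of [h] agree
    at [m] by hypothesis. *)
Lemma periodic_glue (h : R * R -> X) : continuous h ->
  (forall s, h (s, 0) = h (s, 1)) ->
  continuous (fun p : R * R => h (p.1, p.2 - (Num.floor p.2)%:~R)).
Proof.
move=> ch h01; apply: continuous_pointwise => -[s0 t0]; set m := Num.floor t0.
have c (a : R) : {for (s0, t0), continuous (fun p : R * R => h (p.1, p.2 - a))}.
  apply: (@continuous_comp _ _ _ (fun p : R * R => (p.1, p.2 - a)) h); last exact: ch.
  by cont.
have lo : m%:~R <= t0 by exact: floor_le.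
have hi : t0 < m%:~R + 1 by have := floorD1_gt t0; rewrite intrD.
have c2 : {for (s0, t0), continuous (fun p : R * R => p.2)} by cont.
have near_lt (a : R) : t0 < a -> \forall p \near (s0, t0), (p.2 : R) < a.
  move=> ta; have : \forall t \near t0, t < a by exact: lt_nbhsl.
  exact: c2.
have near_gt (a : R) : a < t0 -> \forall p \near (s0, t0), a < (p.2 : R).
  move=> ta; have : \forall t \near t0, a < t by exact: lt_nbhsr.
  exact: c2.
have [tm|tm] := eqVneq t0 m%:~R.
  apply: (continuous_at_either (c m%:~R) (c (m%:~R - 1))) => /=.
  - by rewrite -/m.
  - by rewrite -/m tm subrr opprB addrC subrK h01.
  - have H1 := near_lt _ hi.
    have /near_gt H2 : m%:~R - 1 < t0 by rewrite tm; lra.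
    near=> p; have p1 : p.2 < m%:~R + 1 by near: p.
    have p2 : m%:~R - 1 < p.2 by near: p.
    have [pm|pm] := leP m%:~R p.2; [left|right].
      by rewrite (@floor_def _ _ m) // pm intrD.
    rewrite (@floor_def _ _ (m - 1)) ?intrB //.
    by rewrite intrD intrB subrK pm ltW // p2.
have lo' : m%:~R < t0 by rewrite lt_neqAle eq_sym tm lo.
apply: (continuous_near_eq (c m%:~R)).
have H1 := near_lt _ hi; have H2 := near_gt _ lo'.
near=> p; have p1 : p.2 < m%:~R + 1 by near: p.
have p2 : m%:~R < p.2 by near: p.
by rewrite (@floor_def _ _ m) // intrD p1 ltW.
Unshelve. all: by end_near. Qed.

End Loops.

(** * Uniform subdivisions of the unit interval *)

Section UniformSubdivision.
Context {R : realType}.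

(** A Lebesgue number argument. With [Q] built from scalar products of a path at two times, it gives
    subdivisions on whose pieces the path turns by less than a fixed angle. *)
Lemma diagonal_positive (Q : R * R -> R) : continuous Q ->
  (forall s, 0 <= s <= 1 -> 0 < Q (s, s)) ->
  exists N : nat, forall s t, 0 <= s <= 1 -> `|s - t| <= N.+1%:R^-1 -> 0 < Q (s, t).
Proof.
move=> cQ Q0.
have /compact_near_coveringP cov := @segment_compact R 0 1.
pose P (n : nat) (s : R) := forall t, `|s - t| <= n.+1%:R^-1 -> 0 < Q (s, t).
have : \forall n \near \oo, `[0 : R, 1]%classic `<=` P n.
  apply: cov => s; rewrite /= in_itv /= => s01.
  have : \forall p \near (s, s), 0 < Q p.
    by have /cQ := @lt_nbhsr _ 0 _ (Q0 s s01); apply.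
  move=> [[A B] /= [/nbhs_ballP[e e0 eA] /nbhs_ballP[d d0 dB]] AB].
  pose r := Num.min e d / 2.
  have r0 : 0 < r by rewrite divr_gt0 // lt_min e0 d0.
  have re : r + r = Num.min e d by rewrite /r; field.
  exists (ball s r, [set n | n.+1%:R^-1 < r]) => /=.
    split; first exact: nbhsx_ballx.
    exact: (near_infty_natSinv_lt (PosNum r0)).
  move=> [s' n] /= [Bs nr] t st.
  have [me md] : Num.min e d <= e /\ Num.min e d <= d by rewrite !ge_min !lexx orbT.
  apply: AB; split => /=.
    by apply: eA; apply: (@le_ball _ _ _ r) => //; rewrite (le_trans _ me) // -re; lra.
  apply: dB; apply: (@le_ball _ _ _ (r + r)); first by rewrite re.
  apply: ball_triangle Bs _; rewrite /ball /=.
  exact: le_lt_trans st nr.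
move=> [N _ H]; exists N => s t s01 st.
by apply: (H N (leqnn N) s) => //; rewrite /= in_itv.
Qed.

Lemma subinterval (N : nat) (t : R) : 0 <= t <= 1 ->
  exists2 j, (j < N.+1)%N & j%:R <= N.+1%:R * t <= j.+1%:R.
Proof.
move=> /andP[t0 t1]; elim: N => [|N IH].
  by exists 0%N => //; rewrite mul1r t0 t1.
have H (M : nat) : (0 < M)%N -> forall x : R, 0 <= x <= M%:R ->
    exists2 j, (j < M)%N & j%:R <= x <= j.+1%:R.
  elim: M => // -[|M] IHM _ x /andP[x0 x1]; first by exists 0%N; rewrite // x0.
  have [xM|xM] := leP x M.+1%:R.
    by have [|j jM jx] := IHM isT x; [rewrite x0|exists j => //; exact: leqW].
  by exists M.+1 => //; rewrite x1 ltW.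
apply: H => //; rewrite mulr_ge0 //= -[leRHS]mulr1 ler_pM2l //.
Qed.

End UniformSubdivision.

(** * Loops in the sphere and the circle *)

Section FundamentalGroup.
Context {R : realType}.
Notation V := 'rV[R]_5.
Implicit Types (u v w b : V).

Definition dot3 u v : R := u 0 k2 * v 0 k2 + u 0 k3 * v 0 k3 + u 0 k4 * v 0 k4.

Definition cross3 u v : V := vec5 0 0
  (u 0 k3 * v 0 k4 - u 0 k4 * v 0 k3)
  (u 0 k4 * v 0 k2 - u 0 k2 * v 0 k4)
  (u 0 k2 * v 0 k3 - u 0 k3 * v 0 k2).

Lemma dot3C u v : dot3 u v = dot3 v u.
Proof. by rewrite /dot3; ring. Qed.

Lemma dot3Dr u v w : dot3 u (v + w) = dot3 u v + dot3 u w.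
Proof. by rewrite /dot3 !mxE; ring. Qed.

Lemma dot3Zr a u v : dot3 u (a *: v) = a * dot3 u v.
Proof. by rewrite /dot3 !mxE; ring. Qed.

Lemma dot3_ge0 u : 0 <= dot3 u u.
Proof.
have := sqr_ge0 (u 0 k2); have := sqr_ge0 (u 0 k3); have := sqr_ge0 (u 0 k4).
by rewrite !expr2 /dot3 => *; lra.
Qed.

Lemma dot3_eq0 u v : dot3 u u = 0 -> dot3 u v = 0.
Proof. by rewrite /dot3 => /sqr_sum3_eq0[-> -> ->]; ring. Qed.

Lemma dot3_gt0 u v : dot3 u v != 0 -> 0 < dot3 u u.
Proof.
move=> uv; rewrite lt0r dot3_ge0 andbT; apply: contra uv => /eqP u0.
by apply/eqP; exact: dot3_eq0.
Qed.

Lemma lagrange3 u v :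
  dot3 (cross3 u v) (cross3 u v) = dot3 u u * dot3 v v - dot3 u v ^+ 2.
Proof. by rewrite /dot3 /cross3 !vec5E; ring. Qed.

Lemma cauchy3 u v : dot3 u v ^+ 2 <= dot3 u u * dot3 v v.
Proof. by rewrite -subr_ge0 -lagrange3 dot3_ge0. Qed.

Lemma cont_dot3 (X : topologicalType) (f g : X -> V) (x : X) :
  {for x, continuous f} -> {for x, continuous g} ->
  {for x, continuous (fun y => dot3 (f y) (g y))}.
Proof. by move=> cf cg; rewrite /dot3; cont. Qed.

(** If [w] lies in the plane of [u] and [v], a normal vector of length 1/4 is added to it; products
    with unit vectors then change by at most 1/4. *)
Lemma generic_perturbation u v w : 0 < dot3 (cross3 u v) (cross3 u v) ->
  exists y, dot3 (cross3 u v) y != 0 /\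
    forall x, dot3 x x = 1 -> dot3 x w - 1 / 4 <= dot3 x y.
Proof.
set c := cross3 u v => c0.
have [wc|wc] := eqVneq (dot3 c w) 0; last first.
  by exists w; split=> // x _; lra.
pose e : R := (4 * Num.sqrt (dot3 c c))^-1.
have s0 : 0 < Num.sqrt (dot3 c c) by rewrite sqrtr_gt0.
have e0 : 0 < e by rewrite invr_gt0 mulr_gt0.
have s2 : Num.sqrt (dot3 c c) ^+ 2 = dot3 c c by rewrite sqr_sqrtr // ltW.
exists (w + e *: c); split.
  by rewrite dot3Dr wc add0r dot3Zr mulf_neq0 // gt_eqF.
move=> x xx; rewrite dot3Dr dot3Zr lerD2l.
have : `|e * dot3 x c| <= 1 / 4; last by rewrite ler_norml => /andP[] *; lra.
rewrite -sqrtr_sqr exprMn -(ger0_norm (_ : 0 <= 1 / 4)); last lra.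
rewrite -[leRHS]sqrtr_sqr ler_sqrt ?sqr_ge0 //.
have := cauchy3 x c; rewrite xx mul1r => cau.
apply: (le_trans (_ : _ <= e ^+ 2 * dot3 c c)).
  by rewrite ler_pM2l // exprn_gt0.
rewrite -s2 -exprMn /e.
rewrite (_ : (4 * _)^-1 * _ = 1 / 4) //; field; exact: lt0r_neq0.
Qed.

(** Each vertex avoids the plane spanned by [b] and its predecessor, so that no edge of the
    resulting polygonal path meets the line of [b]. *)
Lemma generic_sequence (b : V) (f : nat -> V) : 0 < dot3 b b ->
  exists y : nat -> V, [/\
    forall k, 0 < dot3 (cross3 b (y k)) (cross3 b (y k)),
    forall k, dot3 (cross3 b (y k)) (y k.+1) != 0 &
    forall k x, dot3 x x = 1 -> dot3 x (f k.+1) - 1 / 4 <= dot3 x (y k.+1)].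
Proof.
move=> b0.
have step (p : nat * V) : exists y, 0 < dot3 (cross3 b p.2) (cross3 b p.2) ->
    dot3 (cross3 b p.2) y != 0 /\
    forall x, dot3 x x = 1 -> dot3 x (f p.1.+1) - 1 / 4 <= dot3 x y.
  have [H|H] := ltP 0 (dot3 (cross3 b p.2) (cross3 b p.2)); last first.
    by exists 0 => K; lra.
  by have [y [y1 y2]] := generic_perturbation (f p.1.+1) H; exists y.
have [st stP] := choice step.
(* The start of the sequence only has to be independent of [b]: it will not be a vertex, the first
   vertex being [b] itself. *)
have [d d0] : exists d, 0 < dot3 (cross3 b d) (cross3 b d).
  have : [|| b 0 k2 != 0, b 0 k3 != 0 | b 0 k4 != 0].
    apply: contraLR isT; rewrite !negb_or !negbK => /and3P[/eqP z2 /eqP z3 /eqP z4].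
    by move: b0; rewrite /dot3 z2 z3 z4 !mul0r !addr0 ltxx.
  have sq (x : R) : x != 0 -> 0 < x ^+ 2 by move=> x0; rewrite lt0r sqrf_eq0 x0 sqr_ge0.
  have := sqr_ge0 (b 0 k2); have := sqr_ge0 (b 0 k3); have := sqr_ge0 (b 0 k4).
  move=> q4 q3 q2 /or3P[] /sq q; [exists (vec5 0 0 0 1 0)|exists (vec5 0 0 0 0 1)
    |exists (vec5 0 0 1 0 0)]; rewrite /dot3 /cross3 !vec5E; rewrite !expr2 in q q2 q3 q4; lra.
pose y := fix y (k : nat) : V := if k is k'.+1 then st (k', y k') else d.
have inv k : 0 < dot3 (cross3 b (y k)) (cross3 b (y k)).
  elim: k => [//|k IH]; have [H _] := stP (k, y k) IH.
  rewrite /= in H; apply: (@dot3_gt0 _ (y k)).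
  rewrite (_ : dot3 (cross3 b (y k.+1)) (y k) = - dot3 (cross3 b (y k)) (y k.+1)).
    by rewrite oppr_eq0.
  by rewrite /dot3 /cross3 !vec5E; ring.
exists y; split => // k; first by have [] := stP (k, y k) (inv k).
by have [] := stP (k, y k) (inv k).
Qed.

Definition hat (x : R) : R := Num.max 0 (1 - `|x|).

Lemma cont_hat (X : topologicalType) (f : X -> R) (x : X) :
  {for x, continuous f} -> {for x, continuous (fun y => hat (f y))}.
Proof. by move=> cf; rewrite /hat; cont. Qed.

Lemma hat_eq0 x : 1 <= `|x| -> hat x = 0.
Proof. by move=> x1; apply/max_idPl; lra. Qed.

Lemma hat_abs x : `|x| <= 1 -> hat x = 1 - `|x|.
Proof. by move=> x1; apply/max_idPr; lra. Qed.

(** The piecewise linear path through [y k] at time [k]. As a sum of tent functions it is continuous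
    without any gluing. *)
Definition polygonal (n : nat) (y : nat -> V) (t : R) : V :=
  \sum_(k < n.+1) hat (t - k%:R) *: y k.

Lemma polygonal_continuous n y : continuous (polygonal n y).
Proof.
apply: continuous_pointwise => t; apply: cvg_big => [|k _].
  exact: add_continuous.
have c : {for t, continuous (fun t : R => hat (t - k%:R) *: y k)}.
  by apply: cont_scale; [apply: cont_hat; cont|exact: cont_cst].
exact: c.
Qed.

Lemma polygonalE n y t j : (j < n)%N -> j%:R <= t <= j.+1%:R ->
  polygonal n y t = (j.+1%:R - t) *: y j + (t - j%:R) *: y j.+1.
Proof.
move=> jn /andP[jt tj]; rewrite -natr1 in tj.
have jn' : (j < n.+1)%N by exact: leqW.
rewrite /polygonal (bigD1 (Ordinal jn')) //= (bigD1 (Ordinal (jn : (j.+1 < n.+1)%N))) /=; last first.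
  by rewrite -val_eqE /= gtn_eqF.
rewrite big1 ?addr0 => [|k /andP[/eqP kj /eqP kj1]].
  rewrite !hat_abs -?natr1; [congr (_ *: _ + _ *: _)| |].
  - by rewrite ger0_norm ?subr_ge0 //; ring.
  - rewrite ler0_norm; [ring|lra].
  - rewrite ler_norml; apply/andP; split; lra.
  - rewrite ler_norml; apply/andP; split; lra.
rewrite hat_eq0 ?scale0r //.
have [kj'|kj'] := ltnP k j.
  have : k.+1%:R <= j%:R :> R by rewrite ler_nat.
  by rewrite -natr1 ler_normr => H; apply/orP; left; lra.
have kj2 : (j.+2 <= k)%N.
  rewrite ltn_neqAle; apply/andP; split.
    by apply/eqP => e; apply: kj1; apply: val_inj.
  rewrite ltn_neqAle kj' andbT; apply/eqP => e; apply: kj; exact: val_inj.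
have : j.+2%:R <= k%:R :> R by rewrite ler_nat.
by rewrite -!natr1 ler_normr => H; apply/orP; right; lra.
Qed.

(* A polygonal approximation of a loop on the sphere with generic vertices
   avoids the antipode of the base point. *)
Lemma sphere_loop_contract (f : R -> V) b : continuous f ->
  (forall t, dot3 (f t) (f t) = 1) -> f 0 = b -> f 1 = b ->
  exists h : R -> V, [/\ continuous h, h 0 = b, h 1 = b &
    forall t l, 0 <= t <= 1 -> 0 <= l <= 1 ->
    0 < dot3 ((1 - l) *: f t + l *: h t) ((1 - l) *: f t + l *: h t) /\
    0 < dot3 ((1 - l) *: h t + l *: b) ((1 - l) *: h t + l *: b)].
Proof.
move=> cf f1 fb0 fb1.
have bb : dot3 b b = 1 by rewrite -fb0.
(* The bound 1/2 leaves a margin for the loss of 1/4 in [generic_perturbation]. *)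
have [||N0 HN0] := @diagonal_positive R (fun p => dot3 (f p.1) (f p.2) - 1 / 2).
- apply: continuous_pointwise => p; apply: contD; last by cont.
  by apply: cont_dot3; apply: (@continuous_comp _ _ _ _ f); by [cont|exact: cf].
- by move=> s _ /=; rewrite f1; lra.
pose N := N0.+1.
have HN s t : 0 <= s <= 1 -> `|s - t| <= N.+1%:R^-1 -> 1 / 2 < dot3 (f s) (f t).
  move=> s01 st; have := HN0 s t s01; rewrite /= subr_gt0; apply.
  by rewrite (le_trans st) // lef_pV2 ?posrE // ler_nat.
have b0 : 0 < dot3 b b by rewrite bb.
pose M := N.+1; have M0 : 0 < M%:R :> R by [].
have [g [g0 g1 g2]] := @generic_sequence b (fun k => f (k%:R / M%:R)) b0.
(* Both end vertices are reset to [b] to obtain a loop; the two edges at [b] are treated apart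
   below. *)
pose y k := if (k == 0%N) || (k == M) then b else g k.
have y0 : y 0%N = b by [].
have yM : y M = b by rewrite /y eqxx orbT.
have yk k : (0 < k < M)%N -> y k = g k.
  by move=> /andP[k0 kM]; rewrite /y gtn_eqF // ltn_eqF.
have fy k t : (k <= M)%N -> 0 <= t <= 1 -> `|t - k%:R / M%:R| <= M%:R^-1 ->
    0 < dot3 (f t) (y k).
  move=> kM t01 tk; have H := HN _ _ t01 tk.
  case: k kM tk H => [|k] kM tk H.
    by rewrite y0 -fb0; move: H; rewrite mul0r; lra.
  have [e|kM'] := eqVneq k.+1 M.
    by rewrite e yM -fb1; move: H; rewrite e divff ?gt_eqF //; lra.
  have -> : y k.+1 = g k.+1 by apply: yk; rewrite andTb ltn_neqAle kM' kM.
  by have := g2 k _ (f1 t); lra.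
exists (fun t => polygonal M y (M%:R * t)).
have h0 : polygonal M y (M%:R * 0) = b.
  rewrite (@polygonalE _ _ _ 0) ?mulr0 ?lexx ?ler01 // y0.
  by rewrite subr0 scale1r subrr scale0r addr0.
have h1 : polygonal M y (M%:R * 1) = b.
  rewrite (@polygonalE _ _ _ N) ?mulr1 ?lexx ?ler_nat ?leqnSn // yM.
  by rewrite subrr scale0r add0r -natr1 addrAC subrr add0r scale1r.
split => //.
  apply: continuous_pointwise => t.
  by apply: (@continuous_comp _ _ _ (fun t : R => M%:R * t) (polygonal M y)); [cont|exact: polygonal_continuous].
move=> t l t01 /andP[l0 l1].
have [j jM jt] := subinterval N t01; rewrite -/M in jM jt.
rewrite (polygonalE _ jM jt).
set m := _ - j%:R; have mE : j.+1%:R - M%:R * t = 1 - m by rewrite /m -natr1; ring.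
rewrite mE; have [m0 m1] : 0 <= m /\ m <= 1 by move: jt; rewrite /m -natr1 => /andP[]; split; lra.
have tj : 0 < dot3 (f t) (y j).
  apply: (fy) => //; first exact: ltnW.
  rewrite -(ler_pM2l M0) divff ?gt_eqF // -{1}(gtr0_norm M0) -normrM mulrBr.
  rewrite (mulrC M%:R (_ / _)) divfK ?gt_eqF // -/m ger0_norm //.
have tj1 : 0 < dot3 (f t) (y j.+1).
  have n1 : `|1 - m| <= 1 by rewrite ger0_norm ?gerBl // subr_ge0.
  apply: (fy) => //.
  rewrite -(ler_pM2l M0) divff ?gt_eqF // -{1}(gtr0_norm M0) -normrM mulrBr.
  by rewrite (mulrC M%:R (_ / _)) divfK ?gt_eqF // -opprB normrN mE.
have pos2 (a c p q : R) : 0 <= a -> 0 <= c -> a + c = 1 -> 0 < p -> 0 < q -> 0 < a * p + c * q.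
  move=> a0 c0 ac p0 q0; have [a0E|aN] := eqVneq a 0; last first.
    by rewrite ltr_wpDr ?mulr_ge0 ?(ltW q0) // mulr_gt0 // lt0r aN.
  have -> : c = 1 by rewrite -ac a0E add0r.
  by rewrite a0E mul0r add0r mul1r.
have l0' : 0 <= 1 - l by lra.
have m0' : 0 <= 1 - m by lra.
have sl : 1 - l + l = 1 by ring.
have sm : 1 - m + m = 1 by ring.
have dot3_pos x z : 0 < dot3 x z -> 0 < dot3 z z.
  by move=> p; apply: (@dot3_gt0 _ x); rewrite dot3C gt_eqF.
split.
  apply: (dot3_pos (f t)); rewrite dot3Dr !dot3Zr f1 dot3Dr !dot3Zr.
  by apply: (pos2) => //; apply: (pos2).
(* On the edges that start or end at [b], all the vectors involved have positive product with
   [b]. *)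
have [e|j0] := eqVneq j 0%N.
  apply: (dot3_pos b); rewrite dot3Dr !dot3Zr dot3Dr !dot3Zr bb e y0 bb.
  apply: (pos2) => //; apply: (pos2) => //.
  rewrite -{1}fb0; apply: (fy) => //; first by rewrite lexx ler01.
  by rewrite sub0r normrN mul1r ger0_norm // invr_ge0 ltW.
have [e|jN] := eqVneq j.+1 M.
  apply: (dot3_pos b); rewrite dot3Dr !dot3Zr dot3Dr !dot3Zr bb e yM bb.
  apply: (pos2) => //; apply: (pos2) => //.
  rewrite -{1}fb1; apply: (fy); [exact: ltnW|by rewrite lexx ler01|].
  rewrite -{1}(@divff _ M%:R) ?gt_eqF // -mulrBl -e -natr1 addrAC subrr add0r mul1r.
  by rewrite ger0_norm // invr_ge0.
have -> : y j = g j by apply: yk; rewrite lt0n j0 jM.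
have -> : y j.+1 = g j.+1 by apply: yk; rewrite andTb ltn_neqAle jN jM.
(* On the inner edges a vanishing combination is tested against the normal of the plane of [b] and
   [g j], then against the direction of that plane orthogonal to [b]. This forces [l = 1], where the
   combination is [b]. *)
rewrite lt0r dot3_ge0 andbT; apply/eqP => z.
have e1 := dot3_eq0 (cross3 b (g j)) z.
have e2 := dot3_eq0 (cross3 b (cross3 b (g j))) z.
have e3 := dot3_eq0 b z.
have cj : (1 - l) * m = 0.
  apply/eqP; have : (1 - l) * m * dot3 (cross3 b (g j)) (g j.+1) = 0.
    by rewrite -e1 /dot3 /cross3 !mxE /=; ring.
  by move/eqP; rewrite mulf_eq0 (negbTE (g1 j)) orbF.
have cj' : (1 - l) * (1 - m) = 0.
  apply/eqP; have : (1 - l) * (1 - m) * dot3 (cross3 b (g j)) (cross3 b (g j)) = 0.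
    transitivity (- dot3 ((1 - l) *: ((1 - m) *: g j + m *: g j.+1) + l *: b)
       (cross3 b (cross3 b (g j)))
      + (1 - l) * m * dot3 (g j.+1) (cross3 b (cross3 b (g j)))).
      by rewrite /dot3 /cross3 !mxE /=; ring.
    by rewrite e2 cj mul0r oppr0 addr0.
  by move/eqP; rewrite mulf_eq0 (gt_eqF (g0 j)) orbF.
have l1' : l = 1.
  have : (1 - l) * m + (1 - l) * (1 - m) = 1 - l by ring.
  by rewrite cj cj' addr0 => /esym/eqP; rewrite subr_eq0 => /eqP.
move: e3; rewrite l1' subrr scale0r add0r scale1r bb => /eqP.
by rewrite oner_eq0.
Qed.

End FundamentalGroup.

(** * Angle of a path in the circle *)

Section Circle.
Context {R : realType}.

Lemma asin0 : asin (0 : R) = 0.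
Proof.
rewrite -[in LHS](@sin0 R) sinK // in_itv /= oppr_le0.
by have := @pi_gt0 R => p; apply/andP; split; lra.
Qed.

Lemma asin_of_unit (d e : R) : 0 < e -> d ^+ 2 + e ^+ 2 = 1 ->
  [/\ -1 < d < 1, cos (asin d) = e & sin (asin d) = d].
Proof.
move=> e0 de; have e2 : 0 < e ^+ 2 by rewrite exprn_gt0.
have d1 : -1 < d < 1 by rewrite -ltr_norml -sqrtr_sqr -sqrtr1 ltr_sqrt //; lra.
have d1' : -1 <= d <= 1 by move: d1 => /andP[? ?]; rewrite !ltW.
split=> //; last by rewrite asinK // in_itv.
by rewrite cos_asin // -[RHS]ger0_norm ?ltW // -sqrtr_sqr; congr Num.sqrt; lra.
Qed.

(** On each piece of a fine subdivision the path turns by less than a right angle, and the turn is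
    the [asin] of its sine. The lift is the sum of these turns over all pieces. *)
Lemma circle_lift (c s : R -> R) : continuous c -> continuous s ->
  (forall t, c t ^+ 2 + s t ^+ 2 = 1) -> c 0 = 1 -> s 0 = 0 ->
  exists phi : R -> R, [/\ continuous phi, phi 0 = 0 &
    forall t, 0 <= t <= 1 -> cos (phi t) = c t /\ sin (phi t) = s t].
Proof.
move=> cc cs cs1 c0 s0.
have [||N HN] := @diagonal_positive R (fun p => c p.1 * c p.2 + s p.1 * s p.2).
- apply: continuous_pointwise => p.
  have [c1 c2] : {for p, continuous (fun p : R * R => c p.1)} /\
      {for p, continuous (fun p : R * R => c p.2)}.
    by split; [apply: (@continuous_comp _ _ _ fst c)|apply: (@continuous_comp _ _ _ snd c)];
      by [cont|exact: cc].
  have [s1 s2] : {for p, continuous (fun p : R * R => s p.1)} /\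
      {for p, continuous (fun p : R * R => s p.2)}.
    by split; [apply: (@continuous_comp _ _ _ fst s)|apply: (@continuous_comp _ _ _ snd s)];
      by [cont|exact: cs].
  by cont.
- by move=> t _ /=; rewrite -!expr2 cs1.
rewrite /= in HN.
pose M := N.+1; have M0 : 0 < M%:R :> R by [].
pose q (k : nat) : R := k%:R / M%:R.
have qS k : q k.+1 = q k + M%:R^-1 by rewrite /q -natr1 mulrDl mul1r.
have Mi : 0 < M%:R^-1 :> R by rewrite invr_gt0.
(* Time is frozen outside the piece [k], so that each summand is continuous on the whole line and
   the sum telescopes. *)
pose cl k (t : R) := Num.max (q k) (Num.min t (q k.+1)).
have cl_near k t : `|q k - cl k t| <= M%:R^-1.
  have H1 : q k <= cl k t by rewrite /cl le_max lexx.
  have H2 : cl k t <= q k.+1 by rewrite /cl ge_max ge_min lexx orbT andbT qS; lra.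
  by rewrite qS in H2; rewrite ler_norml; apply/andP; split; lra.
(* [d] and [e] are the sine and the cosine of the angle travelled on the piece [k] up to time
   [t]. *)
pose d k t := c (q k) * s (cl k t) - s (q k) * c (cl k t).
pose e k t := c (q k) * c (cl k t) + s (q k) * s (cl k t).
have q01 k : (k < M)%N -> 0 <= q k <= 1.
  move=> kM; rewrite divr_ge0 //= ler_pdivrMr // mul1r ler_nat; exact: ltnW.
have dP k t : (k < M)%N ->
    [/\ -1 < d k t < 1, cos (asin (d k t)) = e k t & sin (asin (d k t)) = d k t].
  move=> kM; apply: asin_of_unit; first exact: HN (q01 k kM) (cl_near k t).
  transitivity ((c (q k) ^+ 2 + s (q k) ^+ 2) * (c (cl k t) ^+ 2 + s (cl k t) ^+ 2)).
    by rewrite /d /e; ring.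
  by rewrite !cs1 mulr1.
pose S j t := \sum_(k < j) asin (d k t).
have SP j t : (j <= M)%N -> 0 <= t ->
    cos (S j t) = c (Num.min t (q j)) /\ sin (S j t) = s (Num.min t (q j)).
  move=> + t0; elim: j => [|j IH] jM.
    by rewrite /S big_ord0 cos0 sin0 /q mul0r (min_idPr t0) c0 s0.
  have [IHc IHs] := IH (ltnW jM).
  have -> : S j.+1 t = S j t + asin (d j t) by rewrite /S big_ord_recr.
  have [tq|tq] := ltP t (q j).
    have cj : cl j t = q j.
      by rewrite /cl; apply/max_idPl; rewrite ge_min ltW.
    have -> : d j t = 0 by rewrite /d cj; ring.
    rewrite asin0 addr0 IHc IHs !(min_idPl _) ?ltW // qS; lra.
  have clE : cl j t = Num.min t (q j.+1).
    by rewrite /cl; apply/max_idPr; rewrite le_min tq qS; lra.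
  have [_ ce se] := dP j t jM.
  rewrite cosD sinD ce se IHc IHs (min_idPr tq) -clE.
  have u := cs1 (q j).
  split.
    transitivity ((c (q j) ^+ 2 + s (q j) ^+ 2) * c (cl j t)); first by rewrite /d /e; ring.
    by rewrite u mul1r.
  transitivity ((c (q j) ^+ 2 + s (q j) ^+ 2) * s (cl j t)); first by rewrite /d /e; ring.
  by rewrite u mul1r.
exists (S M); split.
- apply: continuous_pointwise => t; apply: cvg_big => [|k _]; first exact: add_continuous.
  have ccl : {for t, continuous (cl k)} by rewrite /cl; cont.
  have cd : {for t, continuous (d k)}.
    have c1 : {for t, continuous (fun t => s (cl k t))}.
      by apply: (@continuous_comp _ _ _ (cl k) s) => //; exact: cs.
    have c2 : {for t, continuous (fun t => c (cl k t))}.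
      by apply: (@continuous_comp _ _ _ (cl k) c) => //; exact: cc.
    by rewrite /d; cont.
  apply: (@continuous_comp _ _ _ (d k) asin) => //.
  by apply: continuous_asin; have [] := dP k t (ltn_ord k).
- have := cl_near; rewrite /S => _; apply: big1 => k _.
  have ck : cl k 0 = q k.
    rewrite /cl; apply/max_idPl; rewrite ge_min divr_ge0 //.
  have -> : d k 0 = 0 by rewrite /d ck; ring.
  exact: asin0.
- move=> t /andP[t0 t1]; have := SP M t (leqnn M) t0.
  by rewrite /q divff ?gt_eqF // (min_idPl t1).
Qed.

Lemma cos_sin_period (n : int) (x : R) :
  cos (x + n%:~R * (2 * pi)) = cos x /\ sin (x + n%:~R * (2 * pi)) = sin x.
Proof.
have P (k : nat) (y : R) : cos (y + k%:R * (2 * pi)) = cos y /\ sin (y + k%:R * (2 * pi)) = sin y.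
  rewrite (mulr_natl _ k) (mulr_natl _ 2).
  by rewrite (periodicn (@cosD2pi R)) (periodicn (@sinD2pi R)).
case: n => k; first exact: P.
have [Pc Ps] := P k.+1 (x + (Negz k)%:~R * (2 * pi)).
have E : x + (Negz k)%:~R * (2 * pi) + k.+1%:R * (2 * pi) = x.
  by rewrite NegzE rmorphN /= mulNr -addrA addNr addr0.
by rewrite -Pc -Ps E.
Qed.

Lemma cos_eq1 (x : R) : cos x = 1 -> exists n : int, x = n%:~R * (2 * pi).
Proof.
move=> x1; have pi0 := @pi_gt0 R; set n := Num.floor (x / (2 * pi)).
have p0 : 0 < 2 * pi :> R by lra.
pose y := x - n%:~R * (2 * pi).
have y1 : cos y = 1.
  have [+ _] := cos_sin_period (- n) x; rewrite rmorphN /= mulNr -/y => ->.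
  exact: x1.
have y0 : 0 <= y by rewrite subr_ge0 -ler_pdivlMr // floor_le.
have y2 : y < 2 * pi.
  by rewrite ltrBlDr -{1}[2 * pi]mul1r -mulrDl -ltr_pdivrMr // addrC -intrD1 floorD1_gt.
exists n; apply/eqP; rewrite -subr_eq0 -/y.
have inj := @cos_inj R.
have [yp|yp] := leP y pi.
  by apply/eqP; apply: inj; rewrite ?in_itv /= ?y0 ?yp ?lexx ?ltW // y1 cos0.
have : 2 * pi - y = 0.
  apply: inj.
  - by rewrite in_itv /=; apply/andP; split; lra.
  - by rewrite in_itv /= lexx ltW.
  - have [+ _] := cos_sin_period 1 (- y); rewrite mul1r addrC => ->.
    by rewrite cosN y1 cos0.
by move=> ?; lra.
Qed.

End Circle.

(** * The fundamental group of the double cover *)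

Section Generator.
Context {R : realType}.
Notation V := 'rV[R]_5.

(** A retraction of the line onto [0, 1]: composing with it extends paths and homotopies given on
    the unit interval. *)
Definition clamp (x : R) : R := Num.max 0 (Num.min x 1).

Lemma clamp01 x : 0 <= clamp x <= 1.
Proof. by rewrite /clamp le_max lexx /= ge_max ge_min lexx orbT ler01. Qed.

Lemma clamp_id x : 0 <= x <= 1 -> clamp x = x.
Proof. by move=> /andP[x0 x1]; rewrite /clamp (min_idPl x1) (max_idPr x0). Qed.

Lemma unit_rep_dot3 (r : EinHat R) : dot3 (unit_rep r) (unit_rep r) = 1.
Proof.
have [[_ +] <-] := unit_repP r; rewrite ipE /dot3 !expr2 => H; lra.
Qed.

(** The degree [n] of [g] on the circle factor selects the power of [f]. On the circle the homotopy
    interpolates the lifted angles; on the sphere both loops are contracted to the base point. *)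
Lemma generates_pi1_of_angle (f : R -> EinHat R) : is_loop f ->
  (forall t, unit_rep (f t) 0 k0 = cos (2 * pi * t) /\
             unit_rep (f t) 0 k1 = sin (2 * pi * t)) ->
  generates_pi1 f.
Proof.
move=> lf fa g lg gf0.
have cg : continuous (fun t => unit_rep (g t)).
  by move=> t; apply: continuous_comp; [exact: lg.1|exact: unit_rep_continuous].
have cf : continuous (fun t => unit_rep (f t)).
  by move=> t; apply: continuous_comp; [exact: lf.1|exact: unit_rep_continuous].
have [fc0 fs0] := fa 0; rewrite mulr0 cos0 sin0 in fc0 fs0.
have g1 : g 1 = g 0 by rewrite -[in LHS](add0r 1) lg.2.
have [phi [cphi phi0 phiP]] : exists phi : R -> R, [/\ continuous phi, phi 0 = 0 &
    forall t, 0 <= t <= 1 -> cos (phi t) = unit_rep (g t) 0 k0 /\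
      sin (phi t) = unit_rep (g t) 0 k1].
  apply: circle_lift; rewrite ?gf0 //.
  - by apply: continuous_pointwise => t; apply: cont_coord; exact: cg.
  - by apply: continuous_pointwise => t; apply: cont_coord; exact: cg.
  - by move=> t; exact: (unit_repP (g t)).2.
have i1 : 0 <= (1 : R) <= 1 by rewrite lexx ler01.
have i0 : 0 <= (0 : R) <= 1 by rewrite lexx ler01.
have [n nE] : exists n : int, phi 1 = n%:~R * (2 * pi).
  by apply: cos_eq1; have [-> _] := phiP 1 i1; rewrite g1 gf0.
exists n.
set b := unit_rep (f 0).
pose fn t := f (n%:~R * t).
have cfn : continuous (fun t => unit_rep (fn t)).
  apply: continuous_pointwise => t.
  apply: (@continuous_comp _ _ _ (fun t : R => n%:~R * t) (fun t => unit_rep (f t))).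
    by cont.
  exact: cf.
have fn1 : fn 1 = f 0 by rewrite /fn mulr1 -[n%:~R]add0r loop_int.
have fn0 : fn 0 = f 0 by rewrite /fn mulr0.
have [hg [chg hg0 hg1 hgP]] := @sphere_loop_contract R _ b cg
  (fun t => unit_rep_dot3 (g t)) (congr1 unit_rep gf0)
  (congr1 unit_rep (etrans g1 gf0)).
have [hf [chf hf0 hf1 hfP]] := @sphere_loop_contract R _ b cfn
  (fun t => unit_rep_dot3 (fn t)) (congr1 unit_rep fn0) (congr1 unit_rep fn1).
(* The sphere part passes through five stages in four linear moves: [g] is contracted to [b], then
   the contraction of the power of [f] is run backwards. *)
pose stage t k : V := nth 0 [:: unit_rep (g t); hg t; b; hf t; unit_rep (fn t)] k.
have cstage k : continuous (stage^~ k).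
  apply: continuous_pointwise => t; case: k => [|[|[|[|[|k]]]]].
  - exact: cg.
  - exact: chg.
  - exact: cont_cst.
  - exact: chf.
  - exact: cfn.
  - by rewrite (_ : stage^~ _ = fun=> 0); [exact: cont_cst|apply/funext => u; rewrite /stage /= nth_nil].
pose Y s t : V := polygonal 4 (stage t) (4 * s).
have YE s t : 0 <= s <= 1 -> 0 <= t <= 1 -> exists (j : nat) (l : R),
    [/\ (j < 4)%N, 0 <= l <= 1 & Y s t = (1 - l) *: stage t j + l *: stage t j.+1].
  move=> s01 t01; have [j j4 js] := subinterval 3 s01.
  exists j, (4 * s - j%:R); have js' := js; rewrite -(@natr1 _ j) in js'; split => //.
    by move: js' => /andP[? ?]; apply/andP; split; lra.
  rewrite /Y (polygonalE _ j4 js) -(@natr1 _ j).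
  by congr (_ *: _ + _); ring.
have Y0 s t : 0 <= s <= 1 -> t = 0 \/ t = 1 -> Y s t = b.
  move=> s01 t01; have [|j [l [j4 _ ->]]] := YE s t s01.
    by case: t01 => ->.
  have st k : (k < 5)%N -> stage t k = b.
    case: t01 => ->; case: k => [|[|[|[|[|//]]]]] _; rewrite /stage /= ?hg0 ?hg1 ?hf0 ?hf1 ?fn0 ?fn1 ?g1 ?gf0 //.
  rewrite (st j (ltnW j4)) (st j.+1 j4).
  by rewrite -scalerDl subrK scale1r.
have Ypos s t : 0 <= s <= 1 -> 0 <= t <= 1 -> 0 < dot3 (Y s t) (Y s t).
  move=> s01 t01; have [j [l [j4 l01 ->]]] := YE s t s01 t01.
  have l01' : 0 <= 1 - l <= 1 by move: l01 => /andP[? ?]; apply/andP; split; lra.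
  case: j j4 => [|[|[|[|//]]]] _; rewrite /stage /=.
  - exact: (hgP t l t01 l01).1.
  - exact: (hgP t l t01 l01).2.
  - by have := (hfP t (1 - l) t01 l01').2; rewrite subKr (addrC (l *: _)).
  - by have := (hfP t (1 - l) t01 l01').1; rewrite subKr (addrC (l *: _)).
have YL t : Y 0 t = unit_rep (g t).
  rewrite /Y (@polygonalE _ _ _ _ 0) ?mulr0 ?lexx ?ler01 //.
  by rewrite !subr0 scale1r scale0r addr0.
have YR t : Y 1 t = unit_rep (fn t).
  rewrite /Y mulr1 (@polygonalE _ _ _ _ 3) ?lexx ?ler_nat //.
  by rewrite subrr scale0r add0r -natr1 addrAC subrr add0r scale1r.
pose th s t := (1 - s) * phi t + s * (n%:~R * (2 * pi * t)).
(* The angle [th] on the circle and the normalised [Y] on the sphere. [Ypos] makes the division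
   legitimate, and both factors being unit vectors makes [v] isotropic. *)
pose v (p : R * R) : V := let s := clamp p.1 in let t := clamp p.2 in
  let y := Y s t in let r := Num.sqrt (dot3 y y) in
  vec5 (cos (th s t)) (sin (th s t)) (y 0 k2 / r) (y 0 k3 / r) (y 0 k4 / r).
have vnull p : null_vectors (v p).
  rewrite /v; set s := clamp _; set t := clamp _; set y := Y s t.
  have y0 : 0 < dot3 y y by apply: Ypos; exact: clamp01.
  set r := Num.sqrt _; have r0 : 0 < r by rewrite sqrtr_gt0.
  have r2 : r ^+ 2 = dot3 y y by rewrite sqr_sqrtr // ltW.
  split.
    apply/eqP => v0; have := congr1 (fun w : V => w 0 k0 ^+ 2 + w 0 k1 ^+ 2) v0.
    by rewrite /= !vec5E cos2Dsin2 !mxE expr0n addr0 => /eqP; rewrite oner_eq0.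
  rewrite ipE !vec5E; transitivity ((cos (th s t) ^+ 2 + sin (th s t) ^+ 2) - dot3 y y / r ^+ 2).
    by rewrite /dot3; field; rewrite gt_eqF.
  by rewrite cos2Dsin2 r2 divff ?subrr // gt_eqF.
have cclamp : continuous clamp by apply: continuous_pointwise => x; rewrite /clamp; cont.
have cv : continuous v.
  apply: continuous_pointwise => p.
  have c1 : {for p, continuous (fun p : R * R => clamp p.1)}.
    by apply: (@continuous_comp _ _ _ fst clamp); [cont|exact: cclamp].
  have c2 : {for p, continuous (fun p : R * R => clamp p.2)}.
    by apply: (@continuous_comp _ _ _ snd clamp); [cont|exact: cclamp].
  have c3 : {for p, continuous (fun p : R * R => phi (clamp p.2))}.
    by apply: (@continuous_comp _ _ _ (fun p : R * R => clamp p.2) phi) => //; exact: cphi.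
  have cY : {for p, continuous (fun p : R * R => Y (clamp p.1) (clamp p.2))}.
    apply: cvg_big => [|k _]; first exact: add_continuous.
    have cs : {for p, continuous (fun p : R * R => stage (clamp p.2) k)}.
      by apply: (@continuous_comp _ _ _ (fun p : R * R => clamp p.2) (stage^~ k)) => //; exact: cstage.
    have ch : {for p, continuous (fun p : R * R => hat (4 * clamp p.1 - k%:R))}.
      by apply: cont_hat; cont.
    exact: cont_scale ch cs.
  have cr : {for p, continuous (fun p : R * R =>
      (Num.sqrt (dot3 (Y (clamp p.1) (clamp p.2)) (Y (clamp p.1) (clamp p.2))))^-1)}.
    apply: contV; first by rewrite gt_eqF // sqrtr_gt0 Ypos ?clamp01.
    by apply: cont_sqrt; exact: cont_dot3.
  have cth : {for p, continuous (fun p : R * R => th (clamp p.1) (clamp p.2))}.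
    by rewrite /th; cont.
  apply: cont_vec5; [exact: cont_cos|exact: cont_sin|..];
    by apply: contM => //; exact: cont_coord.
have [F FE] := null_vector_lift vnull.
pose h p := ray (F p).
have ch : continuous h.
  apply: continuous_pointwise => p.
  apply: (@continuous_comp _ _ _ F (@ray R)); last exact: ray_continuous.
  exact: null_vector_lift_continuous FE cv p.
have cl0 : clamp 0 = 0 by exact: clamp_id.
have cl1 : clamp 1 = 1 by exact: clamp_id.
have v01 s : v (s, 0) = v (s, 1).
  rewrite /v /= cl0 cl1.
  have Yc t : t = 0 \/ t = 1 -> Y (clamp s) t = b by apply: Y0; exact: clamp01.
  rewrite (Yc 0) ?(Yc 1); [|by right|by left].
  have -> : th (clamp s) 0 = 0 by rewrite /th phi0; ring.
  have -> : th (clamp s) 1 = 0 + n%:~R * (2 * pi) by rewrite /th nE; ring.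
  by have [-> ->] := cos_sin_period n (0 : R).
have h01 s : h (s, 0) = h (s, 1).
  by congr ray; apply: val_inj; rewrite /= !FE v01.
have frac01 (t : R) : 0 <= t - (Num.floor t)%:~R <= 1.
  have := floorD1_gt t; have := floor_le t; rewrite intrD1 => ? ?.
  by apply/andP; split; lra.
(* The homotopy is built on the unit square only and extended periodically in the second
   variable. *)
exists (fun p => h (p.1, p.2 - (Num.floor p.2)%:~R)); split.
- exact: periodic_glue ch h01.
- move=> t /=; set u := t - _.
  rewrite -(loop_int (- Num.floor t) t lg) rmorphN /= -/u.
  apply: ray_unit_rep; rewrite FE /v /= cl0 clamp_id ?frac01 // YL unit_rep_dot3 sqrtr1 !divr1.
  have -> : th 0 u = phi u by rewrite /th; ring.
  have [-> ->] := phiP u (frac01 t).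
  by apply: row5P; rewrite vec5E.
- move=> t /=; set u := t - _.
  have -> : f (n%:~R * t) = fn u.
    rewrite /fn -(loop_int (- (n * Num.floor t)) _ lf); congr f.
    by rewrite rmorphN rmorphM /= /u; ring.
  apply: ray_unit_rep; rewrite FE /v /= cl1 clamp_id ?frac01 // YR unit_rep_dot3 sqrtr1 !divr1.
  have -> : th 1 u = 2 * pi * (n%:~R * u) by rewrite /th; ring.
  have [e0 e1] := fa (n%:~R * u).
  by apply: row5P; rewrite vec5E // -?e0 -?e1.
- move=> s t /=; congr (h (s, _)).
  by rewrite floorDrz // floor1 intrD; ring.
- move=> s /=; rewrite floor0 subrr; apply: ray_unit_rep.
  rewrite FE /v /= cl0 Y0 ?clamp01 //; last by left.
  have -> : th (clamp s) 0 = 0 by rewrite /th phi0; ring.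
  rewrite unit_rep_dot3 sqrtr1 !divr1 cos0 sin0.
  by apply: row5P; rewrite vec5E gf0 ?fc0 ?fs0.
Qed.

End Generator.

(** * Polygons with given vertices *)

Section Hexagons.
Context {R : realType}.
Notation V := 'rV[R]_5.
Notation "''S' i" := (@ordS 6 i) (at level 8, i at level 2).

(** Equality is included, so that this is exactly the pattern of vanishing products in a negative
    hexagon. *)
Definition cyc_adj (i j : 'I_6) : bool := [|| j == i, j == 'S i | i == 'S j].

Lemma cyc_adjC i j : cyc_adj i j = cyc_adj j i.
Proof. by rewrite /cyc_adj eq_sym; congr (_ || _); rewrite orbC. Qed.

Lemma cyc_adj_S i : cyc_adj i ('S i).
Proof. by rewrite /cyc_adj eqxx orbT. Qed.

Lemma cyc_adjxx i : cyc_adj i i.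
Proof. by rewrite /cyc_adj eqxx. Qed.

Lemma cyc_adj_edge i j : cyc_adj i j -> cyc_adj ('S i) j -> j = i \/ j = 'S i.
Proof.
by case: i j => [[|[|[|[|[|[|//]]]]]] hi] [[|[|[|[|[|[|//]]]]]] hj] //= _ _;
  (left; exact: val_inj) || (right; exact: val_inj).
Qed.

Lemma edge_inj i j : (j = i \/ j = 'S i) -> ('S j = i \/ 'S j = 'S i) -> i = j.
Proof.
case: i j => [[|[|[|[|[|[|//]]]]]] hi] [[|[|[|[|[|[|//]]]]]] hj] [] e [] e';
  apply: val_inj => //; by [move/(congr1 val): e | move/(congr1 val): e'].
Qed.

(** The product with vertex [j] kills vertex ['S i] but not vertex [i], so it reads off the first
    coefficient of a combination of the two; [cyc_adj_before] does this for the second one. *)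
Lemma cyc_adj_after i : exists j, cyc_adj ('S i) j && ~~ cyc_adj i j.
Proof.
by exists ('S ('S i)); case: i => [[|[|[|[|[|[|//]]]]]] hi].
Qed.

Lemma cyc_adj_before i : exists j, cyc_adj i j && ~~ cyc_adj ('S i) j.
Proof.
by exists ('S ('S ('S ('S ('S i))))); case: i => [[|[|[|[|[|[|//]]]]]] hi].
Qed.

Lemma cyc_adj_opposite i : exists j, ~~ cyc_adj i j && ~~ cyc_adj ('S i) j.
Proof.
by exists ('S ('S ('S i))); case: i => [[|[|[|[|[|[|//]]]]]] hi].
Qed.

Lemma comb_le0 (a b p q : R) : 0 <= a -> 0 <= b -> p <= 0 -> q <= 0 ->
  a * p + b * q <= 0.
Proof.
by move=> a0 b0 p0 q0; rewrite -[leRHS]addr0 lerD // mulr_ge0_le0.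
Qed.

Lemma comb_lt0 (a b p q : R) : 0 <= a -> 0 <= b -> 0 < a + b -> p < 0 -> q < 0 ->
  a * p + b * q < 0.
Proof.
move=> a0 b0 ab p0 q0; have [z|aN] := eqVneq a 0.
  by rewrite z add0r in ab; rewrite z mul0r add0r pmulr_rlt0.
have e1 : a * p < 0 by rewrite pmulr_rlt0 // lt0r aN.
have e2 : b * q <= 0 by rewrite mulr_ge0_le0 // ltW.
lra.
Qed.

Lemma comb_eq0 (a b p q : R) : 0 < a -> 0 < b -> p <= 0 -> q <= 0 ->
  a * p + b * q = 0 -> p = 0 /\ q = 0.
Proof.
move=> a0 b0 p0 q0 e.
have e1 : a * p <= 0 by rewrite pmulr_rle0.
have e2 : b * q <= 0 by rewrite pmulr_rle0.
have /eqP : a * p = 0 by lra.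
have /eqP : b * q = 0 by lra.
by rewrite !mulf_eq0 (gt_eqF a0) (gt_eqF b0) /= => /eqP-> /eqP->.
Qed.

Lemma dim_plane (u w : V) :
  (forall a b : R, a *: u + b *: w = 0 -> a = 0 /\ b = 0) ->
  \dim (<[u]> + <[w]>)%VS = 2.
Proof.
move=> ind.
have u0 : u != 0.
  apply/eqP => z; have [] := ind 1 0; first by rewrite z scaler0 scale0r addr0.
  by move/eqP; rewrite oner_eq0.
have w0 : w != 0.
  apply/eqP => z; have [] := ind 0 1; first by rewrite z scaler0 scale0r addr0.
  by move=> _ /eqP; rewrite oner_eq0.
rewrite dimv_disjoint_sum ?dim_vline ?u0 ?w0 //; apply/eqP; rewrite -subv0.
apply/subvP => y /memv_capP[/vlineP[a ->] /vlineP[b E]].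
have [|a0 _] := ind a (- b); first by rewrite E scaleNr subrr.
by rewrite a0 scale0r mem0v.
Qed.

Definition negative_hexagon (v : 'I_6 -> V) : Prop :=
  forall i j, if cyc_adj i j then ip (v i) (v j) = 0 else ip (v i) (v j) < 0.

Section Fixed.
Variable x : 'I_6 -> null_vector R.
Notation v i := (val (x i)).
Hypothesis hx : negative_hexagon (fun i => v i).

Lemma hex_adj i j : cyc_adj i j -> ip (v i) (v j) = 0.
Proof. by move=> a; have := hx i j; rewrite a. Qed.

Lemma hex_nadj i j : ~~ cyc_adj i j -> ip (v i) (v j) < 0.
Proof. by move=> a; have := hx i j; rewrite (negbTE a). Qed.

Lemma hex_le0 i j : ip (v i) (v j) <= 0.
Proof.
by case: (boolP (cyc_adj i j)) => a; [rewrite hex_adj|rewrite ltW ?hex_nadj].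
Qed.

Lemma hex_isotropic_pair i : isotropic_pair (v i) (v ('S i)).
Proof.
split; rewrite ?hex_adj ?cyc_adjxx ?cyc_adj_S // => a b ab.
have [j /andP[j1 j2]] := cyc_adj_after i.
have [k /andP[l1 l2]] := cyc_adj_before i.
have P l : a * ip (v i) (v l) + b * ip (v ('S i)) (v l) = 0.
  by rewrite -!ipZl -ipDl ab ip0l.
have := P j; rewrite (hex_adj j1) mulr0 addr0 => /eqP.
rewrite mulf_eq0 (lt_eqF (hex_nadj j2)) orbF => /eqP ->.
have := P k; rewrite (hex_adj l1) mulr0 add0r => /eqP.
by rewrite mulf_eq0 (lt_eqF (hex_nadj l2)) orbF => /eqP ->.
Qed.

Definition in_sector i (a b : R) (w : V) : Prop :=
  [/\ 0 <= a, 0 <= b, 0 < a + b & w = a *: v i + b *: v ('S i)].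

Lemma sector_le0 i a b w j : in_sector i a b w -> ip w (v j) <= 0.
Proof.
move=> [a0 b0 _ ->]; rewrite ipDl !ipZl.
by apply: comb_le0 => //; exact: hex_le0.
Qed.

Lemma sector_lt0 i a b w : in_sector i a b w -> exists j, ip w (v j) < 0.
Proof.
move=> [a0 b0 ab ->]; have [j /andP[/hex_nadj n1 /hex_nadj n2]] := cyc_adj_opposite i.
by exists j; rewrite ipDl !ipZl; exact: comb_lt0.
Qed.

Lemma sector_null i a b w : in_sector i a b w -> null_vectors w.
Proof.
move=> s; have [j lt] := sector_lt0 s; case: s => a0 b0 ab E; split.
  by apply: contraTneq lt => ->; rewrite ip0l ltxx.
by rewrite E !ip_simp !hex_adj ?cyc_adjxx ?cyc_adj_S 1?cyc_adjC ?cyc_adj_S //; ring.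
Qed.

Definition hex_cone : set (null_vector R) :=
  [set w | exists i a b, in_sector i a b (val w)].

Definition hex_edge i : set (Ein R) :=
  line @` [set w | exists a b, in_sector i a b (val w)].

Definition hex_polygon : marked_polygon 6 :=
  MarkedPolygon (fun i => line (x i)) hex_edge.

Definition hex_lifted : lifted_polygon 6 :=
  LiftedPolygon hex_polygon hex_cone (fun i => ray (x i)).

Lemma sector_vertex i : in_sector i 1 0 (v i).
Proof. by split; rewrite ?ler01 ?addr0 ?ltr01 // scale1r scale0r addr0. Qed.

Lemma sector_next i : in_sector i 0 1 (v ('S i)).
Proof. by split; rewrite ?ler01 ?add0r ?ltr01 // scale1r scale0r add0r. Qed.

Lemma cone_vertex i : hex_cone (x i).
Proof. by exists i, 1, 0; exact: sector_vertex. Qed.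

Lemma edge_sector i a b (w : null_vector R) : in_sector i a b (val w) ->
  hex_edge i (line w).
Proof. by move=> s; exists w => //; exists a, b. Qed.

(** The product with this vector is negative on the whole cone, and thus tells the chosen lift from
    its antipode. *)
Definition axis : V := \sum_j v j.

Lemma cone_axis w : hex_cone w -> ip (val w) axis < 0.
Proof.
move=> [i [a [b s]]]; have [j lt] := sector_lt0 s.
rewrite /axis (bigD1 j) //= ipDr -[ltRHS]addr0 ltr_leD //.
elim/big_ind: _ => [|y z y0 z0|k _]; first by rewrite ip0r.
  by rewrite ipDr -[leRHS]addr0 lerD.
exact: sector_le0 s.
Qed.

Lemma cone_same_line u w : hex_cone u -> hex_cone w -> line u = line w ->
  exists2 c : R, 0 < c & val w = c *: val u.
Proof.
move=> /cone_axis cu /cone_axis cw /lineP[c c0 E]; exists c => //.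
by move: cw; rewrite E ipZl nmulr_llt0.
Qed.

(** Both terms of the product are non-positive with positive coefficients, so vertex [j] is
    orthogonal to both ends of the edge. *)
Lemma interior_zero i a b w j : 0 < a -> 0 < b -> w = a *: v i + b *: v ('S i) ->
  ip w (v j) = 0 -> j = i \/ j = 'S i.
Proof.
move=> a0 b0 ->; rewrite ipDl !ipZl => e.
have n1 := hex_le0 i j; have n2 := hex_le0 ('S i) j.
have [z1 z2] := comb_eq0 a0 b0 n1 n2 e.
by apply: cyc_adj_edge; apply: contraT => /hex_nadj; rewrite ?z1 ?z2 ltxx.
Qed.

Lemma edge_vertices i : hex_edge i (line (x i)) /\ hex_edge i (line (x ('S i))).
Proof.
by split; apply: edge_sector; [exact: sector_vertex|exact: sector_next].
Qed.

Lemma sector_boundary i a b (w : null_vector R) : in_sector i a b (val w) ->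
  a = 0 \/ b = 0 -> [set line (x i); line (x ('S i))] (line w).
Proof.
move=> [a0 b0 ab E] [z|z]; rewrite z ?addr0 ?add0r in ab E.
  right; symmetry; apply/lineP; exists b; rewrite ?gt_eqF //.
  by rewrite E scale0r add0r.
left; symmetry; apply/lineP; exists a; rewrite ?gt_eqF //.
by rewrite E scale0r addr0.
Qed.

Lemma sector_scale i a b w c : 0 < c -> in_sector i a b w ->
  in_sector i (c * a) (c * b) (c *: w).
Proof.
move=> c0 [a0 b0 ab ->]; split; rewrite ?mulr_ge0 ?(ltW c0) //.
  by rewrite -mulrDr mulr_gt0.
by rewrite scalerDr !scalerA.
Qed.

(** An interior point of the edge [i] is orthogonal to no vertices but its two ends. If it also lay
    on the edge [j], it would be orthogonal to both ends of [j], whence [i = j]. *)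
Lemma edge_boundary i j u : i != j -> hex_edge i u -> hex_edge j u ->
  [set line (x i); line (x ('S i))] u.
Proof.
move=> ij [w [a [b s]] <-] [w' [a' [b' s']] E].
have [c c0 wc] : exists2 c : R, 0 < c & val w' = c *: val w.
  by apply: cone_same_line; [exists i, a, b|exists j, a', b'|].
have [//|aN] := eqVneq a 0; first by move=> z; apply: (sector_boundary s); left.
have [//|bN] := eqVneq b 0; first by move=> z; apply: (sector_boundary s); right.
have [a0 b0 _ wE] := s.
have Z k : ip (val w') (v k) = 0 -> k = i \/ k = 'S i.
  rewrite wc ipZl => /eqP; rewrite mulf_eq0 gt_eqF //= => /eqP.
  by apply: interior_zero wE; rewrite lt0r ?aN ?bN.
have [_ _ _ w'E] := s'.
have /eqP[] := ij; apply: edge_inj; apply: Z; rewrite w'E ipDl !ipZl.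
  by rewrite !hex_adj ?cyc_adjxx 1?cyc_adjC ?cyc_adj_S // !mulr0 addr0.
by rewrite !hex_adj ?cyc_adjxx ?cyc_adj_S // !mulr0 addr0.
Qed.

Lemma edge_intersection i j : i != j -> hex_edge i `&` hex_edge j =
  [set line (x i); line (x ('S i))] `&` [set line (x j); line (x ('S j))].
Proof.
move=> ij; apply/seteqP; split=> u [].
  move=> ui uj; split; first exact: edge_boundary uj.
  by apply: edge_boundary ui; rewrite // eq_sym.
have [e1 e2] := edge_vertices i; have [e3 e4] := edge_vertices j.
by move=> [->|->] [h|h]; split => //; rewrite h.
Qed.

(** Collinear vertices have the same orthogonality pattern, and the pattern determines the
    vertex. *)
Lemma hex_vertex_inj : injective (fun i => line (x i)).
Proof.
move=> i j; have [//|ij /lineP[c c0 E]] := eqVneq i j.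
exfalso.
have H k : cyc_adj i k = cyc_adj j k.
  have : (ip (v j) (v k) == 0) = (ip (v i) (v k) == 0).
    by rewrite E ipZl mulf_eq0 (negbTE c0).
  have := hx i k; have := hx j k.
  by case: (cyc_adj i k); case: (cyc_adj j k) => // h1 h2;
    rewrite ?h1 ?h2 ?eqxx // ?(lt_eqF h1) ?(lt_eqF h2).
by move: H ij; case: i j {E} => [[|[|[|[|[|[|//]]]]]] hi] [[|[|[|[|[|[|//]]]]]] hj] //= H _;
  have := H (Ordinal hi); have := H (Ordinal hj);
  have := H ('S (Ordinal hi)); have := H ('S (Ordinal hj)).
Qed.

Lemma hex_edge_arc i : is_arc R (hex_edge i) (line (x i)) (line (x ('S i))).
Proof.
pose w (t : R) : V := (1 - clamp t) *: v i + clamp t *: v ('S i).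
have sw t : in_sector i (1 - clamp t) (clamp t) (w t).
  by have /andP[? ?] := clamp01 t; split => //; lra.
have [F FE] := null_vector_lift (fun t => sector_null (sw t)).
have cw : continuous w.
  apply: continuous_pointwise => t; rewrite /w.
  have cc : {for t, continuous clamp} by rewrite /clamp; cont.
  by apply: cont_add_row; cont.
have i0 : 0 <= (0 : R) <= 1 by rewrite lexx ler01.
have i1 : 0 <= (1 : R) <= 1 by rewrite lexx ler01.
exists (fun t => line (F t)); split.
- apply: continuous_subspaceT; apply: continuous_pointwise => t.
  apply: (@continuous_comp _ _ _ F (@line R)); last exact: line_continuous.
  exact: null_vector_lift_continuous FE cw t.
- move=> s t; rewrite !in_itv /= => s01 t01 /lineP[c c0].
  rewrite !FE /w !clamp_id // => E.
  have [_ _ _ ind] := hex_isotropic_pair i.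
  have [|e1 e2] := ind (1 - t - c * (1 - s)) (t - c * s).
    move/eqP: E; rewrite -subr_eq0 scalerDr !scalerA => /eqP <-.
    by rewrite !scalerBl opprD addrACA.
  have c1 : c = 1 by lra.
  by move: e2; rewrite c1 mul1r => /eqP; rewrite subr_eq0 => /eqP.
- congr line; apply: val_inj; rewrite FE /w clamp_id //.
  by rewrite subr0 scale1r scale0r addr0.
- congr line; apply: val_inj; rewrite FE /w clamp_id //.
  by rewrite subrr scale1r scale0r add0r.
- apply/seteqP; split=> u.
    move=> [y [a [b [a0 b0 ab E]]] <-]; exists (b / (a + b)).
      by rewrite /= in_itv /= divr_ge0 ?(ltW ab) //= ler_pdivrMr // mul1r lerDr.
    apply/lineP; exists (a + b); first by rewrite gt_eqF.
    rewrite FE /w clamp_id; last by rewrite divr_ge0 ?(ltW ab) //= ler_pdivrMr // mul1r lerDr.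
    rewrite E scalerDr !scalerA; congr (_ *: _ + _ *: _); field; rewrite gt_eqF //.
  by move=> [t _ <-]; exists (F t) => //; exists (1 - clamp t), (clamp t); rewrite FE.
Qed.

Lemma hex_edge_photon i : exists2 A, is_photon A & hex_edge i `<=` A.
Proof.
have [uu uv vv ind] := hex_isotropic_pair i.
pose U := (<[v i]> + <[v ('S i)]>)%VS.
exists [set line w | w in [set w : null_vector R | val w \in U]]; last first.
  move=> u [w [a [b [_ _ _ E]]] <-]; exists w => //=; rewrite E.
  by apply: memv_add; rewrite memvZ // memv_line.
exists U; split => //; first exact: dim_plane.
move=> y z /memv_addP[y1 /vlineP[a ->] [y2 /vlineP[b ->] ->]].
move=> /memv_addP[z1 /vlineP[c ->] [z2 /vlineP[d ->] ->]].
by rewrite !ip_simp uu uv (ipC (v ('S i))) uv vv; ring.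
Qed.

Lemma hex_lightlike : lightlike_polygon hex_polygon.
Proof.
split => //.
- exact: hex_vertex_inj.
- exact: hex_edge_arc.
- exact: edge_intersection.
- exact: hex_edge_photon.
Qed.

Lemma cone_interior u : hex_cone u ->
  (exists i (a : R), 0 < a /\ val u = a *: v i) \/
  (exists i (a b : R), [/\ 0 < a, 0 < b & val u = a *: v i + b *: v ('S i)]).
Proof.
move=> [i [a [b [a0 b0 ab E]]]].
have [z|aN] := eqVneq a 0.
  by left; exists ('S i), b; rewrite z add0r in ab; rewrite E z scale0r add0r.
have [z|bN] := eqVneq b 0.
  by left; exists i, a; rewrite z addr0 in ab; rewrite E z scale0r addr0.
by right; exists i, a, b; rewrite !lt0r aN bN.
Qed.

Lemma sector_of_vertex i j (a : R) : 0 < a -> (j = i \/ j = 'S i) ->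
  exists b c, in_sector i b c (a *: v j).
Proof.
move=> a0 [->|->].
  by exists (a * 1), (a * 0); apply: sector_scale => //; exact: sector_vertex.
by exists (a * 0), (a * 1); apply: sector_scale => //; exact: sector_next.
Qed.

Lemma cone_orthogonal u w : hex_cone u -> hex_cone w -> ip (val u) (val w) = 0 ->
  exists i, (exists a b, in_sector i a b (val u)) /\ (exists a b, in_sector i a b (val w)).
Proof.
have A i a b j (c : R) u' : 0 < a -> 0 < b -> 0 < c -> u' = a *: v i + b *: v ('S i) ->
    ip u' (c *: v j) = 0 ->
    (exists a b, in_sector i a b u') /\ (exists a b, in_sector i a b (c *: v j)).
  move=> a0 b0 c0 E; rewrite ipZr => /eqP; rewrite mulf_eq0 gt_eqF //= => /eqP o.
  split; first by exists a, b; split; rewrite ?ltW // addr_gt0.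
  by apply: sector_of_vertex => //; apply: interior_zero E o.
move=> /cone_interior[[i [a [a0 ->]]]|[i [a [b [a0 b0 Eu]]]]]
  /cone_interior[[j [c [c0 ->]]]|[j [c [d [c0 d0 Ew]]]]].
- rewrite ipZl ipZr => /eqP; rewrite !mulf_eq0 (gt_eqF a0) (gt_eqF c0) /= => /eqP o.
  have : cyc_adj i j by apply: contraT => /hex_nadj; rewrite o ltxx.
  case/or3P => /eqP ji.
  + by exists i; split; apply: sector_of_vertex; rewrite ?ji; auto.
  + by exists i; split; apply: sector_of_vertex; rewrite ?ji; auto.
  + by exists j; split; apply: sector_of_vertex; rewrite ?ji; auto.
- by rewrite ipC => o; have [s1 s2] := A _ _ _ _ _ _ c0 d0 a0 Ew o; exists j.
- by move=> o; have [s1 s2] := A _ _ _ _ _ _ a0 b0 c0 Eu o; exists i.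
- rewrite {1}Ew ipDr !ipZr => o.
  have su : in_sector i a b (val u) by split; rewrite ?ltW // addr_gt0.
  have n1 := sector_le0 j su; have n2 := sector_le0 ('S j) su.
  have [/(interior_zero a0 b0 Eu) z1 /(interior_zero a0 b0 Eu) z2] := comb_eq0 c0 d0 n1 n2 o.
  exists i; split; first by exists a, b.
  exists c, d; rewrite (edge_inj z1 z2).
  by split; rewrite ?ltW // addr_gt0.
Qed.

Lemma hex_negative_lift : negative_lift hex_polygon hex_cone.
Proof.
move=> u w Cu Cw _; split.
  have [i [a [b s]]] := Cu; have [j [c [d [c0 d0 _ ->]]]] := Cw.
  by rewrite ipDr !ipZr; apply: comb_le0 => //; exact: sector_le0 s.
split=> [uw0|[i [ui wi]]].
  have [i [[a [b s]] [c [d s']]]] := cone_orthogonal Cu Cw uw0.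
  by exists i; split; [exact: edge_sector s|exact: edge_sector s'].
have [u' [a [b [_ _ _ Eu]]] /lineP[k _ ku]] := ui.
have [w' [c [d [_ _ _ Ew]]] /lineP[l _ lw]] := wi.
rewrite ku lw Eu Ew !ip_simp !hex_adj ?cyc_adjxx ?cyc_adj_S 1?cyc_adjC ?cyc_adj_S //.
by ring.
Qed.

Lemma hex_support_cone y : polygon_support hex_polygon y <->
  exists2 w, hex_cone w & y = line w.
Proof.
split=> [[i _ [w [a [b s]] <-]]|[w [i [a [b s]]] ->]].
  by exists w => //; exists i, a, b.
by exists i => //; exact: edge_sector s.
Qed.

(** Over a line the section picks the ray whose product with [axis] is negative. Near the line of a
    point of the cone its continuity comes from that of [ray], because [line] maps open sets to open
    sets. *)
Lemma hex_is_lift : is_lift (polygon_support hex_polygon) hex_cone.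
Proof.
pose sgn_vec (u : V) : V := (if ip u axis < 0 then 1 else -1) *: u.
have sN (u : null_vector R) : null_vectors (sgn_vec (val u)).
  have [u0 uu] := null_vectorP u; rewrite /sgn_vec; split.
    by rewrite scaler_eq0 (negbTE u0) orbF; case: ifP; rewrite ?oppr_eq0 oner_eq0.
  by rewrite ipZl ipZr uu !mulr0.
have [F FE] := null_vector_lift sN.
pose s (y : Ein R) := ray (F (repr (y : {eq_quot same_line_rel}))).
have sE u : ip (val u) axis != 0 -> s (line u) = ray (F u).
  move=> u0; apply/rayP; set u' := repr _.
  have /lineP[c c0 E] : line u' = line u by exact: reprK.
  rewrite E ipZl in u0; have u'0 : ip (val u') axis != 0.
    by apply: contra u0 => /eqP->; rewrite mulr0.
  exists `|c|; first by rewrite normr_gt0.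
  rewrite !FE /sgn_vec E ipZl !scalerA; congr (_ *: _).
  have [cp|cn] := ltP 0 c.
    by rewrite pmulr_rlt0 // gtr0_norm // mulrC.
  have cn' : c < 0 by rewrite lt_neqAle c0.
  rewrite nmulr_rlt0 // ltr0_norm //.
  by case: ltgtP u'0 => //= _ _; rewrite ?mul1r ?mulr1 ?mulN1r ?mulrN1 ?opprK.
have sC w : hex_cone w -> s (line w) = ray w.
  move=> /cone_axis lt; rewrite sE ?lt_eqF //.
  by congr ray; apply: val_inj; rewrite FE /sgn_vec lt scale1r.
exists s; split.
- apply: continuous_in_subspaceT => y; rewrite inE => /hex_support_cone[w Cw ->].
  move=> A; rewrite sC // => nA.
  have cr : {for w, continuous (@ray R)} by exact: ray_continuous.
  have /cr : nbhs (ray w) A by [].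
  rewrite /= => nw.
  have ax : \forall u \near w, ip (val u) axis < 0.
    have c : {for w, continuous (fun u : null_vector R => ip (val u) axis)}.
      by apply: cont_ip; [exact: val_continuous|exact: cont_cst].
    have := @lt_nbhsl _ _ 0 (cone_axis Cw).
    by move=> /c.
  have : nbhs w [set u | A (ray u) /\ ip (val u) axis < 0] by exact: filterI.
  rewrite nbhsE => -[B [oB Bw] BA].
  (* the lines meeting B form an open set: B is saturated by homotheties *)
  have oL : open (@line R @` B).
    rewrite /open /= /quotient_open.
    rewrite (_ : _ @^-1` _ = \bigcup_(c in [set c : R | c != 0])
      [set u | exists2 u', B u' & val u' = c *: val u]); last first.
      apply/seteqP; split=> u.
        by move=> [u' Bu' /esym/lineP[c c0 E]]; exists c => //; exists u'.
      move=> [c c0 [u' Bu' E]]; exists u' => //.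
      by apply/esym/lineP; exists c.
    apply: bigcup_open => c c0.
    have zN (u : null_vector R) : null_vectors (c *: val u).
      have [u0 uu] := null_vectorP u; split; first by rewrite scaler_eq0 negb_or c0.
      by rewrite ipZl ipZr uu !mulr0.
    have [G GE] := null_vector_lift zN.
    have cG : continuous G.
      apply: (null_vector_lift_continuous GE); apply: continuous_pointwise => u.
      by apply: cont_scale; [exact: cont_cst|exact: val_continuous].
    rewrite (_ : [set u | _] = G @^-1` B); first by apply: open_comp => // u _; exact: cG.
    apply/seteqP; split=> u /=.
      by move=> [u' Bu' E]; rewrite (_ : G u = u') //; apply: val_inj; exact: etrans (GE u) (esym E).
    by move=> Bu; exists (G u) => //; rewrite GE.
  have : nbhs (line w) (line @` B) by apply: open_nbhs_nbhs; split => //; exists w.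
  change (nbhs (line w) (line @` B) -> nbhs (line w) (s @^-1` A)).
  apply: filterS => _ [u Bu <-] /=.
  have [Au lt] := BA u Bu.
  rewrite sE ?lt_eqF // (_ : F u = u) //.
  by apply: val_inj; rewrite FE /sgn_vec lt scale1r.
- by move=> y /hex_support_cone[w Cw ->]; rewrite sC // double_cover_ray.
- apply/seteqP; split=> w.
    by move=> Cw; exists (line w); [apply/hex_support_cone; exists w|exact: sC].
  move=> [y /hex_support_cone[w' Cw' ->]]; rewrite sC // => /rayP[c c0 E].
  have [i [a [b sw]]] := Cw'; exists i, (c * a), (c * b); rewrite E.
  exact: sector_scale.
Qed.

End Fixed.
End Hexagons.

(** * Hexagons winding once around the positive plane *)

Section TimeStructure.
Context {R : realType}.
Notation V := 'rV[R]_5.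
Notation "''S' i" := (@ordS 6 i) (at level 8, i at level 2).

Definition shift6 (n : nat) (i : 'I_6) : 'I_6 := iter n (@ordS 6) i.

Lemma shift6_6 i : shift6 6 i = i.
Proof. by apply: val_inj; case: i => [[|[|[|[|[|[|//]]]]]] hi]. Qed.

Lemma ord_predS n i : ord_pred (shift6 n.+1 i) = shift6 n i.
Proof. exact: ordSK. Qed.

Lemma ord_pred0 i : ord_pred i = shift6 5 i.
Proof. by rewrite -{1}(shift6_6 i) ord_predS. Qed.

Lemma sum_shift6 (W : nmodType) (F : 'I_6 -> W) i : \sum_j F j =
  F i + F (shift6 1 i) + F (shift6 2 i) + F (shift6 3 i) + F (shift6 4 i)
  + F (shift6 5 i).
Proof.
pose h (n : 'I_6) : 'I_6 := shift6 n i.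
have hinj : injective h.
  move=> a b /(congr1 val); rewrite /h; move: a b {h}.
  case: i => [[|[|[|[|[|[|//]]]]]] hi] [[|[|[|[|[|[|//]]]]]] ha] [[|[|[|[|[|[|//]]]]]] hb] //= _;
    exact: val_inj.
rewrite (reindex_inj hinj) /= !big_ord_recl big_ord0 addr0 !addrA.
by [].
Qed.

Section Fixed.
Variables (x : 'I_6 -> null_vector R) (e : R).
Notation v i := (val (x i)).
Hypothesis hx : negative_hexagon (fun i => v i).
Hypothesis e1 : e = 1 \/ e = -1.

Let ee : e * e = 1.
Proof. by case: e1 => ->; ring. Qed.

Let P u w : R := e * pdet u w.

(** With the next three hypotheses, the projections of the vertices to the positive plane form a
    centrally symmetric hexagon that winds around the origin in the sense given by [e]. *)
Hypothesis P1 : forall i, 0 < P (v i) (v ('S i)).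
Hypothesis P2 : forall i, 0 <= P (v i) (v ('S ('S i))).
Hypothesis opp0 : forall i, v (shift6 3 i) 0 k0 = - v i 0 k0.
Hypothesis opp1 : forall i, v (shift6 3 i) 0 k1 = - v i 0 k1.

Let PC u w : P u w = - P w u.
Proof. by rewrite /P /pdet; ring. Qed.

Let PDl u u' w a b : P (a *: u + b *: u') w = a * P u w + b * P u' w.
Proof. by rewrite /P /pdet !mxE; ring. Qed.

Let PDr u u' w a b : P w (a *: u + b *: u') = a * P w u + b * P w u'.
Proof. by rewrite /P /pdet !mxE; ring. Qed.

(** The coefficient of vertex [j], by Cramer's rule in the positive plane: the first quotient gives
    it on the sector before [j], the second on the sector after [j], and on the other sectors the
    minimum is not positive. One formula covers all sectors, so the section is continuous without
    gluing. *)
Definition sector_weight (d : V) (j : 'I_6) : R :=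
  Num.max 0 (Num.min
    (e * pdet (v (ord_pred j)) d / (e * pdet (v (ord_pred j)) (v j)))
    (e * pdet d (v ('S j)) / (e * pdet (v j) (v ('S j))))).

Definition cone_section (d : V) : V := \sum_j sector_weight d j *: v j.

Lemma weight0l d j n : P (v (shift6 n j)) d <= 0 ->
  sector_weight d (shift6 n.+1 j) = 0.
Proof.
move=> H; apply/max_idPl; rewrite ge_min ord_predS; apply/orP; left.
by rewrite ler_pdivrMr ?mul0r //; exact: P1.
Qed.

Lemma weight0r d j n : P d (v (shift6 n.+1 j)) <= 0 ->
  sector_weight d (shift6 n j) = 0.
Proof.
move=> H; apply/max_idPl; rewrite ge_min; apply/orP; right.
by rewrite ler_pdivrMr ?mul0r //; exact: P1.
Qed.

Lemma cone_section_sector i a b w : in_sector x i a b w -> cone_section w = w.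
Proof.
move=> [a0 b0 ab wE].
have Pii j : P (v j) (v j) = 0 by rewrite /P /pdet; ring.
have P3 j : P (v j) (v (shift6 3 j)) = 0 by rewrite /P /pdet opp0 opp1; ring.
have Pm u j : P u (v (shift6 3 j)) = - P u (v j) by rewrite /P /pdet opp0 opp1; ring.
have S1 := P1 i; have S2 := P2 i; have S1' := P1 (shift6 1 i).
have S5 : P (v (shift6 5 i)) (v i) = P (v (shift6 2 i)) (v (shift6 3 i)).
  by rewrite -[shift6 5 i]/(shift6 3 (shift6 2 i)) /P /pdet !opp0 !opp1; ring.
have w0 : sector_weight w i = a.
  rewrite /sector_weight ord_pred0 -/(P _ _) wE.
  rewrite -/(P (v (shift6 5 i)) _) -/(P (v (shift6 5 i)) (v i)) -/(P (_ + _) _) -/(P (v i) _).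
  rewrite PDr PDl Pii mulr0 addr0 mulfK ?gt_eqF //.
  have Q : 0 < P (v (shift6 5 i)) (v i) by rewrite S5; exact: (P1 (shift6 2 i)).
  have Q' : P (v (shift6 5 i)) (v ('S i)) = P (v ('S i)) (v ('S ('S i))).
    by rewrite -[shift6 5 i]/(shift6 3 ('S ('S i))) /P /pdet !opp0 !opp1; ring.
  have Q'' : 0 <= P (v (shift6 5 i)) (v ('S i)) by rewrite Q' ltW.
  rewrite (min_idPr _) ?(max_idPr a0) //.
  by rewrite ler_pdivlMr // lerDl mulr_ge0.
have w1 : sector_weight w (shift6 1 i) = b.
  rewrite /sector_weight ord_predS -/(P _ _) wE.
  rewrite -/(P (v i) _) -/(P (v i) (v (shift6 1 i))) -/(P (_ + _) _) -/(P (v ('S i)) _).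
  rewrite PDr PDl Pii mulr0 add0r mulfK ?gt_eqF //.
  rewrite (min_idPl _) ?(max_idPr b0) //.
  by rewrite ler_pdivlMr ?S1' // lerDr mulr_ge0.
have w2 : sector_weight w (shift6 2 i) = 0.
  by apply: weight0l; rewrite wE PDr Pii mulr0 addr0 PC mulrN oppr_le0 mulr_ge0 // ltW.
have w3 : sector_weight w (shift6 3 i) = 0.
  apply: weight0l; rewrite wE PDr (PC _ (v i)) (PC _ (v ('S i))) !mulrN -opprD oppr_le0.
  by rewrite addr_ge0 // mulr_ge0 // ltW.
have w4 : sector_weight w (shift6 4 i) = 0.
  apply: weight0r; rewrite wE PDl -[shift6 5 i]/(shift6 3 (shift6 2 i)) !Pm // !mulrN -opprD oppr_le0.
  by rewrite addr_ge0 // mulr_ge0 // ltW.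
have w5 : sector_weight w (shift6 5 i) = 0.
  apply: weight0r; rewrite shift6_6 wE PDl Pii mulr0 add0r PC mulrN oppr_le0.
  by rewrite mulr_ge0 // ltW.
rewrite /cone_section (sum_shift6 _ i) w0 w1 w2 w3 w4 w5 !scale0r !addr0.
by rewrite wE.
Qed.

(** The determinants of the successive vertices with [d] change sign after three steps, by central
    symmetry. The sector where they pass from non-negative to non-positive contains the direction
    [d]. *)
Lemma sector_cover (d : V) : (d 0 k0 != 0) || (d 0 k1 != 0) ->
  exists i a b w, [/\ in_sector x i a b w, w 0 k0 = d 0 k0 & w 0 k1 = d 0 k1].
Proof.
move=> d0.
pose s n := P (v (shift6 n ord0)) d.
have s3 n : s n.+3 = - s n.
  by rewrite /s -[shift6 n.+3 _]/(shift6 3 (shift6 n _)) /P /pdet opp0 opp1; ring.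
have s6 : s 6 = s 0 by rewrite /s shift6_6.
have [n sn sn1] : exists2 n, 0 <= s n & s n.+1 <= 0.
  have [p0|p0] := leP 0 (s 0%N).
    have p3 : s 3 <= 0 by rewrite s3 oppr_le0.
    have [p1|p1] := leP (s 1%N) 0; first by exists 0%N.
    have [p2|p2] := leP (s 2%N) 0; first by exists 1%N => //; exact: ltW.
    by exists 2%N => //; exact: ltW.
  have p3 : 0 <= s 3 by rewrite s3 oppr_ge0 ltW.
  have [p4|p4] := leP (s 4%N) 0; first by exists 3%N.
  have [p5|p5] := leP (s 5%N) 0; first by exists 4%N => //; exact: ltW.
  by exists 5%N; [exact: ltW|rewrite s6 ltW].
set i := shift6 n ord0 in sn sn1 *.
have D := P1 i; set D0 := P _ _ in D.
pose b := s n / D0; pose a := - s n.+1 / D0.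
have a0 : 0 <= a by rewrite divr_ge0 ?oppr_ge0 // ltW.
have b0 : 0 <= b by rewrite divr_ge0 // ltW.
have DN : D0 != 0 by rewrite gt_eqF.
have K (p q y z : R) : p / D0 * y + q / D0 * z = (p * y + q * z) / D0 by ring.
have c0 : a * v i 0 k0 + b * v ('S i) 0 k0 = d 0 k0.
  rewrite /a /b /s -/i -[shift6 n.+1 _]/('S i).
  apply: (mulIf DN); rewrite K divfK //.
  by rewrite /D0 /P /pdet; ring.
have c1 : a * v i 0 k1 + b * v ('S i) 0 k1 = d 0 k1.
  rewrite /a /b /s -/i -[shift6 n.+1 _]/('S i).
  apply: (mulIf DN); rewrite K divfK //.
  by rewrite /D0 /P /pdet; ring.
exists i, a, b, (a *: v i + b *: v ('S i)); split; last 2 first.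
- by rewrite !mxE c0.
- by rewrite !mxE c1.
split => //; rewrite lt0r addr_ge0 // andbT; apply/eqP => z.
have [az bz] : a = 0 /\ b = 0 by split; lra.
by move: d0; rewrite -c0 -c1 az bz !mul0r addr0 eqxx.
Qed.

Lemma cone_section_continuous : continuous cone_section.
Proof.
rewrite /cone_section; apply: continuous_big => [|j _]; first exact: add_continuous.
apply: continuous_pointwise => d; apply: cont_scale; last exact: cont_cst.
by rewrite /sector_weight /pdet; cont.
Qed.

Lemma cone_section_time (c : R) (d d' : V) : d 0 k0 = d' 0 k0 -> d 0 k1 = d' 0 k1 ->
  cone_section d = cone_section d'.
Proof.
move=> E0 E1; apply: eq_bigr => j _; congr (_ *: _).
by rewrite /sector_weight /pdet E0 E1.
Qed.

Lemma hex_generating_lift : generating_lift (hex_cone x).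
Proof.
pose dir (t : R) : V := vec5 (cos (2 * pi * t)) (sin (2 * pi * t)) 0 0 0.
have dirN t : (dir t 0 k0 != 0) || (dir t 0 k1 != 0).
  rewrite !vec5E -negb_and; apply/negP => /andP[/eqP c0 /eqP s0].
  have := cos2Dsin2 (2 * pi * t); rewrite c0 s0 expr0n addr0 => /eqP.
  by rewrite eq_sym oner_eq0.
pose w t := cone_section (dir t).
have wP t : [/\ exists i a b, in_sector x i a b (w t), w t 0 k0 = cos (2 * pi * t) &
    w t 0 k1 = sin (2 * pi * t)].
  have [i [a [b [u [su u0 u1]]]]] := sector_cover (dirN t).
  have -> : w t = u.
    by rewrite -(cone_section_sector su); apply: cone_section_time.
  by split; rewrite ?u0 ?u1 ?vec5E //; exists i, a, b.
have wnull t : null_vectors (w t).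
  by have [[i [a [b s]]] _ _] := wP t; exact: sector_null hx _ _ _ _ s.
have [F FE] := null_vector_lift wnull.
have cw : continuous w.
  apply: continuous_pointwise => t.
  apply: (@continuous_comp _ _ _ dir cone_section); last exact: cone_section_continuous.
  by rewrite /dir; cont.
have tn t : tnorm (w t) = 1.
  by have [_ c0 c1] := wP t; rewrite /tnorm c0 c1 cos2Dsin2 sqrtr1.
have uF t : unit_rep (ray (F t)) = w t.
  by rewrite unit_rep_ray FE tn invr1 scale1r.
have lf : is_loop (fun t => ray (F t)).
  split.
    apply: continuous_pointwise => t.
    apply: (@continuous_comp _ _ _ F (@ray R)); last exact: ray_continuous.
    exact: null_vector_lift_continuous FE cw t.
  move=> t; congr ray; apply: val_inj; rewrite /= !FE /w; congr cone_section.
  rewrite /dir mulrDr mulr1.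
  have [+ +] := cos_sin_period 1 (2 * pi * t).
  by rewrite mul1r => -> ->.
exists (fun t => ray (F t)); split => //.
- move=> s t; rewrite !in_itv /= => /andP[s0 s1] /andP[t0 t1] /(congr1 unit_rep).
  rewrite !uF => E.
  have [_ cs ss] := wP s; have [_ ct st] := wP t; rewrite -E cs in ct; rewrite -E ss in st.
  have : cos (2 * pi * (s - t)) = 1.
    rewrite mulrBr cosB -{1}ct -{1}st -!expr2 ct st; exact: cos2Dsin2.
  move/cos_eq1 => [n nE]; have p0 := @pi_gt0 R.
  have {}nE : s - t = n%:~R.
    apply: (@mulfI _ (2 * pi)); first by rewrite mulf_neq0 ?gt_eqF.
    by rewrite nE mulrC.
  have n1 : `|n%:~R : R| < 1 by rewrite -nE ltr_norml; apply/andP; split; lra.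
  have n0 : n = 0.
    by move: n1; rewrite -intr_norm (ltr_int R _ 1) => n1; lia.
  by move: nE; rewrite n0 => ?; lra.
- apply/seteqP; split=> r.
    move=> [t _ <-]; exists (F t) => //.
    by have [[i [a [b s]]] _ _] := wP t; exists i, a, b; rewrite FE.
  move=> [u [i [a [b s]]] <-].
  have t0 := tnorm_gt0 (null_valP u).
  have ti : 0 < (tnorm (val u))^-1 by rewrite invr_gt0.
  have s' := sector_scale ti s; rewrite -unit_rep_ray in s'.
  have [_ /polar_angle[th [c0 c1]]] := unit_repP (ray u).
  have p0 := @pi_gt0 R; have p2 : 2 * pi != 0 :> R by rewrite mulf_neq0 ?gt_eqF.
  set n := Num.floor (th / (2 * pi)); exists (th / (2 * pi) - n%:~R).
    rewrite /= in_itv /= subr_ge0 floor_le /=.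
    by rewrite ltrBlDr addrC -intrD1 floorD1_gt.
  apply: unit_rep_inj; rewrite uF -[RHS](cone_section_sector s').
  have E : 2 * pi * (th / (2 * pi) - n%:~R) = th + (- n)%:~R * (2 * pi).
    by rewrite rmorphN /= mulNr mulrBr mulrCA divff // mulr1 mulrC.
  have [E0 E1] := cos_sin_period (- n) th.
  by apply: cone_section_time => //; rewrite /dir vec5E E ?c0 ?c1 ?E0 ?E1.
- apply: generates_pi1_of_angle => // t; rewrite uF.
  by have [_ -> ->] := wP t.
Qed.

Lemma hex_future_directed (w1 w2 w3 : V) :
  (forall u u', isotropic_pair u u' -> 0 < dVol u u' w1 w2 w3 <-> 0 < e * pdet u u') ->
  future_directed w1 w2 w3 (hex_polygon x) (hex_cone x).
Proof.
move=> eP i u u' Cu Cu' Eu Eu'.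
have [a a0 uE] := cone_same_line hx (cone_vertex x i) Cu (esym Eu).
have [b b0 u'E] := cone_same_line hx (cone_vertex x ('S i)) Cu' (esym Eu').
apply/eP; rewrite uE u'E.
  exact: isotropic_pair_scale (lt0r_neq0 a0) (lt0r_neq0 b0) (hex_isotropic_pair hx i).
have -> : e * pdet (a *: v i) (b *: v ('S i)) = a * b * P (v i) (v ('S i)).
  by rewrite /P /pdet !mxE; ring.
by apply: mulr_gt0; [exact: mulr_gt0|exact: P1].
Qed.

Lemma hex_future_negative (w1 w2 w3 : V) :
  (forall u u', isotropic_pair u u' -> 0 < dVol u u' w1 w2 w3 <-> 0 < e * pdet u u') ->
  future_negative_lifted w1 w2 w3 (hex_lifted x).
Proof.
move=> eP; split; first split.
- exact: hex_lightlike.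
- exact: hex_is_lift.
- exact: hex_negative_lift.
- exact: hex_generating_lift.
- exact: hex_future_directed.
- move=> i; split; last exact: double_cover_ray.
  by exists (x i) => //; exact: cone_vertex.
Qed.

End Fixed.
End TimeStructure.

(** * Vertices of a polygon *)

(** Factoring through the subtype of [B] turns continuity within [B] into plain continuity of the
    composite. *)
Lemma within_continuous_total_comp (X Y Z : topologicalType) (B : set Y)
    (g : Y -> Z) (F : X -> Y) : {within B, continuous g} -> continuous F ->
  (forall x, B (F x)) -> continuous (g \o F).
Proof.
move=> /subspace_sigL_continuousP cg cF BF.
pose F' x : set_type B := SigSub (mem_set (BF x)).
have cF' : continuous F' by exact: continuous_into_set_type.
by move=> x; apply: (@continuous_comp _ _ _ F' (sigL B g) x); [exact: cF'|exact: cg].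
Qed.

Section FromPolygon.
Context {R : realType}.
Notation V := 'rV[R]_5.
Notation "''S' i" := (@ordS 6 i) (at level 8, i at level 2).

(* On the circle of rays of an isotropic plane, a path from u to w that avoids
   the antipodes of u and w and is injective runs along the short arc: the
   coordinate (a - b) / max(a, b) makes this an intermediate value argument. *)
Lemma arc_short (u w : V) (a b : R -> R) (f : R -> Ein R) (F : R -> null_vector R) :
  (forall y z : R, y *: u + z *: w = 0 -> y = 0 /\ z = 0) ->
  continuous a -> continuous b -> {in `[0, 1] &, injective f} ->
  (forall t, 0 <= t <= 1 -> line (F t) = f t /\ val (F t) = a t *: u + b t *: w) ->
  0 < a 0 -> b 0 = 0 -> a 1 = 0 -> 0 < b 1 ->
  f @` `[0, 1] = line @` [set y | exists p q : R,
    [/\ 0 <= p, 0 <= q, 0 < p + q & val y = p *: u + q *: w]].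
Proof.
move=> ind ca cb finj FE a0 b0 a1 b1.
have i0 : 0 <= (0 : R) <= 1 by rewrite lexx ler01.
have i1 : 0 <= (1 : R) <= 1 by rewrite lexx ler01.
pose m t := Num.max (a t) (b t).
have cm : continuous m.
  by apply: continuous_pointwise => t; apply: cont_max; [exact: ca|exact: cb].
have prop t t' (c : R) : 0 <= t <= 1 -> 0 <= t' <= 1 -> c != 0 ->
    a t' = c * a t -> b t' = c * b t -> t = t'.
  move=> t01 t01' c0 ea eb; apply: finj; rewrite ?in_itv //.
  have [<- v1] := FE t t01; have [<- v2] := FE t' t01'.
  by apply/lineP; exists c => //; rewrite v1 v2 ea eb scalerDr !scalerA.
have nz t : 0 <= t <= 1 -> a t != 0 \/ b t != 0.
  move=> t01; have [az|?] := eqVneq (a t) 0; last by left.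
  have [bz|?] := eqVneq (b t) 0; last by right.
  have [_ v] := FE t t01; have [] := null_vectorP (F t).
  by rewrite v az bz !scale0r addr0 eqxx.
(* Where the maximum vanishes, the point is antipodal to [u] or to [w]; its line is then that of an
   end of the arc, and injectivity puts it at that end, where the coordinate is positive. *)
have mN t : 0 <= t <= 1 -> m t != 0.
  move=> t01; apply/eqP; rewrite /m /Num.max; case: ifP => [ab z|/negbT + z].
    rewrite z in ab.
    have t0 : 0 = t.
      apply: (prop _ _ (a t / a 0)) => //.
      - by rewrite mulf_neq0 ?invr_eq0 ?(lt_eqF ab) ?(gt_eqF a0).
      - by rewrite divfK ?(gt_eqF a0).
      - by rewrite z b0 mulr0.
    by move: ab; rewrite -t0 => ?; lra.
  rewrite -leNgt z => ba.
  have bt : b t < 0.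
    by rewrite lt_neqAle ba andbT; have [|//] := nz t t01; rewrite z eqxx.
  have t1 : 1 = t.
    apply: (prop _ _ (b t / b 1)) => //.
    - by rewrite mulf_neq0 ?invr_eq0 ?(lt_eqF bt) ?(gt_eqF b1).
    - by rewrite z a1 mulr0.
    - by rewrite divfK ?(gt_eqF b1).
  by move: bt; rewrite -t1 => ?; lra.
have m0 : forall t, 0 <= t <= 1 -> 0 < m t.
  apply: segment_nonvanishing_gt0 => //; first exact: continuous_subspaceT.
  by rewrite /m lt_max a0.
pose phi t := (a t - b t) / m t.
have cphi : {within `[0, 1], continuous phi}.
  apply: continuous_in_subspaceT => t; rewrite inE /= in_itv /= => t01.
  have c1 : {for t, continuous a} by exact: ca.
  have c2 : {for t, continuous b} by exact: cb.
  have c3 : {for t, continuous m} by exact: cm.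
  have c4 : {for t, continuous (fun t => (m t)^-1)} by apply: contV => //; exact: mN.
  have c : {for t, continuous (fun t => (a t - b t) * (m t)^-1)} by cont.
  exact: c.
(* [A] and [B] invert the coordinate: they recover the ratios of p and q to their maximum from (p -
   q) / max(p, q). *)
pose A (y : R) := Num.min 1 (1 + y); pose B (y : R) := Num.min 1 (1 - y).
have AB (p q : R) : 0 < Num.max p q -> p = Num.max p q * A ((p - q) / Num.max p q) /\
    q = Num.max p q * B ((p - q) / Num.max p q).
  rewrite /A /B; case: (ltP p q) => pq M0.
    have y0 : (p - q) / q <= 0 by rewrite pmulr_lle0 ?invr_gt0 // subr_le0 ltW.
    rewrite (min_idPr (_ : 1 + _ <= 1)); last by rewrite gerDl.
    rewrite (min_idPl (_ : 1 <= 1 - _)); last by rewrite lerDl oppr_ge0.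
    by split; field; rewrite ?gt_eqF.
  have y0 : 0 <= (p - q) / p by rewrite divr_ge0 ?subr_ge0 // ltW.
  rewrite (min_idPl (_ : 1 <= 1 + _)); last by rewrite lerDl.
  rewrite (min_idPr (_ : 1 - _ <= 1)); last by rewrite gerBl.
  by split; field; rewrite ?gt_eqF.
have phi_inj : {in `[0, 1] &, injective phi}.
  move=> t t'; rewrite !in_itv /= => t01 t01' e.
  have mt := m0 t t01; have mt' := m0 t' t01'.
  have [ea eb] := AB _ _ mt; have [ea' eb'] := AB _ _ mt'.
  rewrite -/(m t) -/(phi t) in ea eb; rewrite -/(m t') -/(phi t') -e in ea' eb'.
  apply: (prop _ _ (m t' / m t)); rewrite ?mulf_neq0 ?invr_eq0 ?gt_eqF //.
  - by rewrite ea' ea mulrA divfK ?gt_eqF.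
  - by rewrite eb' eb mulrA divfK ?gt_eqF.
have p0 : phi 0 = 1.
  by rewrite /phi /m b0 (max_idPl _) ?subr0 ?divff ?gt_eqF ?ltW.
have p1 : phi 1 = -1.
  by rewrite /phi /m a1 (max_idPr _) ?sub0r ?mulNr ?divff ?gt_eqF ?ltW.
have img := continuous_inj_image_segment ler01 cphi phi_inj.
have phiP y : -1 <= y <= 1 <-> exists2 t, 0 <= t <= 1 & phi t = y.
  have := congr1 (fun S => S y) img; rewrite /= p0 p1.
  have -> : Num.min (1 : R) (-1) = -1 by apply/min_idPr; lra.
  have -> : Num.max (1 : R) (-1) = 1 by apply/max_idPl; lra.
  rewrite in_itv /= => <-.
  by split=> -[t]; rewrite ?in_itv /= => t01 <-; exists t; rewrite ?in_itv.
apply/seteqP; split=> r.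
  move=> [t /=]; rewrite in_itv /= => t01 <-.
  have mt := m0 t t01; have [ea eb] := AB _ _ mt.
  have /phiP : exists2 t', 0 <= t' <= 1 & phi t' = phi t by exists t.
  rewrite -/(m t) -/(phi t) in ea eb => /andP[y0 y1].
  have [<- v] := FE t t01; exists (F t) => //; exists (a t), (b t).
  have at0 : 0 <= a t.
    by rewrite ea mulr_ge0 ?(ltW mt) // /A le_min ler01 /=; lra.
  have bt0 : 0 <= b t.
    by rewrite eb mulr_ge0 ?(ltW mt) // /B le_min ler01 /=; lra.
  split => //; rewrite lt0r addr_ge0 // andbT; apply/eqP => z.
  by case: (nz t t01) => /eqP; apply; lra.
move=> [y [p [q [pp qq pq yE]]] <-].
have M0 : 0 < Num.max p q by rewrite lt_max; apply/orP; have [?|?] := ltP 0 p; [left|right; lra].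
have [ep eq] := AB _ _ M0; set M := Num.max p q in M0 ep eq.
have /phiP[t t01 pt] : -1 <= (p - q) / M <= 1.
  have pM : p <= M by rewrite /M le_max lexx.
  have qM : q <= M by rewrite /M le_max lexx orbT.
  by rewrite ler_pdivlMr // ler_pdivrMr //; apply/andP; split; lra.
exists t; first by rewrite /= in_itv.
have mt := m0 t t01; have [ea eb] := AB _ _ mt.
rewrite -/(m t) -/(phi t) pt in ea eb.
have [<- v] := FE t t01; apply/lineP; exists (M / m t).
  by rewrite mulf_neq0 ?invr_eq0 ?gt_eqF.
rewrite yE v scalerDr !scalerA; congr (_ *: _ + _ *: _).
  by rewrite [LHS]ep ea mulrA divfK ?gt_eqF.
by rewrite [LHS]eq eb mulrA divfK ?gt_eqF.
Qed.

Lemma lifted_polygon_hexagon (w1 w2 w3 : V) (L : lifted_polygon 6) :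
  future_negative_lifted w1 w2 w3 L -> exists x : 'I_6 -> null_vector R,
  [/\ negative_hexagon (fun i => val (x i)), polygon L = hex_polygon x,
      forall i, vertex_ray L i = ray (x i) &
      forall i, 0 < dVol (val (x i)) (val (x ('S i))) w1 w2 w3].
Proof.
case: L => -[vtx edg] C vr [[/= [_ inj arcs inter phot] [s [cs sl CE]] neg _ fut] vrP].
have {}arcs i : is_arc R (edg i) (vtx i) (vtx ('S i)) := arcs i.
have {}phot i : exists2 A, is_photon A & edg i `<=` A := phot i.
have {}inj : injective vtx := inj.
have {}inter i j : i != j -> edg i `&` edg j =
  [set vtx i; vtx ('S i)] `&` [set vtx j; vtx ('S j)] := @inter i j.
have /choice[x xP] : forall i, exists y : null_vector R, C y /\ ray y = vr i.
  by move=> i; have [[y Cy <-] _] := vrP i; exists y.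
have xv i : line (x i) = vtx i.
  have E : double_cover (vr i) = vtx i := (vrP i).2.
  by rewrite -E -(xP i).2 double_cover_ray.
exists x.
have xC i : C (x i) := (xP i).1.
have Cs y : C y -> s (line y) = ray y.
  rewrite CE => -[z Dz zy]; have := sl z Dz; rewrite zy double_cover_ray => ->.
  by rewrite zy.
have edge0 i : edg i (vtx i).
  have [f [_ _ <- _ ->]] := arcs i; exists 0 => //=.
  by rewrite in_itv /= lexx ler01.
have edge1 i : edg i (vtx ('S i)).
  have [f [_ _ _ <- ->]] := arcs i; exists 1 => //=.
  by rewrite in_itv /= lexx ler01.
have ortho i : ip (val (x i)) (val (x ('S i))) = 0.
  have [A [U [_ UU ->]] sub] := phot i.
  have [y' y'U /lineP[c' _ E1]] : [set line v | v in [set v : null_vector R | val v \in U]] (line (x i)).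
    by rewrite xv; exact: sub (edge0 i).
  have [z' z'U /lineP[d' _ E2]] : [set line v | v in [set v : null_vector R | val v \in U]] (line (x ('S i))).
    by rewrite xv; exact: sub (edge1 i).
  by rewrite E1 E2 ipZl ipZr UU // !mulr0.
have vertex_edge i k : edg k (vtx i) -> i = k \/ i = 'S k.
  move=> ek; have [->|ik] := eqVneq i k; first by left.
  have : (edg i `&` edg k) (vtx i) by split.
  by rewrite (inter _ _ ik) => -[_ [/inj|/inj]]; [left|right].
have nx : negative_hexagon (fun i => val (x i)).
  move=> i j; case: ifP => [/or3P[]/eqP ji|/negP na].
  - by rewrite ji; exact: (null_vectorP (x i)).2.
  - by rewrite ji.
  - by rewrite ji ipC.
  have lij : line (x i) <> line (x j).
    by rewrite !xv => /inj ij; apply: na; rewrite ij cyc_adjxx.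
  have [le0 eq0] := neg _ _ (xC i) (xC j) lij.
  rewrite lt_neqAle le0 andbT; apply/eqP => /eq0.1[k []].
  rewrite !xv => /= /vertex_edge ik /vertex_edge jk; apply: na.
  by case: ik => ->; case: jk => ->;
    rewrite ?cyc_adjxx ?cyc_adj_S // cyc_adjC cyc_adj_S.
split => //; last first.
- by move=> i; apply: fut; rewrite ?xv.
- by move=> i; have [_ ->] := xP i.
congr MarkedPolygon; first by apply/funext => i; rewrite xv.
apply/funext => i.
have [f [cf finj f0 f1 fE]] := arcs i.
have [uu uv vv ind] := hex_isotropic_pair nx i.
have [j /andP[j1 j2]] := cyc_adj_after i.
have [k /andP[l1 l2]] := cyc_adj_before i.
(* The arc is continuous on [0, 1] only and the section on the support only. Composition with
   [clamp] gives a lifted path that is continuous on the line. *)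
have clI (t : R) : `[0, 1]%classic (clamp t) by rewrite /= in_itv /= clamp01.
have cclamp : continuous (@clamp R).
  by apply: continuous_pointwise => t; rewrite /clamp; cont.
have cF := within_continuous_total_comp cf cclamp clI.
pose D := polygon_support (MarkedPolygon vtx edg).
have DF t : D ((f \o clamp) t).
  by exists i => //; rewrite -/(edge _ i) /= fE; exists (clamp t).
have crho := within_continuous_total_comp cs cF DF.
pose rho t := unit_rep (s (f (clamp t))).
have {}crho : continuous rho.
  apply: continuous_pointwise => t.
  exact: (@continuous_comp _ _ _ (s \o (f \o clamp)) unit_rep t (crho t) (@unit_rep_continuous _ _)).
have [G GE] := null_vector_lift (fun t => (unit_repP (s (f (clamp t)))).1).
have rayG t : ray (G t) = s (f (clamp t)) by exact: ray_unit_rep.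
have lineG t : line (G t) = f (clamp t).
  by rewrite -double_cover_ray rayG; apply: sl; exact: DF.
have i0 : 0 <= (0 : R) <= 1 by rewrite lexx ler01.
have i1 : 0 <= (1 : R) <= 1 by rewrite lexx ler01.
have Dx l : D (vtx l) by exists l => //; exact: edge0.
have nij : ip (val (x i)) (val (x j)) != 0 by rewrite lt_eqF // hex_nadj.
have nik : ip (val (x ('S i))) (val (x k)) != 0 by rewrite lt_eqF // hex_nadj.
(* Coefficients on the two end vertices, read off by products with vertices [j] and [k], hence
   continuous. *)
pose a t := ip (rho t) (val (x j)) / ip (val (x i)) (val (x j)).
pose b t := ip (rho t) (val (x k)) / ip (val (x ('S i))) (val (x k)).
have abE t p q : rho t = p *: val (x i) + q *: val (x ('S i)) -> a t = p /\ b t = q.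
  move=> E; rewrite /a /b E !ipDl !ipZl (hex_adj nx j1) (hex_adj nx l1) !mulr0 addr0 add0r.
  by rewrite !mulfK.
have rhoE t : rho t = a t *: val (x i) + b t *: val (x ('S i)).
  have [A [U [dU _ ->]] sub] := phot i.
  have memU y : edg i (line y) -> val y \in U.
    by move=> /sub[z zU /lineP[c _ ->]]; rewrite memvZ.
  (* The photon containing the edge contains both end vertices, so by dimension it is the photon
     they span. *)
  have UE : (<[val (x i)]> + <[val (x ('S i))]>)%VS = U.
    apply/eqP; rewrite eqEdim dU dim_plane // leqnn andbT subv_add -!memvE.
    by rewrite !memU // xv; [exact: edge1|exact: edge0].
  have : val (G t) \in U.
    by apply: memU; rewrite lineG fE; exists (clamp t).
  rewrite GE -UE => /memv_addP[_ /vlineP[p ->] [_ /vlineP[q ->] E]].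
  by have [-> ->] := abE _ _ _ E.
have rho_at t l : 0 <= t <= 1 -> f t = vtx l ->
    rho t = (tnorm (val (x l)))^-1 *: val (x l).
  move=> t01 ft; rewrite /rho clamp_id // ft -xv Cs; last exact: xC.
  exact: unit_rep_ray.
have tn l : 0 < (tnorm (val (x l)))^-1 by rewrite invr_gt0 tnorm_gt0 //; exact: null_valP.
have [ea0 eb0] := abE 0 _ 0 (etrans (rho_at 0 i i0 f0) (esym (etrans (congr1 (+%R _) (scale0r _)) (addr0 _)))).
have [ea1 eb1] := abE 1 0 _ (etrans (rho_at 1 ('S i) i1 f1) (esym (etrans (congr1 (+%R^~ _) (scale0r _)) (add0r _)))).
rewrite fE (@arc_short _ _ a b f G ind) ?ea0 ?eb1 //.
- by apply: continuous_pointwise => t; apply: contM; [apply: cont_ip; [exact: crho|]|]; exact: cont_cst.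
- by apply: continuous_pointwise => t; apply: contM; [apply: cont_ip; [exact: crho|]|]; exact: cont_cst.
- by move=> t t01; rewrite -rhoE lineG clamp_id //; split=> //; rewrite GE /rho clamp_id.
Qed.

End FromPolygon.

(** * Gram systems and normal forms *)

Section NormalForms.
Context {R : realType}.
Notation V := 'rV[R]_5.
Notation "''S' i" := (@ordS 6 i) (at level 8, i at level 2).

Definition j0 : 'I_6 := @Ordinal 6 0 isT.
Definition j1 : 'I_6 := @Ordinal 6 1 isT.
Definition j2 : 'I_6 := @Ordinal 6 2 isT.
Definition j3 : 'I_6 := @Ordinal 6 3 isT.
Definition j4 : 'I_6 := @Ordinal 6 4 isT.
Definition j5 : 'I_6 := @Ordinal 6 5 isT.

Lemma ord6_ind (P : 'I_6 -> Prop) :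
  P j0 -> P j1 -> P j2 -> P j3 -> P j4 -> P j5 -> forall k, P k.
Proof.
move=> p0 p1 p2 p3 p4 p5 [[|[|[|[|[|[|//]]]]]] lt6].
- by rewrite (_ : Ordinal lt6 = j0) //; apply: val_inj.
- by rewrite (_ : Ordinal lt6 = j1) //; apply: val_inj.
- by rewrite (_ : Ordinal lt6 = j2) //; apply: val_inj.
- by rewrite (_ : Ordinal lt6 = j3) //; apply: val_inj.
- by rewrite (_ : Ordinal lt6 = j4) //; apply: val_inj.
- by rewrite (_ : Ordinal lt6 = j5) //; apply: val_inj.
Qed.

Lemma sum6E (W : nmodType) (F : 'I_6 -> W) :
  \sum_i F i = F j0 + F j1 + F j2 + F j3 + F j4 + F j5.
Proof.
rewrite !big_ord_recl big_ord0 addr0 !addrA.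
by congr (F _ + F _ + F _ + F _ + F _ + F _); apply: val_inj.
Qed.

(* Opposite vertices 0 and 3, 4 and 1, 2 and 5 are p + m1 and p - m1, q + m2 and
   q - m2, r + m3 and r - m3; after scaling, the span of p, q, r is orthogonal
   to that of m1, m2, m3, and products of distinct vectors within each triple are -1. *)
Record gram (x y z : R) (p q r m1 m2 m3 : V) : Prop := Gram {
  gpp : ip p p = - x; gqq : ip q q = - y; grr : ip r r = - z;
  gpq : ip p q = -1; gpr : ip p r = -1; gqr : ip q r = -1;
  g11 : ip m1 m1 = x; g22 : ip m2 m2 = y; g33 : ip m3 m3 = z;
  g12 : ip m1 m2 = -1; g13 : ip m1 m3 = -1; g23 : ip m2 m3 = -1;
  gp1 : ip p m1 = 0; gp2 : ip p m2 = 0; gp3 : ip p m3 = 0;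
  gq1 : ip q m1 = 0; gq2 : ip q m2 = 0; gq3 : ip q m3 = 0;
  gr1 : ip r m1 = 0; gr2 : ip r m2 = 0; gr3 : ip r m3 = 0 }.

Section GramRules.
Variables (x y z : R) (p q r m1 m2 m3 : V).
Hypothesis G : gram x y z p q r m1 m2 m3.

Let sym (u v : V) c : ip u v = c -> ip v u = c. Proof. by rewrite ipC. Qed.

Definition gram_rules := ((gpp G, gqq G, grr G, g11 G, g22 G, g33 G),
  (gpq G, gpr G, gqr G, g12 G, g13 G, g23 G),
  (gp1 G, gp2 G, gp3 G, gq1 G, gq2 G, gq3 G, gr1 G, gr2 G, gr3 G),
  (sym (gpq G), sym (gpr G), sym (gqr G), sym (g12 G), sym (g13 G), sym (g23 G)),
  (sym (gp1 G), sym (gp2 G), sym (gp3 G), sym (gq1 G), sym (gq2 G), sym (gq3 G),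
   sym (gr1 G), sym (gr2 G), sym (gr3 G))).

End GramRules.

Definition six (p q r m1 m2 m3 : V) (i : 'I_6) : V :=
  nth 0 [:: p + m1; q - m2; r + m3; p - m1; q + m2; r - m3] i.

Lemma gram_hexagon x y z p q r m1 m2 m3 : 0 < x -> 0 < y -> 0 < z ->
  gram x y z p q r m1 m2 m3 -> negative_hexagon (six p q r m1 m2 m3).
Proof.
move=> x0 y0 z0 G; apply: ord6_ind; apply: ord6_ind;
  rewrite /cyc_adj /= /six /= !ip_simp !(gram_rules G); clear -x0 y0 z0; lra.
Qed.

Section TimePart.
Variables (e X Y A B : R) (p q r m1 m2 m3 : V) (x : 'I_6 -> null_vector R).
Hypotheses (e1 : e = 1 \/ e = -1) (X0 : 0 < X) (Y0 : 0 < Y) (A0 : 0 < A) (B0 : B < 0).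
Hypothesis time0 : forall w, w \in [:: p; q; r] -> w 0 k0 = 0 /\ w 0 k1 = 0.
Hypothesis time1 : m1 0 k0 = X /\ m1 0 k1 = - e * A.
Hypothesis time2 : m2 0 k0 = - Y /\ m2 0 k1 = - e * A.
Hypothesis time3 : m3 0 k0 = 0 /\ m3 0 k1 = - e * B.
Hypothesis xE : forall i, val (x i) = six p q r m1 m2 m3 i.

(** Only [m1], [m2], [m3] have positive coordinates, so opposite vertices project to opposite
    points, and the oriented areas of consecutive vertices are A (X + Y), - B Y and - B X, all
    positive. *)
Lemma six_future w1 w2 w3 : negative_hexagon (six p q r m1 m2 m3) ->
  (forall u u', isotropic_pair u u' -> 0 < dVol u u' w1 w2 w3 <-> 0 < e * pdet u u') ->
  future_negative_lifted w1 w2 w3 (hex_lifted x).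
Proof.
move=> hx; have hx' : negative_hexagon (fun i => val (x i)).
  by move=> i j; rewrite !xE; exact: hx.
have ee : e * e = 1 by case: e1 => ->; ring.
have [tp0 tp1] : p 0 k0 = 0 /\ p 0 k1 = 0 by apply: time0; rewrite !inE eqxx.
have [tq0 tq1] : q 0 k0 = 0 /\ q 0 k1 = 0 by apply: time0; rewrite !inE eqxx !orbT.
have [tr0 tr1] : r 0 k0 = 0 /\ r 0 k1 = 0 by apply: time0; rewrite !inE eqxx !orbT.
have [t10 t11] := time1; have [t20 t21] := time2; have [t30 t31] := time3.
have S0 : 'S j0 = j1 by apply: val_inj.
have S1 : 'S j1 = j2 by apply: val_inj.
have S2 : 'S j2 = j3 by apply: val_inj.
have S3 : 'S j3 = j4 by apply: val_inj.
have S4 : 'S j4 = j5 by apply: val_inj.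
have S5 : 'S j5 = j0 by apply: val_inj.
pose T := (tp0, tp1, tq0, tq1, (tr0, tr1, t10, t11), (t20, t21, t30, t31)).
(* Leaving [e * e] unevaluated turns the goals below into polynomial identities. *)
have D (u w : V) c : e * pdet u w = e * e * c -> e * pdet u w = c by rewrite ee mul1r.
have AX : 0 < A * X by rewrite mulr_gt0.
have AY : 0 < A * Y by rewrite mulr_gt0.
have BX : B * X < 0 by rewrite nmulr_rlt0.
have BY : B * Y < 0 by rewrite nmulr_rlt0.
apply: (@hex_future_negative _ x e) => //.
- apply: ord6_ind; rewrite ?S0 ?S1 ?S2 ?S3 ?S4 ?S5 !xE /six /=.
  + rewrite (D _ _ (A * X + A * Y)); [lra|by rewrite /pdet !mxE !T; ring].
  + rewrite (D _ _ (- (B * Y))); [lra|by rewrite /pdet !mxE !T; ring].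
  + rewrite (D _ _ (- (B * X))); [lra|by rewrite /pdet !mxE !T; ring].
  + rewrite (D _ _ (A * X + A * Y)); [lra|by rewrite /pdet !mxE !T; ring].
  + rewrite (D _ _ (- (B * Y))); [lra|by rewrite /pdet !mxE !T; ring].
  + rewrite (D _ _ (- (B * X))); [lra|by rewrite /pdet !mxE !T; ring].
- apply: ord6_ind; rewrite ?S0 ?S1 ?S2 ?S3 ?S4 ?S5 ?S0 !xE /six /=.
  + rewrite (D _ _ (- (B * X))); [lra|by rewrite /pdet !mxE !T; ring].
  + rewrite (D _ _ (A * X + A * Y)); [lra|by rewrite /pdet !mxE !T; ring].
  + rewrite (D _ _ (- (B * Y))); [lra|by rewrite /pdet !mxE !T; ring].
  + rewrite (D _ _ (- (B * X))); [lra|by rewrite /pdet !mxE !T; ring].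
  + rewrite (D _ _ (A * X + A * Y)); [lra|by rewrite /pdet !mxE !T; ring].
  + rewrite (D _ _ (- (B * Y))); [lra|by rewrite /pdet !mxE !T; ring].
- by apply: ord6_ind; rewrite /shift6 /= ?S0 ?S1 ?S2 ?S3 ?S4 ?S5 ?S0 ?S1 !xE /six /= !mxE !T; ring.
- by apply: ord6_ind; rewrite /shift6 /= ?S0 ?S1 ?S2 ?S3 ?S4 ?S5 ?S0 ?S1 !xE /six /= !mxE !T; ring.
Qed.

End TimePart.

(* The two normal forms: in the first the span of m1, m2, m3 is a positive
   definite plane, in the second that of p, q, r is a negative definite plane
   (or, if s = t = 0, a line). *)
Section TypeTwo.
Variables (e x y z s t n : R).

(** With [n ^+ 2 = x + y + 2], the square of m1 - m2, the first axis is (m1 - m2) / n; [nX] and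
    [- nY] are the components of m1 and m2 along it, and the common remainder of m1 and m2 has
    square (s / n) ^ 2. *)
Definition nX := (x + 1) / n.
Definition nY := (y + 1) / n.
(** Coordinates of that remainder in a plane of signature (1, 1). Its null coordinates, the sum and
    the difference of [nAp] and [nAm], are 1 and (s / n) ^ 2: at s = 0 the vector becomes isotropic
    but not zero. *)
Definition nAp := (1 + (s / n) ^+ 2) / 2.
Definition nAm := (1 - (s / n) ^+ 2) / 2.
(** Coordinates of m3 in the same plane. Their null coordinates - z n / (n + 2) and - (n + 2) / n
    have product z. The factor n + 2 comes from [s2z]: in the product of m3 with m1 it leaves (n -
    2) / n and (n + 2) / n, whose half sum is 1. *)
Definition nBp := (- (z * n / (n + 2)) - (n + 2) / n) / 2.
Definition nBm := (- (z * n / (n + 2)) + (n + 2) / n) / 2.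

Definition two_p : V := vec5 0 0 0 nX (- (s / n)).
Definition two_q : V := vec5 0 0 0 nY (s / n).
Definition two_r : V := vec5 0 0 0 (2 / n) (t / n).
Definition two_m1 : V := vec5 nX (- e * nAp) nAm 0 0.
Definition two_m2 : V := vec5 (- nY) (- e * nAp) nAm 0 0.
Definition two_m3 : V := vec5 0 (- e * nBp) nBm 0 0.

Hypotheses (e1 : e * e = 1) (n0 : 0 < n) (n2 : n ^+ 2 = x + y + 2)
  (s2 : s ^+ 2 = x * y - 1) (st : s * t = x - y) (zn : z * n ^+ 2 = 4 + t ^+ 2).

Let nN0 : n != 0. Proof. by rewrite gt_eqF. Qed.
Let n2N0 : n + 2 != 0. Proof. by rewrite gt_eqF // addr_gt0. Qed.

Lemma clear_n2 (a b : R) : a * n ^+ 2 = b * n ^+ 2 -> a = b.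
Proof. by apply: mulIf; rewrite expf_neq0. Qed.

Lemma nXY : nX + nY = n.
Proof. by apply: (mulIf nN0); rewrite -expr2 n2 /nX /nY; field. Qed.

Lemma nX2 : nX ^+ 2 + (s / n) ^+ 2 = x.
Proof.
apply: clear_n2; transitivity ((x + 1) ^+ 2 + s ^+ 2); first by rewrite /nX; field.
by rewrite n2 s2; ring.
Qed.

Lemma nY2 : nY ^+ 2 + (s / n) ^+ 2 = y.
Proof.
apply: clear_n2; transitivity ((y + 1) ^+ 2 + s ^+ 2); first by rewrite /nY; field.
by rewrite n2 s2; ring.
Qed.

Lemma nXnY : nX * nY - (s / n) ^+ 2 = 1.
Proof.
apply: clear_n2; transitivity ((x + 1) * (y + 1) - s ^+ 2).
  by rewrite /nX /nY; field.
by rewrite n2 s2; ring.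
Qed.

Lemma nXr : nX * (2 / n) - s / n * (t / n) = 1.
Proof.
apply: clear_n2; transitivity ((x + 1) * 2 - s * t); first by rewrite /nX; field.
by rewrite n2 st; ring.
Qed.

Lemma nYr : nY * (2 / n) + s / n * (t / n) = 1.
Proof.
apply: clear_n2; transitivity ((y + 1) * 2 + s * t); first by rewrite /nY; field.
by rewrite n2 st; ring.
Qed.

Lemma nr2 : (2 / n) ^+ 2 + (t / n) ^+ 2 = z.
Proof. by apply: clear_n2; rewrite zn; field. Qed.

Lemma s2z : s ^+ 2 * z = n ^+ 2 - 4.
Proof.
apply: clear_n2; rewrite -mulrA zn.
transitivity (4 * s ^+ 2 + (s * t) ^+ 2); first by ring.
by rewrite s2 st n2; ring.
Qed.

Lemma nA2 : nAp ^+ 2 - nAm ^+ 2 = (s / n) ^+ 2.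
Proof. by rewrite /nAp /nAm; field. Qed.

Lemma nAB : nAp * nBp - nAm * nBm = -1.
Proof.
transitivity (- ((s ^+ 2 * z) / (n * (n + 2)) + (n + 2) / n) / 2).
  by rewrite /nAp /nAm /nBp /nBm; field; rewrite n2N0 nN0.
by rewrite s2z; field; rewrite n2N0 nN0.
Qed.

Lemma nB2 : nBp ^+ 2 - nBm ^+ 2 = z.
Proof. by rewrite /nBp /nBm; field; rewrite n2N0 nN0. Qed.

(** As this determinant does not vanish even for s = 0, the axes of the plane of signature (1, 1)
    can be recovered from m3 and the remainder of m1. *)
Lemma nDelta : nAp * nBm - nAm * nBp = 2 / n.
Proof.
transitivity ((- (s ^+ 2 * z) / (n * (n + 2)) + (n + 2) / n) / 2).
  by rewrite /nAp /nAm /nBp /nBm; field; rewrite n2N0 nN0.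
by rewrite s2z; field; rewrite n2N0 nN0.
Qed.

Lemma two_gram : gram x y z two_p two_q two_r two_m1 two_m2 two_m3.
Proof.
have H1 := nX2; have H2 := nY2; have H3 := nXnY; have H4 := nXr; have H5 := nYr.
have H6 := nr2; have H7 := nA2; have H8 := nAB; have H9 := nB2.
rewrite /two_p /two_q /two_r /two_m1 /two_m2 /two_m3.
have C (a b : R) : - e * a * (- e * b) = a * b.
  by rewrite -[RHS]mul1r -e1; ring.
(* Naming the quotients makes every goal linear in their products. *)
split; rewrite ipE !vec5E ?C; move: H1 H2 H3 H4 H5 H6 H7 H8 H9;
  set a1 := nX; set a2 := nY; set a3 := s / n; set a4 := t / n; set a5 := 2 / n;
  rewrite ?expr2; lra.
Qed.

End TypeTwo.

Section TypeOne.
Variables (e x y z s n : R).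

Definition one_p : V := vec5 0 0 (nX x n) (- (s / n)) 0.
Definition one_q : V := vec5 0 0 (nY y n) (s / n) 0.
Definition one_r : V := vec5 0 0 (2 / n) ((x - y) / (n * s)) (2 / s).
Definition one_m1 : V := vec5 (nX x n) (- e * (s / n)) 0 0 0.
Definition one_m2 : V := vec5 (- nY y n) (- e * (s / n)) 0 0 0.
Definition one_m3 : V := vec5 0 (- e * - (n / s)) 0 0 0.

Hypotheses (e1 : e * e = 1) (n0 : 0 < n) (n2 : n ^+ 2 = x + y + 2)
  (s0 : 0 < s) (s2 : s ^+ 2 = x * y - 1) (zs : z * s ^+ 2 = n ^+ 2).

Let nN0 : n != 0. Proof. by rewrite gt_eqF. Qed.
Let sN0 : s != 0. Proof. by rewrite gt_eqF. Qed.

Lemma one_gram : gram x y z one_p one_q one_r one_m1 one_m2 one_m3.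
Proof.
have H1 := nX2 n0 n2 s2; have H2 := nY2 n0 n2 s2; have H3 := nXnY n0 n2 s2.
have H4 : nX x n * (2 / n) - s / n * ((x - y) / (n * s)) = 1.
  apply: (clear_n2 n0); transitivity ((x + 1) * 2 - (x - y)).
    by rewrite /nX; field; rewrite nN0 sN0.
  by rewrite n2; ring.
have H5 : nY y n * (2 / n) + s / n * ((x - y) / (n * s)) = 1.
  apply: (clear_n2 n0); transitivity ((y + 1) * 2 + (x - y)).
    by rewrite /nY; field; rewrite nN0 sN0.
  by rewrite n2; ring.
have H6 : (2 / n) ^+ 2 + ((x - y) / (n * s)) ^+ 2 + (2 / s) ^+ 2 = z.
  apply: (clear_n2 n0); apply: (mulIf (_ : s ^+ 2 != 0)); first by rewrite expf_neq0.
  rewrite (mulrAC z) zs.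
  transitivity (4 * s ^+ 2 + (x - y) ^+ 2 + 4 * n ^+ 2).
    by field; rewrite nN0 sN0.
  by rewrite s2 n2; ring.
have H7 : s / n * (n / s) = 1 by field; rewrite nN0 sN0.
have H8 : (n / s) ^+ 2 = z.
  apply: (mulIf (_ : s ^+ 2 != 0)); first by rewrite expf_neq0.
  by rewrite zs; field.
rewrite /one_p /one_q /one_r /one_m1 /one_m2 /one_m3.
have C (a b : R) : - e * a * (- e * b) = a * b.
  by rewrite -[RHS]mul1r -e1; ring.
split; rewrite ipE !vec5E ?C; move: H1 H2 H3 H4 H5 H6 H7 H8;
  set a1 := nX x n; set a2 := nY y n; set a3 := s / n; set a4 := _ / (n * s);
  set a5 := 2 / n; set a6 := n / s; set a7 := 2 / s;
  rewrite ?expr2; lra.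
Qed.

End TypeOne.

End NormalForms.

(** * Orthonormal frames adapted to a Gram system *)

Section Frames.
Context {R : realType}.
Notation V := 'rV[R]_5.

Lemma left_kernel m (A : 'M[R]_(m.+1, m)) : exists2 u : 'rV_m.+1, u != 0 & u *m A = 0.
Proof.
have : kermx A != 0.
  by rewrite -mxrank_eq0 mxrank_ker subn_eq0 -ltnNge ltnS rank_leq_col.
by move=> /rowV0Pn[u /sub_kermxP uA u0]; exists u.
Qed.

Lemma exists_orthogonal (f0 f1 f2 f3 : V) : exists u : V,
  [/\ u != 0, ip u f0 = 0, ip u f1 = 0, ip u f2 = 0 & ip u f3 = 0].
Proof.
pose A : 'M[R]_(5, 4) := \matrix_(k, j) (sg k * nth 0 [:: f0; f1; f2; f3] j 0 k).
have [u u0 uA] := left_kernel A.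
have H (j : 'I_4) : ip u (nth 0 [:: f0; f1; f2; f3] j) = 0.
  have := congr1 (fun M : 'rV_4 => M 0 j) uA; rewrite !mxE => <-.
  by rewrite ip_sg; apply: eq_bigr => k _; rewrite mxE; ring.
exists u; split => //.
- exact: (H (@Ordinal 4 0 isT)).
- exact: (H (@Ordinal 4 1 isT)).
- exact: (H (@Ordinal 4 2 isT)).
- exact: (H (@Ordinal 4 3 isT)).
Qed.

Record orthonormal_frame (f0 f1 f2 f3 f4 : V) : Prop := OrthonormalFrame {
  f00 : ip f0 f0 = 1; f11 : ip f1 f1 = 1; f22 : ip f2 f2 = -1;
  f33 : ip f3 f3 = -1; f44 : ip f4 f4 = -1;
  f01 : ip f0 f1 = 0; f02 : ip f0 f2 = 0; f03 : ip f0 f3 = 0; f04 : ip f0 f4 = 0;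
  f12 : ip f1 f2 = 0; f13 : ip f1 f3 = 0; f14 : ip f1 f4 = 0;
  f23 : ip f2 f3 = 0; f24 : ip f2 f4 = 0; f34 : ip f3 f4 = 0 }.

Definition frame_mx (f0 f1 f2 f3 f4 : V) : 'M[R]_5 :=
  \matrix_(i < 5) nth (0 : V) [:: f0; f1; f2; f3; f4] i.

Lemma mul_frame_mx f0 f1 f2 f3 f4 u : u *m frame_mx f0 f1 f2 f3 f4 =
  u 0 k0 *: f0 + u 0 k1 *: f1 + u 0 k2 *: f2 + u 0 k3 *: f3 + u 0 k4 *: f4.
Proof. by rewrite mulmx_sum_row sum5E !rowK. Qed.

Lemma frame_isometry f0 f1 f2 f3 f4 : orthonormal_frame f0 f1 f2 f3 f4 ->
  isometry (frame_mx f0 f1 f2 f3 f4).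
Proof.
move=> [h00 h11 h22 h33 h44 h01 h02 h03 h04 h12 h13 h14 h23 h24 h34] u v.
rewrite !mul_frame_mx !ip_simp (ipC f1 f0) (ipC f2 f0) (ipC f3 f0) (ipC f4 f0)
  (ipC f2 f1) (ipC f3 f1) (ipC f4 f1) (ipC f3 f2) (ipC f4 f2) (ipC f4 f3)
  h00 h11 h22 h33 h44 h01 h02 h03 h04 h12 h13 h14 h23 h24 h34 ipE; ring.
Qed.

Lemma frame_orthogonal_eq0 f0 f1 f2 f3 f4 d : orthonormal_frame f0 f1 f2 f3 f4 ->
  ip d f0 = 0 -> ip d f1 = 0 -> ip d f2 = 0 -> ip d f3 = 0 -> ip d f4 = 0 -> d = 0.
Proof.
move=> hf d0 d1 d2 d3 d4.
have ig := frame_isometry hf; have gu := isometry_unit ig.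
set g := frame_mx _ _ _ _ _ in ig gu.
suff z : d *m invmx g = 0 by rewrite -(mulmxKV gu d) z mul0mx.
have H u : ip (d *m invmx g) u = 0.
  by rewrite -ig mulmxKV // mul_frame_mx !ip_simp d0 d1 d2 d3 d4; ring.
apply/rowP => k; rewrite [RHS]mxE; have := H (bas k); rewrite ip_bas /sg.
by case: ifP => _ ?; lra.
Qed.

Lemma orthonormal_pair_lt0 (f0 f1 w : V) : ip f0 f0 = 1 -> ip f1 f1 = 1 ->
  ip f0 f1 = 0 -> ip f0 w = 0 -> ip f1 w = 0 -> ip w w <= 0 /\ (ip w w = 0 -> w = 0).
Proof.
move=> h0 h1 h01; apply: ip_lt0_orth; rewrite h0 ?h1 ?h01 ?ltr01 //.
by rewrite mulr1 expr0n subr0 ltr01.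
Qed.

Variables (e x y z : R) (p q r m1 m2 m3 : V).
Hypotheses (e1 : e * e = 1) (G : gram x y z p q r m1 m2 m3).

Let T := gram_rules G.

Variables (s n : R).
Hypotheses (n0 : 0 < n) (n2 : n ^+ 2 = x + y + 2) (s2 : s ^+ 2 = x * y - 1).

Let nN0 : n != 0. Proof. by rewrite gt_eqF. Qed.
Notation X := (nX x n).
Notation Y := (nY y n).

Let xE : x = X * n - 1. Proof. by rewrite /nX divfK // addrK. Qed.
Let yE : y = Y * n - 1. Proof. by rewrite /nY divfK // addrK. Qed.
Let nE : n = X + Y. Proof. by rewrite nXY. Qed.
Let HX := nX2 n0 n2 s2.

Section One.
Hypotheses (s0 : 0 < s) (zs : z * s ^+ 2 = n ^+ 2).

(** Orthonormalisation of m1 - m2 and m1 on the positive side, and of p + q, p and r on the negative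
    side. The rows of [g] are the resulting frame. *)
Lemma gram_normal_one : exists g, isometry g /\
  [/\ p = one_p x s n *m g, q = one_q y s n *m g, r = one_r x y s n *m g &
   [/\ m1 = one_m1 e x s n *m g, m2 = one_m2 e y s n *m g & m3 = one_m3 e s n *m g]].
Proof.
have sN0 : s != 0 by rewrite gt_eqF.
have [f0 f0E] : exists f : V, f = n^-1 *: (m1 - m2) by eexists.
have [f1' f1'E] : exists f : V, f = (n / s) *: (m1 - X *: f0) by eexists.
have [f1 f1E] : exists f : V, f = - e *: f1' by eexists.
have [f2 f2E] : exists f : V, f = n^-1 *: (p + q) by eexists.
have [f3 f3E] : exists f : V, f = - (n / s) *: (p - X *: f2) by eexists.
pose c := (x - y) / (n * s).
have [f4 f4E] : exists f : V, f = (s / 2) *: (r - (2 / n) *: f2 - c *: f3) by eexists.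
have H00 : ip f0 f0 = 1.
  rewrite f0E !ip_simp !T; apply: (clear_n2 n0).
  by transitivity (x + y + 2); [field|rewrite n2 mul1r].
have H10 : ip m1 f0 = X by rewrite f0E !ip_simp !T /nX; field.
have H30 : ip m3 f0 = 0 by rewrite f0E !ip_simp !T; ring.
have A0 : ip (m1 - X *: f0) f0 = 0 by rewrite !ip_simp H10 H00; ring.
have HA : ip (m1 - X *: f0) (m1 - X *: f0) = (s / n) ^+ 2.
  rewrite [in LHS]ipDr [in X in _ + X = _]ipNr ipZr A0 mulr0 subr0.
  rewrite ipDl ipNl ipZl (ipC f0) H10 T; have := HX; set a := X; set b := s / n; rewrite !expr2 => ?; lra.
have H1'0 : ip f1' f0 = 0 by rewrite f1'E ipZl A0 mulr0.
have H1'1' : ip f1' f1' = 1.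
  by rewrite f1'E ipZl ipZr HA; field; rewrite nN0 sN0.
have H22 : ip f2 f2 = -1.
  rewrite f2E !ip_simp !T; apply: (clear_n2 n0).
  by transitivity (- (x + y + 2)); [field|rewrite n2; ring].
have Hp2 : ip p f2 = - X by rewrite f2E !ip_simp !T /nX; field.
have Hr2 : ip r f2 = - (2 / n) by rewrite f2E !ip_simp !T; field.
have B0 : ip (p - X *: f2) f2 = 0 by rewrite !ip_simp Hp2 H22; ring.
have HB : ip (p - X *: f2) (p - X *: f2) = - (s / n) ^+ 2.
  rewrite [in LHS]ipDr [in X in _ + X = _]ipNr ipZr B0 mulr0 subr0.
  rewrite ipDl ipNl ipZl (ipC f2) Hp2 T; have := HX; set a := X; set b := s / n; rewrite !expr2 => ?; lra.
have H32 : ip f3 f2 = 0 by rewrite f3E ipZl B0 mulr0.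
have H33 : ip f3 f3 = -1.
  by rewrite f3E ipZl ipZr HB; field; rewrite nN0 sN0.
have Hr3 : ip r f3 = - c.
  rewrite f3E ipZr ipDr ipNr ipZr Hr2 T /c /nX.
  transitivity ((n ^+ 2 - 2 * (x + 1)) / (n * s)); first by field; rewrite nN0 sN0.
  by rewrite n2; ring.
have Hcz : z = (2 / n) ^+ 2 + c ^+ 2 + (2 / s) ^+ 2.
  apply: (clear_n2 n0); apply: (mulIf (_ : s ^+ 2 != 0)); first by rewrite expf_neq0.
  rewrite (mulrAC z) zs.
  transitivity (4 * s ^+ 2 + (x - y) ^+ 2 + 4 * n ^+ 2).
    by rewrite s2 n2; ring.
  by rewrite /c; field; rewrite nN0 sN0.
have C2 : ip (r - (2 / n) *: f2 - c *: f3) f2 = 0.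
  by rewrite !ip_simp Hr2 H22 H32; ring.
have C3 : ip (r - (2 / n) *: f2 - c *: f3) f3 = 0.
  by rewrite !ip_simp Hr3 (ipC f2) H32 H33; ring.
have HC : ip (r - (2 / n) *: f2 - c *: f3) (r - (2 / n) *: f2 - c *: f3) = - (2 / s) ^+ 2.
  rewrite [LHS]ipDr [ip _ (- _)]ipNr ipZr C3 mulr0 subr0.
  rewrite [LHS]ipDr [ip _ (- _)]ipNr ipZr C2 mulr0 subr0.
  rewrite !ip_simp (ipC f2) (ipC f3) Hr2 Hr3 T [in LHS]Hcz; ring.
have H42 : ip f4 f2 = 0 by rewrite f4E ipZl C2 mulr0.
have H43 : ip f4 f3 = 0 by rewrite f4E ipZl C3 mulr0.
have H44 : ip f4 f4 = -1.
  by rewrite f4E ipZl ipZr HC; field.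
have Z u w : ip u m1 = 0 -> ip u m2 = 0 -> w = f0 \/ w = f1' -> ip u w = 0.
  by move=> u1 u2 [|] ->; rewrite ?f1'E ?f0E !ip_simp u1 u2; ring.
have Zp w : w = f0 \/ w = f1' -> ip p w = 0 by apply: Z; rewrite T.
have Zq w : w = f0 \/ w = f1' -> ip q w = 0 by apply: Z; rewrite T.
have Zr w : w = f0 \/ w = f1' -> ip r w = 0 by apply: Z; rewrite T.
have Z2 w : w = f0 \/ w = f1' -> ip f2 w = 0.
  by move=> h; rewrite f2E !ip_simp Zp ?Zq //; ring.
have Z3 w : w = f0 \/ w = f1' -> ip f3 w = 0.
  by move=> h; rewrite f3E !ip_simp Zp ?Z2 //; ring.
have Z4 w : w = f0 \/ w = f1' -> ip f4 w = 0.
  by move=> h; rewrite f4E !ip_simp Zr ?Z2 ?Z3 //; ring.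
have hf : orthonormal_frame f0 f1 f2 f3 f4.
  have L : f0 = f0 \/ f0 = f1' by left.
  have L' : f1' = f0 \/ f1' = f1' by right.
  split; rewrite ?f1E ?ipZl ?ipZr //.
  - by rewrite H1'1' mulr1 mulrNN.
  - by rewrite (ipC f0) H1'0 mulr0.
  - by rewrite ipC Z2.
  - by rewrite ipC Z3.
  - by rewrite ipC Z4.
  - by rewrite ipC Z2 // mulr0.
  - by rewrite ipC Z3 // mulr0.
  - by rewrite ipC Z4 // mulr0.
  - by rewrite ipC.
  - by rewrite ipC.
  - by rewrite ipC.
(* The difference is isotropic and orthogonal to the positive plane of [f0] and [f1'], on whose
   orthogonal the form is definite; so it vanishes. *)
have m3E : m3 = - (n / s) *: f1'.
  have H31' : ip m3 f1' = - (n / s).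
    by rewrite f1'E !ip_simp H30 T; ring.
  have P1 : ip f0 f1' = 0 by rewrite ipC.
  have D0 : ip f0 (m3 + (n / s) *: f1') = 0.
    by rewrite !ip_simp (ipC f0 m3) H30 P1; ring.
  have D1 : ip f1' (m3 + (n / s) *: f1') = 0.
    by rewrite !ip_simp (ipC f1' m3) H31' H1'1'; ring.
  have [_ K] := orthonormal_pair_lt0 H00 H1'1' P1 D0 D1.
  apply/eqP; rewrite -subr_eq0 scaleNr opprK; apply/eqP/K.
  rewrite !ip_simp (ipC f1' m3) H31' H1'1' T.
  have -> : z = (n / s) ^+ 2.
    by apply: (mulIf (_ : s ^+ 2 != 0)); [rewrite expf_neq0|rewrite zs; field].
  by ring.
have f1s c' : (- e * c') *: f1 = c' *: f1'.
  by rewrite f1E scalerA; congr (_ *: _); rewrite -[RHS]mul1r -e1; ring.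
have m1E : m1 = X *: f0 + (s / n) *: f1'.
  by apply/rowP => k; rewrite f1'E !mxE; field; rewrite nN0 sN0.
have pE : p = X *: f2 - (s / n) *: f3.
  by apply/rowP => k; rewrite f3E !mxE; field; rewrite nN0 sN0.
have m2E : m2 = - Y *: f0 + (s / n) *: f1'.
  have -> : m2 = m1 - n *: f0 by apply/rowP => k; rewrite f0E !mxE; field.
  by rewrite {1}m1E; apply/rowP => k; rewrite !mxE; move: nE;
    set a := X; set b := Y; set c0 := s / n => ->; ring.
have qE : q = Y *: f2 + (s / n) *: f3.
  have -> : q = n *: f2 - p by apply/rowP => k; rewrite f2E !mxE; field.
  by rewrite {1}pE; apply/rowP => k; rewrite !mxE; move: nE;
    set a := X; set b := Y; set c0 := s / n => ->; ring.
have rE : r = (2 / n) *: f2 + c *: f3 + (2 / s) *: f4.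
  by apply/rowP => k; rewrite f4E !mxE; field; rewrite nN0 sN0.
exists (frame_mx f0 f1 f2 f3 f4); split; first exact: frame_isometry.
have M := mul_frame_mx f0 f1 f2 f3 f4.
split; last split; rewrite M !vec5E ?f1s !scale0r ?addr0 ?add0r //.
by rewrite {1}pE scaleNr.
Qed.
End One.

Section Two.
Variable t : R.
Hypotheses (st : s * t = x - y) (zn : z * n ^+ 2 = 4 + t ^+ 2).
Notation Ap := (nAp s n).
Notation Am := (nAm s n).
Notation Bp := (nBp z n).
Notation Bm := (nBm z n).

Lemma sign_choice (a b c d : R) : a ^+ 2 = c ^+ 2 -> b ^+ 2 = d ^+ 2 ->
  a * b = - (c * d) -> exists g : R, [/\ g * g = 1, a = - (g * c) & b = g * d].
Proof.
move=> /eqP; rewrite eqf_sqr => /orP[] /eqP-> /eqP; rewrite eqf_sqr => /orP[] /eqP-> e0.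
- have /eqP : c * d = 0 by lra.
  rewrite mulf_eq0 => /orP[] /eqP->; [exists 1|exists (-1)]; split; ring.
- by exists (-1); split; ring.
- by exists 1; split; ring.
- have /eqP : c * d = 0 by lra.
  rewrite mulf_eq0 => /orP[] /eqP->; [exists (-1)|exists 1]; split; ring.
Qed.

(** Here [f1'] and [f2] solve the linear system that expresses [a] and [m3] in the plane of
    signature (1, 1), with determinant [nDelta]. The vectors p, q, r lie in the negative plane
    orthogonal to [f0], [f1'], [f2], whose first axis [f3] is p + q normalised; only the sign of its
    second axis is left to choose. *)
Lemma gram_normal_two : exists g, isometry g /\
  [/\ p = two_p x s n *m g, q = two_q y s n *m g, r = two_r t n *m g &
   [/\ m1 = two_m1 e x s n *m g, m2 = two_m2 e y s n *m g & m3 = two_m3 e z n *m g]].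
Proof.
have [f0 f0E] : exists f : V, f = n^-1 *: (m1 - m2) by eexists.
have [a aE] : exists f : V, f = m1 - X *: f0 by eexists.
have [f1' f1'E] : exists f : V, f = (n / 2) *: (Bm *: a - Am *: m3) by eexists.
have [f1 f1E] : exists f : V, f = - e *: f1' by eexists.
have [f2 f2E] : exists f : V, f = (n / 2) *: (Ap *: m3 - Bp *: a) by eexists.
have [f3 f3E] : exists f : V, f = n^-1 *: (p + q) by eexists.
have H00 : ip f0 f0 = 1.
  rewrite f0E !ip_simp !T; apply: (clear_n2 n0).
  by transitivity (x + y + 2); [field|rewrite n2 mul1r].
have H10 : ip m1 f0 = X by rewrite f0E !ip_simp !T /nX; field.
have H30 : ip m3 f0 = 0 by rewrite f0E !ip_simp !T; ring.
have A0 : ip a f0 = 0 by rewrite aE !ip_simp H10 H00; ring.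
have AA : ip a a = Ap ^+ 2 - Am ^+ 2.
  have -> : Ap ^+ 2 - Am ^+ 2 = (s / n) ^+ 2 by apply: nA2.
  transitivity (ip a (m1 - X *: f0)); first by rewrite -aE.
  rewrite ipDr ipNr ipZr A0 mulr0 subr0 aE ipDl ipNl ipZl (ipC f0) H10 T.
  by have := HX; set b := X; set c := s / n; rewrite !expr2 => ?; lra.
have A3 : ip a m3 = Ap * Bp - Am * Bm.
  by rewrite (nAB n0 n2 s2 st zn) aE !ip_simp (ipC f0) H30 T; ring.
have M33 : ip m3 m3 = Bp ^+ 2 - Bm ^+ 2 by rewrite nB2 // T.
have D := nDelta n0 n2 s2 st zn.
have D' : n / 2 * (Ap * Bm - Am * Bp) = 1 by rewrite D; field.
have H1'0 : ip f1' f0 = 0 by rewrite f1'E !ip_simp A0 H30; ring.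
have H20 : ip f2 f0 = 0 by rewrite f2E !ip_simp A0 H30; ring.
have H1'1' : ip f1' f1' = 1.
  transitivity ((n / 2 * (Ap * Bm - Am * Bp)) ^+ 2); last by rewrite D' expr1n.
  by rewrite f1'E !ip_simp (ipC m3 a) AA A3 M33; set k := n / 2; ring.
have H22 : ip f2 f2 = -1.
  transitivity (- (n / 2 * (Ap * Bm - Am * Bp)) ^+ 2); last by rewrite D' expr1n.
  by rewrite f2E !ip_simp (ipC m3 a) AA A3 M33; set k := n / 2; ring.
have H1'2 : ip f1' f2 = 0.
  by rewrite f1'E f2E !ip_simp (ipC m3 a) AA A3 M33; set k := n / 2; ring.
have H33 : ip f3 f3 = -1.
  rewrite f3E !ip_simp !T; apply: (clear_n2 n0).
  by transitivity (- (x + y + 2)); [field|rewrite n2; ring].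
have [Zp [Zq Zr]] : (forall w, w \in [:: f0; f1'; f2] -> ip p w = 0) /\
    (forall w, w \in [:: f0; f1'; f2] -> ip q w = 0) /\
    (forall w, w \in [:: f0; f1'; f2] -> ip r w = 0).
  by split; [|split] => w; rewrite !inE => /or3P[] /eqP->;
    rewrite ?f1'E ?f2E ?aE ?f0E !ip_simp !T; ring.
have m0 : f0 \in [:: f0; f1'; f2] by rewrite !inE eqxx.
have m1' : f1' \in [:: f0; f1'; f2] by rewrite !inE eqxx orbT.
have m2' : f2 \in [:: f0; f1'; f2] by rewrite !inE eqxx !orbT.
have Z3 w : w \in [:: f0; f1'; f2] -> ip f3 w = 0.
  by move=> h; rewrite f3E !ip_simp Zp ?Zq //; ring.
(* The last axis is taken as any vector orthogonal to the other four: p alone would not provide it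
   when s = 0. *)
have [u [uN0 u0 u1 u2 u3]] := exists_orthogonal f0 f1' f2 f3.
have [ul u00] := orthonormal_pair_lt0 H00 H1'1' (etrans (ipC _ _) H1'0)
  (etrans (ipC _ _) u0) (etrans (ipC _ _) u1).
have uu : 0 < - ip u u.
  rewrite oppr_gt0 lt_neqAle ul andbT; apply/eqP => /u00 z0.
  by rewrite z0 eqxx in uN0.
pose c := Num.sqrt (- ip u u).
have c0 : c != 0 by rewrite gt_eqF // sqrtr_gt0.
have c2 : c * c = - ip u u by rewrite -expr2 sqr_sqrtr // ltW.
have [f4' f4'E] : exists f : V, f = c^-1 *: u by eexists.
have H4'4' : ip f4' f4' = -1.
  by rewrite f4'E ipZl ipZr -[ip u u]opprK -c2; field.
have Z4 w : ip u w = 0 -> ip f4' w = 0 by move=> h; rewrite f4'E ipZl h mulr0.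
have frm (g : R) : g * g = 1 -> orthonormal_frame f0 f1 f2 f3 (g *: f4').
  move=> gg; split; rewrite ?f1E ?ipZl ?ipZr //.
  - by rewrite H1'1' mulr1 mulrNN.
  - by rewrite H4'4' mulrN1 mulrN gg.
  - by rewrite (ipC f0) H1'0 mulr0.
  - by rewrite ipC.
  - by rewrite ipC Z3.
  - by rewrite ipC Z4 // mulr0.
  - by rewrite H1'2 mulr0.
  - by rewrite ipC Z3 // mulr0.
  - by rewrite (ipC f1') Z4 // !mulr0.
  - by rewrite ipC Z3.
  - by rewrite ipC Z4 // mulr0.
  - by rewrite ipC Z4 // mulr0.
have Hp3 : ip p f3 = - X by rewrite f3E !ip_simp !T /nX; field.
have Hq3 : ip q f3 = - Y by rewrite f3E !ip_simp !T /nY; field.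
have Hr3 : ip r f3 = - (2 / n) by rewrite f3E !ip_simp !T; field.
have ff : orthonormal_frame f0 f1 f2 f3 f4' by rewrite -[f4']scale1r; apply: frm; ring.
have dec w k : (forall f, f \in [:: f0; f1'; f2] -> ip w f = 0) -> ip w f3 = - k ->
    w = k *: f3 - ip w f4' *: f4'.
  move=> wz w3; apply/eqP; rewrite -subr_eq0; apply/eqP.
  have [w0 w1 w2] : [/\ ip w f0 = 0, ip w f1' = 0 & ip w f2 = 0].
    by split; apply: wz.
  have [a0 a1 a2] : [/\ ip f3 f0 = 0, ip f3 f1' = 0 & ip f3 f2 = 0].
    by split; apply: Z3.
  have [b0 b1 b2 b3] : [/\ ip f4' f0 = 0, ip f4' f1' = 0, ip f4' f2 = 0 & ip f4' f3 = 0].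
    by split; apply: Z4.
  apply: (frame_orthogonal_eq0 ff); rewrite ?f1E !ip_simp.
  - by rewrite w0 a0 b0; ring.
  - by rewrite w1 a1 b1; ring.
  - by rewrite w2 a2 b2; ring.
  - by rewrite w3 H33 b3; ring.
  - by rewrite (ipC f3) b3 H4'4'; ring.
have pE := dec p X Zp Hp3; have qE := dec q Y Zq Hq3; have rE := dec r _ Zr Hr3.
move: pE qE rE; set P4 := ip p f4'; set Q4 := ip q f4'; set R4 := ip r f4' => pE qE rE.
have H34 : ip f3 f4' = 0 by rewrite ipC Z4.
have E1 : X ^+ 2 + P4 ^+ 2 = x.
  have := (gpp G); rewrite {1 2}pE !ip_simp H34 (ipC f4') H34 H33 H4'4' !expr2 => ?; lra.
have E2 : (2 / n) ^+ 2 + R4 ^+ 2 = z.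
  have := (grr G); rewrite {1 2}rE !ip_simp H34 (ipC f4') H34 H33 H4'4' !expr2 => ?; lra.
have E3 : X * (2 / n) + P4 * R4 = 1.
  have := (gpr G); rewrite {1}pE {1}rE !ip_simp H34 (ipC f4') H34 H33 H4'4' => ?; lra.
have E4 : Q4 = - P4.
  have : ip (p + q) f4' = 0.
    by rewrite (_ : p + q = n *: f3) ?ipZl ?H34 ?mulr0 // f3E scalerA divff // scale1r.
  by rewrite ipDl -/P4 -/Q4 => ?; lra.
(* The Gram matrix fixes the squares and the product of the last components of p and r, hence both
   components up to one common sign. *)
have [g [gg gP gR]] : exists g : R, [/\ g * g = 1, P4 = - (g * - (s / n)) & R4 = g * - (t / n)].
  apply: sign_choice.
  - by rewrite sqrrN; have := HX; move: E1; set b := X; set d := s / n; rewrite !expr2 => ? ?; lra.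
  - by rewrite sqrrN; have := nr2 n0 zn; move: E2; set b := 2 / n; set d := t / n; rewrite !expr2 => ? ?; lra.
  - have := nXr n0 n2 st; move: E3; set b := X; set b' := 2 / n; set d := s / n; set d' := t / n => ? ?; lra.
have f1s c' : (- e * c') *: f1 = c' *: f1'.
  by rewrite f1E scalerA; congr (_ *: _); rewrite -[RHS]mul1r -e1; ring.
have aF : a = Ap *: f1' + Am *: f2.
  apply/rowP => k; transitivity (n / 2 * (Ap * Bm - Am * Bp) * a 0 k); first by rewrite D' mul1r.
  by rewrite f1'E f2E !mxE; set h := n / 2; ring.
have m3F : m3 = Bp *: f1' + Bm *: f2.
  apply/rowP => k; transitivity (n / 2 * (Ap * Bm - Am * Bp) * m3 0 k); first by rewrite D' mul1r.
  by rewrite f1'E f2E !mxE; set h := n / 2; ring.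
have m1E : m1 = X *: f0 + (Ap *: f1' + Am *: f2) by rewrite -aF aE addrC subrK.
have m2E : m2 = - Y *: f0 + (Ap *: f1' + Am *: f2).
  have -> : m2 = m1 - n *: f0 by apply/rowP => k; rewrite f0E !mxE; field.
  rewrite {1}m1E; apply/rowP => k; rewrite !mxE; move: nE.
  by set b := X; set b' := Y; set d := Ap; set d' := Am => ->; ring.
exists (frame_mx f0 f1 f2 f3 (g *: f4')); split; first exact/frame_isometry/frm.
have M := mul_frame_mx f0 f1 f2 f3 (g *: f4').
split; last split; rewrite M !vec5E ?f1s !scale0r ?addr0 ?add0r // ?scalerA.
- by rewrite {1}pE gP -scaleNr; congr (_ + _ *: _); ring.
- by rewrite {1}qE E4 gP -scaleNr; congr (_ + _ *: _); ring.
- by rewrite {1}rE gR -scaleNr; congr (_ + _ *: _); ring.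
- by rewrite {1}m1E addrA.
- by rewrite {1}m2E addrA.
Qed.
End Two.
End Frames.

(** * Invariants of a hexagon *)

Section Invariants.
Context {R : realType}.
Notation V := 'rV[R]_5.

(** The square root contains the factors that equalise the products in the triples (a, c, d) and (b,
    f, g). The whole is of degree 0 in each vector, hence a function of the rays. *)
Definition inv6 (v : 'I_6 -> V) (a b c d f g : 'I_6) : R :=
  let N i j := `|ip (v i) (v j)| in
  N a b * Num.sqrt (N c d * N f g / (N a c * N a d * (N b f * N b g))).

(* The products of opposite vertices once v is scaled so that the products of
   vertices of the same parity are -2 (up to a factor -2). *)
Definition inv_x v := inv6 v j0 j3 j2 j4 j1 j5.
Definition inv_y v := inv6 v j4 j1 j0 j2 j3 j5.
Definition inv_z v := inv6 v j2 j5 j0 j4 j1 j3.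

Definition nonadj (v : 'I_6 -> V) := forall i j, ~~ cyc_adj i j -> ip (v i) (v j) != 0.

Lemma hexagon_nonadj v : negative_hexagon v -> nonadj v.
Proof. by move=> hv i j nij; have := hv i j; rewrite (negbTE nij) => ?; rewrite lt_eqF. Qed.

Lemma inv6_scale (v v' : 'I_6 -> V) (k : 'I_6 -> R) (h : 'M[R]_5) a b c d f g :
  isometry h -> (forall i, k i != 0) -> (forall i, v' i = k i *: (v i *m h)) ->
  ip (v a) (v c) != 0 -> ip (v a) (v d) != 0 -> ip (v b) (v f) != 0 ->
  ip (v b) (v g) != 0 -> inv6 v' a b c d f g = inv6 v a b c d f g.
Proof.
move=> ih kN0 v'E ac ad bf bg; rewrite /inv6.
have E i j : `|ip (v' i) (v' j)| = `|k i| * `|k j| * `|ip (v i) (v j)|.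
  by rewrite !v'E ipZl ipZr ih !normrM mulrA.
rewrite !E.
have kN i : `|k i| != 0 by rewrite normr_eq0.
set A := `|ip (v a) (v c)|; set B := `|ip (v a) (v d)|.
set C := `|ip (v b) (v f)|; set D := `|ip (v b) (v g)|.
set N1 := `|ip (v c) (v d)|; set N2 := `|ip (v f) (v g)|.
have [A0 B0 C0 D0] : [/\ A != 0, B != 0, C != 0 & D != 0] by rewrite !normr_eq0.
set ka := `|k a|; set kb := `|k b|.
have ka0 : 0 < ka by rewrite normr_gt0. have kb0 : 0 < kb by rewrite normr_gt0.
rewrite (_ : _ / _ = (ka * kb)^-1 ^+ 2 * (N1 * N2 / (A * B * (C * D)))); last first.
  by field; rewrite A0 B0 C0 D0 !kN.
rewrite sqrtrM ?sqr_ge0 // sqrtr_sqr (ger0_norm (_ : 0 <= (ka * kb)^-1)) ?invr_ge0 ?mulr_ge0 ?ltW //.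
by set S := Num.sqrt _; field; rewrite !gt_eqF.
Qed.

Lemma inv_scale (v v' : 'I_6 -> V) (k : 'I_6 -> R) (h : 'M[R]_5) :
  nonadj v -> isometry h -> (forall i, k i != 0) ->
  (forall i, v' i = k i *: (v i *m h)) ->
  [/\ inv_x v' = inv_x v, inv_y v' = inv_y v & inv_z v' = inv_z v].
Proof.
by move=> nv ih k0 v'E; split; apply: (inv6_scale ih k0 v'E); exact: nv.
Qed.

Lemma inv6_continuous (X : topologicalType) (v : X -> 'I_6 -> V) (x : X) a b c d f g :
  (forall i, {for x, continuous (v^~ i)}) ->
  ip (v x a) (v x c) != 0 -> ip (v x a) (v x d) != 0 -> ip (v x b) (v x f) != 0 ->
  ip (v x b) (v x g) != 0 ->
  {for x, continuous (fun y => inv6 (v y) a b c d f g)}.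
Proof.
move=> cv ac ad bf bg; rewrite /inv6.
have cN i j : {for x, continuous (fun y => `|ip (v y i) (v y j)|)}.
  by apply: cont_norm; apply: cont_ip.
apply: contM; first exact: cN.
apply: cont_sqrt; apply: contM; first by apply: contM; exact: cN.
apply: contV; first by rewrite !mulf_neq0 ?normr_eq0.
by apply: contM; apply: contM; exact: cN.
Qed.

Lemma inv_six x y z (p q r m1 m2 m3 : V) : 0 < x -> 0 < y -> 0 < z ->
  gram x y z p q r m1 m2 m3 ->
  [/\ inv_x (six p q r m1 m2 m3) = x, inv_y (six p q r m1 m2 m3) = y &
      inv_z (six p q r m1 m2 m3) = z].
Proof.
move=> x0 y0 z0 G; have T := gram_rules G.
set v := six p q r m1 m2 m3.
have E i j c : 0 <= c -> ip (v i) (v j) = - (2 * c) -> `|ip (v i) (v j)| = 2 * c.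
  by move=> c0 ->; rewrite normrN ger0_norm // mulr_ge0.
have F (c : R) : 0 < c -> 2 * c * Num.sqrt (2 * 1 * (2 * 1) / (2 * 1 * (2 * 1) * (2 * 1 * (2 * 1)))) = c.
  move=> c0; rewrite (_ : _ / _ = (1 / 2) ^+ 2); last by field.
  by rewrite sqrtr_sqr ger0_norm; [field|lra].
split; rewrite /inv_x /inv_y /inv_z /inv6.
- by rewrite (E j0 j3 x) ?(E j2 j4 1) ?(E j1 j5 1) ?(E j0 j2 1) ?(E j0 j4 1) ?(E j3 j1 1)
    ?(E j3 j5 1) ?F ?ltW //; rewrite /v /six /= !ip_simp !T; ring.
- by rewrite (E j4 j1 y) ?(E j0 j2 1) ?(E j3 j5 1) ?(E j4 j0 1) ?(E j4 j2 1) ?(E j1 j3 1)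
    ?(E j1 j5 1) ?F ?ltW //; rewrite /v /six /= !ip_simp !T; ring.
- by rewrite (E j2 j5 z) ?(E j0 j4 1) ?(E j1 j3 1) ?(E j2 j0 1) ?(E j2 j4 1) ?(E j5 j1 1)
    ?(E j5 j3 1) ?F ?ltW //; rewrite /v /six /= !ip_simp !T; ring.
Qed.

Lemma hexagon_gram (v : 'I_6 -> V) : negative_hexagon v ->
  exists (k : 'I_6 -> R) (p q r m1 m2 m3 : V), [/\ forall i, 0 < k i,
    forall i, six p q r m1 m2 m3 i = k i *: v i,
    [/\ 0 < inv_x v, 0 < inv_y v & 0 < inv_z v] &
    gram (inv_x v) (inv_y v) (inv_z v) p q r m1 m2 m3].
Proof.
move=> hv; pose N i j := `|ip (v i) (v j)|.
have N0 i j : ~~ cyc_adj i j -> 0 < N i j.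
  by move=> /(hexagon_nonadj hv); rewrite normr_gt0.
have NC i j : N i j = N j i by rewrite /N ipC.
have ipN i j : ~~ cyc_adj i j -> ip (v i) (v j) = - N i j.
  by move=> nij; have := hv i j; rewrite (negbTE nij) /N => lt; rewrite ltr0_norm // opprK.
have ip0 i j : cyc_adj i j -> ip (v i) (v j) = 0.
  by move=> nij; have := hv i j; rewrite nij.
(* The factor of vertex [a] in the unique positive scaling that makes the three products in the
   triple (a, b, c) equal to -2. *)
pose K a b c := Num.sqrt (2 * N b c / (N a b * N a c)).
have KK a b c : ~~ cyc_adj a b -> ~~ cyc_adj a c -> ~~ cyc_adj b c ->
    K a b c * K b a c * N a b = 2.
  move=> /N0 ab /N0 ac /N0 bc; rewrite /K -sqrtrM ?divr_ge0 ?mulr_ge0 ?ltW //.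
  rewrite (NC b a) (_ : _ * _ / _ * _ = (2 / N a b) ^+ 2); last first.
    by field; rewrite !gt_eqF.
  by rewrite sqrtr_sqr ger0_norm ?divr_ge0 ?ltW // divfK // gt_eqF.
have K0 a b c : ~~ cyc_adj a b -> ~~ cyc_adj a c -> ~~ cyc_adj b c -> 0 < K a b c.
  by move=> /N0 ab /N0 ac /N0 bc; rewrite sqrtr_gt0 divr_gt0 // mulr_gt0.
have KL a b c d f g : ~~ cyc_adj a c -> ~~ cyc_adj a d -> ~~ cyc_adj c d ->
    ~~ cyc_adj b f -> ~~ cyc_adj b g -> ~~ cyc_adj f g ->
    K a c d * K b f g * N a b = 2 * inv6 v a b c d f g.
  move=> /N0 ac /N0 ad /N0 cd /N0 bf /N0 bg /N0 fg; rewrite /K -sqrtrM ?divr_ge0 ?mulr_ge0 ?ltW //.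
  rewrite (_ : _ * _ / _ * _ = 2 ^+ 2 * (N c d * N f g / (N a c * N a d * (N b f * N b g)))); last first.
    by field; rewrite !gt_eqF.
  by rewrite sqrtrM ?sqr_ge0 // sqrtr_sqr ger0_norm // /inv6 -!/(N _ _); ring.
have KS a b c : K a b c = K a c b by rewrite /K NC (mulrC (N a b)).
pose k (i : 'I_6) := nth 0 [:: K j0 j2 j4; K j1 j3 j5; K j2 j0 j4; K j3 j1 j5; K j4 j0 j2; K j5 j1 j3] i.
have kp i : 0 < k i by move: i; apply: ord6_ind; exact: K0.
have [w wE] : exists w : 'I_6 -> V, forall i, w i = k i *: v i.
  by exists (fun i => k i *: v i).
have wa i j : cyc_adj i j -> ip (w i) (w j) = 0.
  by move=> a; rewrite !wE ipZl ipZr ip0 // !mulr0.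
have w2 i j : k i * k j * N i j = 2 -> ~~ cyc_adj i j -> ip (w i) (w j) = -2.
  by move=> e a; rewrite !wE ipZl ipZr ipN // -e; ring.
have wX i j c : k i * k j * N i j = 2 * c -> ~~ cyc_adj i j -> ip (w i) (w j) = - (2 * c).
  by move=> e a; rewrite !wE ipZl ipZr ipN // -e; ring.
have w02 : ip (w j0) (w j2) = -2 by apply: w2 => //; exact: KK.
have w04 : ip (w j0) (w j4) = -2 by apply: w2 => //; rewrite /k /= KS; exact: KK.
have w24 : ip (w j2) (w j4) = -2 by apply: w2 => //; rewrite /k /= KS (KS j4); exact: KK.
have w13 : ip (w j1) (w j3) = -2 by apply: w2 => //; exact: KK.
have w15 : ip (w j1) (w j5) = -2 by apply: w2 => //; rewrite /k /= KS; exact: KK.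
have w35 : ip (w j3) (w j5) = -2 by apply: w2 => //; rewrite /k /= KS (KS j5); exact: KK.
have w03 : ip (w j0) (w j3) = - (2 * inv_x v) by apply: wX => //; exact: KL.
have w41 : ip (w j4) (w j1) = - (2 * inv_y v) by apply: wX => //; exact: KL.
have w25 : ip (w j2) (w j5) = - (2 * inv_z v) by apply: wX => //; exact: KL.
have pos a b c d f g : ~~ cyc_adj a b -> ~~ cyc_adj a c -> ~~ cyc_adj a d -> ~~ cyc_adj c d ->
    ~~ cyc_adj b f -> ~~ cyc_adj b g -> ~~ cyc_adj f g -> 0 < inv6 v a b c d f g.
  move=> /N0 ab /N0 ac /N0 ad /N0 cd /N0 bf /N0 bg /N0 fg.
  by rewrite /inv6 -!/(N _ _) mulr_gt0 // sqrtr_gt0 divr_gt0 ?mulr_gt0.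
pose half (u u' : V) : V := 2^-1 *: (u + u').
exists k, (half (w j0) (w j3)), (half (w j4) (w j1)), (half (w j2) (w j5)),
  (half (w j0) (- w j3)), (half (w j4) (- w j1)), (half (w j2) (- w j5)).
split => //.
- by apply: ord6_ind; rewrite /six /half /= -wE; apply/rowP => l; rewrite !mxE; field.
- by split; apply: pos.
pose T := (w02, w04, w24, w13, w15, w35, w03, w41, w25).
have sym i j c : ip (w i) (w j) = c -> ip (w j) (w i) = c by rewrite ipC.
pose T' := (sym _ _ _ w02, sym _ _ _ w04, sym _ _ _ w24, sym _ _ _ w13, sym _ _ _ w15,
  sym _ _ _ w35, sym _ _ _ w03, sym _ _ _ w41, sym _ _ _ w25).
by split; rewrite /half !ip_simp ?T ?T' ?wa //; field.
Qed.

(** A linear relation among the six vectors splits, by orthogonality, into one for p, q, r and one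
    for m1, m2, m3, with determinants [DM] (up to sign) and [DK]. If both were non-zero the relation
    would be trivial. *)
Lemma gram_classification x y z (p q r m1 m2 m3 : V) : 0 < x -> 0 < y -> 0 < z ->
  gram x y z p q r m1 m2 m3 ->
  (x * y * z = x + y + z + 2 /\ 1 < x * y) \/
  [/\ x * y * z = x + y + z - 2, 1 <= x * y & x * y = 1 -> [/\ x = 1, y = 1 & 1 <= z]].
Proof.
move=> x0 y0 z0 G; have T := gram_rules G.
(* The plane of m1 - m2 and m1 - m3 is positive definite and orthogonal to p, q, r. Testing x q - p
   and x r - p then bounds x y and x z. *)
have neg a b c : ip (a *: p + b *: q + c *: r) (a *: p + b *: q + c *: r) <= 0.
  have [||||H _] := @ip_lt0_orth _ (m1 - m2) (m1 - m3) (a *: p + b *: q + c *: r).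
  - by rewrite !ip_simp !T; lra.
  - rewrite !ip_simp !T; have xy := mulr_gt0 x0 y0; have xz := mulr_gt0 x0 z0.
    have yz := mulr_gt0 y0 z0; rewrite expr2; nra.
  - by rewrite !ip_simp !T; ring.
  - by rewrite !ip_simp !T; ring.
  - exact: H.
have xy1 : 1 <= x * y.
  have := neg (-1) x 0; rewrite !ip_simp !T => H.
  have : x * (1 - x * y) <= 0 by lra.
  by rewrite pmulr_rle0 // subr_le0.
have xz1 : 1 <= x * z.
  have := neg (-1) 0 x; rewrite !ip_simp !T => H.
  have : x * (1 - x * z) <= 0 by lra.
  by rewrite pmulr_rle0 // subr_le0.
pose A : 'M[R]_(6, 5) := \matrix_(i < 6) nth 0 [:: p; q; r; m1; m2; m3] i.
have [c c0 cA] := left_kernel A.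
have {}cA : c 0 j0 *: p + c 0 j1 *: q + c 0 j2 *: r + c 0 j3 *: m1 + c 0 j4 *: m2 + c 0 j5 *: m3 = 0.
  by rewrite -cA mulmx_sum_row sum6E !rowK.
have ort u : ip (c 0 j0 *: p + c 0 j1 *: q + c 0 j2 *: r + c 0 j3 *: m1 + c 0 j4 *: m2 + c 0 j5 *: m3) u = 0.
  by rewrite cA ip0l.
have := ort p; have := ort q; have := ort r; have := ort m1; have := ort m2; have := ort m3.
rewrite !ip_simp !T; set a0 := c 0 j0; set a1 := c 0 j1; set a2 := c 0 j2;
  set a3 := c 0 j3; set a4 := c 0 j4; set a5 := c 0 j5 => E5 E4 E3 E2 E1 E0.
have [F0 F1 F2] : [/\ x * a0 + a1 + a2 = 0, a0 + y * a1 + a2 = 0 & a0 + a1 + z * a2 = 0].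
  by clear -E0 E1 E2; split; lra.
have [F3 F4 F5] : [/\ x * a3 - a4 - a5 = 0, - a3 + y * a4 - a5 = 0 & - a3 - a4 + z * a5 = 0].
  by clear -E3 E4 E5; split; lra.
pose DM := x * y * z + 2 - x - y - z; pose DK := x * y * z - 2 - x - y - z.
(* Here and below the coefficients are rows of the adjugate matrices. *)
have M0 : DM * a0 = 0.
  transitivity ((y * z - 1) * (x * a0 + a1 + a2) + (1 - z) * (a0 + y * a1 + a2) + (1 - y) * (a0 + a1 + z * a2)).
    by rewrite /DM; ring.
  by rewrite F0 F1 F2; ring.
have M1 : DM * a1 = 0.
  transitivity ((1 - z) * (x * a0 + a1 + a2) + (x * z - 1) * (a0 + y * a1 + a2) + (1 - x) * (a0 + a1 + z * a2)).
    by rewrite /DM; ring.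
  by rewrite F0 F1 F2; ring.
have M2 : DM * a2 = 0.
  transitivity ((1 - y) * (x * a0 + a1 + a2) + (1 - x) * (a0 + y * a1 + a2) + (x * y - 1) * (a0 + a1 + z * a2)).
    by rewrite /DM; ring.
  by rewrite F0 F1 F2; ring.
have K3 : DK * a3 = 0.
  transitivity ((y * z - 1) * (x * a3 - a4 - a5) + (z + 1) * (- a3 + y * a4 - a5) + (1 + y) * (- a3 - a4 + z * a5)).
    by rewrite /DK; ring.
  by rewrite F3 F4 F5; ring.
have K4 : DK * a4 = 0.
  transitivity ((z + 1) * (x * a3 - a4 - a5) + (x * z - 1) * (- a3 + y * a4 - a5) + (1 + x) * (- a3 - a4 + z * a5)).
    by rewrite /DK; ring.
  by rewrite F3 F4 F5; ring.
have K5 : DK * a5 = 0.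
  transitivity ((y + 1) * (x * a3 - a4 - a5) + (1 + x) * (- a3 + y * a4 - a5) + (x * y - 1) * (- a3 - a4 + z * a5)).
    by rewrite /DK; ring.
  by rewrite F3 F4 F5; ring.
have [DK0|DKN] := eqVneq DK 0.
  left; have e : x * y * z = x + y + z + 2 by move: DK0; clear; rewrite /DK; lra.
  split => //; have : 0 < z * (x * y - 1) by clear -e x0 y0 z0; lra.
  by rewrite pmulr_rgt0 // subr_gt0.
have DM0 : DM = 0.
  apply/eqP; apply: contraTT isT => DMN.
  have Z (D a : R) : D != 0 -> D * a = 0 -> a = 0.
    by move=> DN /eqP; rewrite mulf_eq0 (negbTE DN) => /eqP.
  have /eqP[] := c0; apply/rowP; apply: ord6_ind; rewrite mxE.
  - exact: Z DMN M0.
  - exact: Z DMN M1.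
  - exact: Z DMN M2.
  - exact: Z DKN K3.
  - exact: Z DKN K4.
  - exact: Z DKN K5.
have e : x * y * z = x + y + z - 2 by move: DM0; clear; rewrite /DM; lra.
right; split => // xy.
have x1 : x = 1.
  have : (x - 1) ^+ 2 = 0 by move: e; rewrite xy expr2; clear -xy; nra.
  by move/eqP; rewrite sqrf_eq0 subr_eq0 => /eqP.
by move: xy xz1; rewrite x1 !mul1r.
Qed.

End Invariants.

(** * Polygons in the same orbit *)

Section Moduli.
Context {R : realType}.
Notation V := 'rV[R]_5.
Notation "''S' i" := (@ordS 6 i) (at level 8, i at level 2).

Lemma null_isometry (h : 'M[R]_5) (c : R) (w : null_vector R) : isometry h -> c != 0 ->
  exists w' : null_vector R, val w' = c *: (val w *m h).
Proof.
move=> ih c0; have [w0 ww] := null_vectorP w.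
suff N : null_vectors (c *: (val w *m h)) by exists (SigSub (mem_set N)).
split; last by rewrite ipZl ipZr ih ww !mulr0.
rewrite scaler_eq0 negb_or c0 /=; apply: contra w0 => /eqP z.
by rewrite -(mulmxK (isometry_unit ih) (val w)) z mul0mx.
Qed.

(** Positive factors on the vertices preserve the sectors, and the common sign [s] disappears in
    projective space. *)
Lemma hex_polygon_translate (x x' : 'I_6 -> null_vector R) (h : 'M[R]_5)
    (s : R) (d : 'I_6 -> R) :
  negative_hexagon (fun i => val (x i)) -> isometry h -> s * s = 1 ->
  (forall i, 0 < d i) -> (forall i, val (x' i) = (s * d i) *: (val (x i) *m h)) ->
  hex_polygon x' = translate_polygon h (hex_polygon x).
Proof.
move=> hx ih ss d0 x'E.
have s0 : s != 0 by apply/eqP => z; move: ss; rewrite z mul0r => /eqP; rewrite eq_sym oner_eq0.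
congr MarkedPolygon.
  apply/funext => i /=; rewrite act_Ein_line //; symmetry; apply/lineP.
  exists (s * d i); first by rewrite mulf_neq0 // gt_eqF.
  by rewrite x'E val_act_null.
apply/funext => i /=; apply/seteqP; split=> y.
  move=> [w' [a [b [a0 b0 ab E]]] <-].
  have sec : in_sector x i (a * d i) (b * d ('S i))
      ((a * d i) *: val (x i) + (b * d ('S i)) *: val (x ('S i))).
    split; rewrite ?mulr_ge0 ?(ltW (d0 _)) //.
    rewrite lt0r addr_ge0 ?mulr_ge0 ?(ltW (d0 _)) // andbT; apply/eqP => z.
    have p1 : 0 <= a * d i by rewrite mulr_ge0 // ltW.
    have p2 : 0 <= b * d ('S i) by rewrite mulr_ge0 // ltW.
    have /eqP : a * d i = 0 by lra.
    have /eqP : b * d ('S i) = 0 by lra.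
    rewrite !mulf_eq0 ![d _ == 0]gt_eqF // !orbF => /eqP b0' /eqP a0'.
    by move: ab; rewrite a0' b0' addr0 ltxx.
  have [F FE] := @null_vector_lift R unit _ (fun=> sector_null hx sec).
  exists (line (F tt)); first by exists (F tt) => //; exists (a * d i), (b * d ('S i)); rewrite FE.
  rewrite act_Ein_line //; apply/lineP; exists s => //.
  rewrite val_act_null // FE E !x'E mulmxDl -!scalemxAl scalerDr !scalerA.
  by congr (_ *: _ + _ *: _); ring.
move=> [_ [w [a [b [a0 b0 ab E]]] <-] <-].
have [w' w'E] := null_isometry w ih s0.
rewrite act_Ein_line //; exists w'; last first.
  by apply/lineP; exists s => //; rewrite (val_act_null w ih) w'E scalerA ss scale1r.
exists (a / d i), (b / d ('S i)).
have i0 j : 0 < (d j)^-1 by rewrite invr_gt0.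
split; rewrite ?mulr_ge0 ?(ltW (i0 _)) //.
  rewrite lt0r addr_ge0 ?mulr_ge0 ?(ltW (i0 _)) // andbT; apply/eqP => z.
  have p1 : 0 <= a / d i by rewrite mulr_ge0 // ltW.
  have p2 : 0 <= b / d ('S i) by rewrite mulr_ge0 // ltW.
  have /eqP : a / d i = 0 by lra.
  have /eqP : b / d ('S i) = 0 by lra.
  rewrite !mulf_eq0 ![_^-1 == 0]gt_eqF // !orbF => /eqP b0' /eqP a0'.
  by move: ab; rewrite a0' b0' addr0 ltxx.
rewrite w'E E !x'E mulmxDl -!scalemxAl scalerDr !scalerA.
by congr (_ *: _ + _ *: _); field; rewrite gt_eqF.
Qed.

Variables w1 w2 w3 : V.
Hypothesis wneg : negative_definite_frame w1 w2 w3.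

Lemma dVol_scale (u u' : V) (a b : R) : isotropic_pair u u' -> 0 < a -> 0 < b ->
  0 < dVol u u' w1 w2 w3 -> 0 < dVol (a *: u) (b *: u') w1 w2 w3.
Proof.
move=> iso a0 b0; have [e _ eP] := time_orientation wneg.
have aN : a != 0 by rewrite gt_eqF. have bN : b != 0 by rewrite gt_eqF.
move=> /(eP _ _ iso) p; apply/(eP _ _ (isotropic_pair_scale aN bN iso)).
rewrite (_ : _ * _ = a * b * (e * pdet u u')); first by rewrite mulr_gt0 // mulr_gt0.
by rewrite /pdet !mxE; ring.
Qed.

Lemma hex_polygon_SO0 (x x' : 'I_6 -> null_vector R) (k k' : 'I_6 -> R) (g : 'M[R]_5) :
  negative_hexagon (fun i => val (x i)) ->
  0 < dVol (val (x j0)) (val (x ('S j0))) w1 w2 w3 ->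
  0 < dVol (val (x' j0)) (val (x' ('S j0))) w1 w2 w3 ->
  isometry g -> (forall i, 0 < k i) -> (forall i, 0 < k' i) ->
  (forall i, k' i *: val (x' i) = (k i *: val (x i)) *m g) ->
  exists2 h, SO0 h & hex_polygon x' = translate_polygon h (hex_polygon x).
Proof.
move=> hx p p' ig k0 k'0 E.
have x'E i : val (x' i) = (k i / k' i) *: (val (x i) *m g).
  rewrite mulrC -scalerA scalemxAl -E scalerA mulVf ?scale1r // gt_eqF //.
have kk i : 0 < k i / k' i by rewrite divr_gt0.
have iso := hex_isotropic_pair hx j0.
have pg : 0 < dVol (val (x j0) *m g) (val (x ('S j0)) *m g) w1 w2 w3.
  have iso' := isotropic_pair_scale (lt0r_neq0 (kk j0)) (lt0r_neq0 (kk ('S j0)))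
    (isotropic_pair_isometry ig iso).
  rewrite -!x'E in iso'.
  have ki i : 0 < (k i / k' i)^-1 by rewrite invr_gt0.
  have := dVol_scale iso' (ki j0) (ki ('S j0)) p'.
  by rewrite !x'E !scalerA !mulVf ?gt_eqF // !scale1r.
have [h Sh hE] := SO0_up_to_sign wneg ig iso p pg.
exists h => //; case: hE => hE.
- apply: (hex_polygon_translate hx (SO0_isometry Sh) (mulr1 1) kk) => i.
  by rewrite x'E hE mul1r.
- apply: (@hex_polygon_translate _ _ _ (-1) _ hx (SO0_isometry Sh) _ kk) => [|i].
    by ring.
  by rewrite x'E hE mulN1r scaleNr scalerN opprK.
Qed.

End Moduli.

(** * The chart *)

Section Chart.
Context {R : realType}.
Notation V := 'rV[R]_5.

Definition row2 (a b : R) : 'rV[R]_2 := \row_(j < 2) if j == ord0 then a else b.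

Lemma row2E a b : (row2 a b 0 ord0 = a) * (row2 a b 0 ord_max = b).
Proof. by rewrite !mxE. Qed.

Lemma row2_eta (v : 'rV[R]_2) : row2 (v 0 ord0) (v 0 ord_max) = v.
Proof.
apply/rowP => -[[|[|//]] lt2]; rewrite mxE /=.
  by congr (v 0 _); apply: val_inj.
by congr (v 0 _); apply: val_inj.
Qed.

(** The exponential of arsinh q: it maps the line bijectively onto the positive numbers, with
    inverse (u - 1 / u) / 2, and serves to squeeze a plane into a half plane. *)
Definition escape (q : R) := q + Num.sqrt (q ^+ 2 + 1).

Lemma escapeP q : 0 < escape q /\ q = (escape q - (escape q)^-1) / 2.
Proof.
rewrite /escape; set r := Num.sqrt _.
have r2 : r ^+ 2 = q ^+ 2 + 1 by rewrite sqr_sqrtr // addr_ge0 ?sqr_ge0.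
have r0 : 0 <= r by exact: sqrtr_ge0.
have p : 0 < q + r.
  have [q0|q0] := leP 0 q.
    by rewrite ltr_wpDl // sqrtr_gt0; have := sqr_ge0 q; lra.
  rewrite -ltrBlDl sub0r -(ltr0_norm q0) -sqrtr_sqr /r ltr_sqrt; first by lra.
  by have := sqr_ge0 q; lra.
split => //; have pN : q + r != 0 by rewrite gt_eqF.
have -> : (q + r)^-1 = r - q.
  by apply: (mulfI pN); rewrite divff //; transitivity (r ^+ 2 - q ^+ 2); [rewrite r2|]; ring.
by field.
Qed.

Lemma escape_inj : injective escape.
Proof. by move=> q q' E; rewrite (escapeP q).2 E -(escapeP q').2. Qed.

(** Used for the squares of s and t, recovered from s ^ 2 - t ^ 2 and (s t) ^ 2. *)
Lemma sum_diff_eq (a b a' b' : R) : 0 <= a -> 0 <= b -> 0 <= a' -> 0 <= b' ->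
  a - b = a' - b' -> a * b = a' * b' -> a = a' /\ b = b'.
Proof.
move=> a0 b0 a0' b0' D P.
have : (a + b) ^+ 2 = (a' + b') ^+ 2.
  transitivity ((a - b) ^+ 2 + 4 * (a * b)); first by ring.
  by rewrite D P; ring.
move/eqP; rewrite eqrXn2 ?addr_ge0 // => /eqP S.
by split; lra.
Qed.

(** In the second branch the argument of [escape] is (x y - 1) - (z (x + y + 2) - 4), which is s ^ 2
    - t ^ 2, and x - y is s t. The sign in front of [escape] keeps this component apart from the
    first one, where x > 0. *)
Definition chart (x y z : R) : 'rV[R]_2 :=
  if x + y + z < x * y * z then row2 x y
  else row2 (- escape (x * y + 3 - z * (x + y + 2))) (x - y).

Definition moduli_triple (x y z : R) : Prop := [/\ 0 < x, 0 < y, 0 < z &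
  (x * y * z = x + y + z + 2 /\ 1 < x * y) \/
  [/\ x * y * z = x + y + z - 2, 1 <= x * y & x * y = 1 -> [/\ x = 1, y = 1 & 1 <= z]]].

Definition chart_domain : set 'rV[R]_2 :=
  [set v | [/\ 0 < v 0 ord0, 0 < v 0 ord_max & 1 < v 0 ord0 * v 0 ord_max] \/
           v 0 ord0 < 0].

Lemma second_type_identity (x y z : R) : x * y * z = x + y + z - 2 ->
  (x * y - 1) * (z * (x + y + 2) - 4) = (x - y) ^+ 2.
Proof.
move=> e; transitivity ((x * y * z - z) * (x + y + 2) - 4 * (x * y - 1)); first by ring.
by rewrite e; ring.
Qed.

(** These quantities play the roles of s ^ 2 and t ^ 2. As their product is a square, the second
    sign follows from the first unless [x * y = 1], where the bound on [z] gives it. *)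
Lemma second_type_ge0 (x y z : R) : moduli_triple x y z -> x * y * z = x + y + z - 2 ->
  0 <= x * y - 1 /\ 0 <= z * (x + y + 2) - 4.
Proof.
move=> [x0 y0 z0 [[e' _]|[_ xy1 xy]]] e; first by exfalso; lra.
split; first by rewrite subr_ge0.
have [xyE|xyN] := eqVneq (x * y) 1.
  by have [-> -> z1] := xy xyE; lra.
have xy0 : 0 < x * y - 1 by rewrite subr_gt0 lt_neqAle eq_sym xyN.
by rewrite -(pmulr_rge0 _ xy0) second_type_identity // sqr_ge0.
Qed.

Lemma chart_in_domain x y z : moduli_triple x y z -> chart_domain (chart x y z).
Proof.
move=> [x0 y0 z0 [[e xy]|[e xy1 xy]]]; rewrite /chart.
  have -> : x + y + z < x * y * z by lra.
  by left; rewrite !row2E.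
have -> : (x + y + z < x * y * z) = false by apply/negbTE; rewrite -leNgt; lra.
by right; rewrite row2E oppr_lt0; exact: (escapeP _).1.
Qed.

Lemma chart_inj x y z x' y' z' : moduli_triple x y z -> moduli_triple x' y' z' ->
  chart x y z = chart x' y' z' -> [/\ x = x', y = y' & z = z'].
Proof.
move=> m m' E.
have E0 := congr1 (fun v : 'rV_2 => v 0 ord0) E.
have E1 := congr1 (fun v : 'rV_2 => v 0 ord_max) E.
have [x0 y0 z0 [[e xy]|[e xy1 xy]]] := m; have [x0' y0' z0' [[e' xy']|[e' xy1' xy']]] := m';
  move: E0 E1; rewrite /chart.
- have -> : x + y + z < x * y * z by lra.
  have -> : x' + y' + z' < x' * y' * z' by lra.
  rewrite !row2E => Ex Ey; split => //; rewrite -{}Ex -{}Ey in e' xy' *.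
  have : (x * y - 1) * (z - z') = 0 by lra.
  by move/eqP; rewrite mulf_eq0 gt_eqF ?subr_gt0 //= subr_eq0 => /eqP.
- have -> : x + y + z < x * y * z by lra.
  have -> : (x' + y' + z' < x' * y' * z') = false by apply/negbTE; rewrite -leNgt; lra.
  by rewrite !row2E => Ex; have := (escapeP (x' * y' + 3 - z' * (x' + y' + 2))).1; lra.
- have -> : (x + y + z < x * y * z) = false by apply/negbTE; rewrite -leNgt; lra.
  have -> : x' + y' + z' < x' * y' * z' by lra.
  by rewrite !row2E => Ex; have := (escapeP (x * y + 3 - z * (x + y + 2))).1; lra.
have -> : (x + y + z < x * y * z) = false by apply/negbTE; rewrite -leNgt; lra.
have -> : (x' + y' + z' < x' * y' * z') = false by apply/negbTE; rewrite -leNgt; lra.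
rewrite !row2E => /oppr_inj/escape_inj Eq Ep.
have [S0 T0] := second_type_ge0 m e; have [S0' T0'] := second_type_ge0 m' e'.
have I := second_type_identity e; have I' := second_type_identity e'.
move: I I' S0 T0 S0' T0'; set S := x * y - 1; set T := z * (x + y + 2) - 4.
set S' := x' * y' - 1; set T' := z' * (x' + y' + 2) - 4 => I I' S0 T0 S0' T0'.
have [SE TE] : S = S' /\ T = T'.
  apply: sum_diff_eq => //; last by rewrite I I' Ep.
  by rewrite /S /T /S' /T'; lra.
have sumE : x + y = x' + y'.
  apply/eqP; rewrite -(eqrXn2 (isT : (0 < 2)%N)); [apply/eqP|lra..].
  transitivity ((x - y) ^+ 2 + 4 * (S + 1)); first by rewrite /S; ring.
  by rewrite Ep SE /S'; ring.
split; [lra|lra|].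
have : (z - z') * (x + y + 2) = 0.
  by move: TE; rewrite /T /T' -sumE => ?; lra.
have pos : 0 < x + y + 2 by lra.
by move/eqP; rewrite mulf_eq0 subr_eq0 (gt_eqF pos) orbF => /eqP.
Qed.

(* In the second type x y = s ^ 2 + 1 and x - y = s t, and two_w is x + y. *)
Definition two_w (s t : R) := Num.sqrt (4 + s ^+ 2 * (4 + t ^+ 2)).
Definition two_n s t := Num.sqrt (two_w s t + 2).
Definition two_x s t := (two_w s t + s * t) / 2.
Definition two_y s t := (two_w s t - s * t) / 2.
Definition two_z s t := (4 + t ^+ 2) / two_n s t ^+ 2.

Lemma two_params s t : [/\ 0 < two_n s t,
  two_n s t ^+ 2 = two_x s t + two_y s t + 2,
  s ^+ 2 = two_x s t * two_y s t - 1, s * t = two_x s t - two_y s t &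
  two_z s t * two_n s t ^+ 2 = 4 + t ^+ 2].
Proof.
have w0 : 0 <= two_w s t by exact: sqrtr_ge0.
have w2 : two_w s t ^+ 2 = 4 + s ^+ 2 * (4 + t ^+ 2).
  have p : 0 <= s ^+ 2 * (4 + t ^+ 2).
    by apply: mulr_ge0; first exact: sqr_ge0; have := sqr_ge0 t; lra.
  by rewrite sqr_sqrtr //; lra.
have n0 : 0 < two_n s t by rewrite sqrtr_gt0 ltr_wpDl.
have n2 : two_n s t ^+ 2 = two_w s t + 2 by rewrite sqr_sqrtr //; lra.
split => //.
- by rewrite n2 /two_x /two_y; field.
- transitivity ((two_w s t ^+ 2 - (s * t) ^+ 2) / 4 - 1); first by rewrite w2; field.
  by rewrite /two_x /two_y; field.
- by rewrite /two_x /two_y; field.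
- by rewrite /two_z divfK // expf_neq0 // gt_eqF.
Qed.

Lemma two_pos s t : [/\ 0 < two_x s t, 0 < two_y s t & 0 < two_z s t].
Proof.
have [n0 n2 s2 st zn] := two_params s t.
have w0 : 0 <= two_w s t by exact: sqrtr_ge0.
have s2' := sqr_ge0 s; have t2' := sqr_ge0 t.
have xy : 0 < two_x s t * two_y s t by lra.
have sum : two_x s t + two_y s t = two_w s t by rewrite /two_x /two_y; field.
have x0 : 0 < two_x s t.
  rewrite ltNge; apply/negP => x0.
  have y0 : two_y s t < 0.
    rewrite ltNge; apply/negP => y0; have : two_x s t * two_y s t <= 0 by rewrite mulr_le0_ge0.
    by lra.
  by lra.
split => //; first by rewrite pmulr_rgt0 in xy.
by rewrite /two_z divr_gt0 ?exprn_gt0 // ltr_wpDr.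
Qed.

Lemma two_triple s t : 0 <= s -> moduli_triple (two_x s t) (two_y s t) (two_z s t) /\
  chart (two_x s t) (two_y s t) (two_z s t) = row2 (- escape (s ^+ 2 - t ^+ 2)) (s * t).
Proof.
move=> s0; have [n0 n2 s2 st zn] := two_params s t; have [x0 y0 z0] := two_pos s t.
have e : two_x s t * two_y s t * two_z s t = two_x s t + two_y s t + two_z s t - 2.
  apply: (clear_n2 n0).
  transitivity ((two_x s t * two_y s t - 1) * (two_z s t * two_n s t ^+ 2)
    + two_z s t * two_n s t ^+ 2); first by ring.
  rewrite -s2 zn.
  transitivity ((two_x s t + two_y s t - 2) * two_n s t ^+ 2 + two_z s t * two_n s t ^+ 2); last by ring.
  rewrite zn n2; congr (_ + _).
  transitivity (4 * s ^+ 2 + (s * t) ^+ 2); first by ring.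
  by rewrite st s2; ring.
split.
  split => //; right; split => //; first by rewrite -subr_ge0 -s2 sqr_ge0.
  move=> xy; have sz : s = 0.
    by apply/eqP; rewrite -sqrf_eq0 s2 xy subrr.
  have xy' : two_x s t = two_y s t by move: st; rewrite sz mul0r => ?; lra.
  have x1 : two_x s t = 1.
    move: xy; rewrite -xy' => /eqP; rewrite -expr2 sqrf_eq1 => /orP[/eqP//|/eqP xN].
    by move: x0; rewrite xN => ?; lra.
  have y1 : two_y s t = 1 by rewrite -xy'.
  split => //; move: zn; rewrite n2 x1 y1 => zn.
  by have := sqr_ge0 t; lra.
rewrite /chart (_ : _ < _ = false); last by apply/negbTE; rewrite -leNgt; lra.
rewrite -n2 zn -st; congr (row2 (- escape _) _).
have -> : two_x s t * two_y s t = s ^+ 2 + 1 by rewrite s2; ring.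
by ring.
Qed.

Definition one_s (x y : R) := Num.sqrt (x * y - 1).
Definition one_n (x y : R) := Num.sqrt (x + y + 2).
Definition one_z (x y : R) := (x + y + 2) / (x * y - 1).

Lemma one_params x y : 0 < x -> 0 < y -> 1 < x * y ->
  [/\ 0 < one_n x y, one_n x y ^+ 2 = x + y + 2, 0 < one_s x y,
      one_s x y ^+ 2 = x * y - 1 & one_z x y * one_s x y ^+ 2 = one_n x y ^+ 2].
Proof.
move=> x0 y0 xy; have xy' : 0 < x * y - 1 by rewrite subr_gt0.
have n0 : 0 < x + y + 2 by lra.
have n2 : one_n x y ^+ 2 = x + y + 2 by rewrite sqr_sqrtr // ltW.
have s2 : one_s x y ^+ 2 = x * y - 1 by rewrite sqr_sqrtr // ltW.
split; rewrite ?sqrtr_gt0 //.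
by rewrite n2 s2 /one_z divfK // gt_eqF.
Qed.

Lemma one_triple x y : 0 < x -> 0 < y -> 1 < x * y ->
  moduli_triple x y (one_z x y) /\ chart x y (one_z x y) = row2 x y.
Proof.
move=> x0 y0 xy; have xy' : 0 < x * y - 1 by rewrite subr_gt0.
have z0 : 0 < one_z x y by rewrite divr_gt0 //; lra.
have e : x * y * one_z x y = x + y + one_z x y + 2.
  have : (x * y - 1) * one_z x y = x + y + 2 by rewrite mulrC divfK // gt_eqF.
  by move=> ?; lra.
split; first by split => //; left.
by rewrite /chart ifT //; lra.
Qed.

(** Both systems are isometric images of one normal form depending on x, y, z only, taken here with
    sign [e = 1]. *)
Lemma gram_isometric x y z (p q r m1 m2 m3 p' q' r' m1' m2' m3' : V) :
  moduli_triple x y z -> gram x y z p q r m1 m2 m3 -> gram x y z p' q' r' m1' m2' m3' ->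
  exists2 g, isometry g &
    forall i, six p' q' r' m1' m2' m3' i = six p q r m1 m2 m3 i *m g.
Proof.
move=> mt G G'; have [x0 y0 z0 cls] := mt.
pose n := Num.sqrt (x + y + 2); pose s := Num.sqrt (x * y - 1).
have n0 : 0 < n by rewrite sqrtr_gt0; lra.
have n2 : n ^+ 2 = x + y + 2 by rewrite sqr_sqrtr //; lra.
have xy1 : 1 <= x * y by case: cls => [[_ /ltW]|[]].
have s2 : s ^+ 2 = x * y - 1 by rewrite sqr_sqrtr // subr_ge0.
have e1 : 1 * 1 = 1 :> R by rewrite mulr1.
suff [P [Q [A [M1 [M2 [M3 H]]]]]] : exists P Q A M1 M2 M3 : V,
    forall p q r m1 m2 m3, gram x y z p q r m1 m2 m3 -> exists g, isometry g /\
    [/\ p = P *m g, q = Q *m g, r = A *m g &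
      [/\ m1 = M1 *m g, m2 = M2 *m g & m3 = M3 *m g]].
  have [g [ig [-> -> -> [-> -> ->]]]] := H _ _ _ _ _ _ G.
  have [g' [ig' [-> -> -> [-> -> ->]]]] := H _ _ _ _ _ _ G'.
  exists (invmx g *m g'); first by apply: isometryM => //; exact: isometryV.
  have K (w : V) : w *m g *m (invmx g *m g') = w *m g'.
    by rewrite mulmxA mulmxK // isometry_unit.
  by apply: ord6_ind; rewrite /six /= ?mulmxDl ?mulNmx !K.
case: cls => [[e xy]|[e _ xy]].
  have s0 : 0 < s by rewrite sqrtr_gt0 subr_gt0.
  have zs : z * s ^+ 2 = n ^+ 2 by rewrite s2 n2; lra.
  exists (one_p x s n), (one_q y s n), (one_r x y s n), (one_m1 1 x s n),
    (one_m2 1 y s n), (one_m3 1 s n) => p0 q0 r0 m10 m20 m30 G0.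
  exact: (gram_normal_one e1 G0 n0 n2 s2 s0 zs).
have [S0 T0] := second_type_ge0 mt e; have I := second_type_identity e.
have [t [st zn]] : exists t, s * t = x - y /\ z * n ^+ 2 = 4 + t ^+ 2.
  (* For s = 0 the relation s t = x - y says nothing about t; either root of t ^ 2 = z n ^ 2 - 4
     would do. *)
  have [sz|sN] := eqVneq s 0.
    exists (Num.sqrt (z * (x + y + 2) - 4)); split; last by rewrite n2 sqr_sqrtr //; ring.
    have xy' : x * y = 1 by move: s2; rewrite sz expr0n /= => ?; lra.
    by have [-> -> _] := xy xy'; rewrite sz mul0r subrr.
  exists ((x - y) / s); split; first by rewrite mulrC divfK.
  rewrite expr_div_n n2; apply: (mulIf (_ : s ^+ 2 != 0)); first by rewrite expf_neq0.
  rewrite mulrDl divfK ?expf_neq0 // -I s2; ring.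
exists (two_p x s n), (two_q y s n), (two_r t n), (two_m1 1 x s n),
  (two_m2 1 y s n), (two_m3 1 z n) => p0 q0 r0 m10 m20 m30 G0.
exact: (gram_normal_two e1 G0 n0 n2 s2 st zn).
Qed.

End Chart.

Section PointwiseTopology.

Lemma continuous_into_ptws (X : topologicalType) (I : Type) (Y : topologicalType)
    (f : X -> {ptws I -> Y}) : (forall i, continuous (fun x => f x i)) -> continuous f.
Proof.
move=> cf x; apply/cvg_sup => i; apply/cvg_image.
  by rewrite eqEsubset; split => y //= _; exists (fun=> y).
move=> A nA; exists ((fun g : I -> Y => g i) @^-1` A); first exact: cf i x _ nA.
by rewrite image_preimage //; apply/seteqP; split => y // _; exists (fun=> y).
Qed.

End PointwiseTopology.

(** * The chart on the moduli space *)

Section ModuliChart.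
Context {R : realType}.
Notation V := 'rV[R]_5.
Notation "''S' i" := (@ordS 6 i) (at level 8, i at level 2).

Lemma cont_row2 (X : topologicalType) (f g : X -> R) (x : X) :
  {for x, continuous f} -> {for x, continuous g} ->
  {for x, continuous (fun y => row2 (f y) (g y))}.
Proof.
move=> cf cg; apply: cont_mx => i j.
by case E : (j == ord0); [apply: continuous_near_eq cf _|apply: continuous_near_eq cg _];
  apply: nearW => y; rewrite mxE E.
Qed.

(** On the two components x y z - (x + y + z) is 2 or -2, so the branch of [chart] is constant near
    [x]. *)
Lemma chart_continuous (X : topologicalType) (a b c : X -> R) (x : X) :
  moduli_triple (a x) (b x) (c x) ->
  {for x, continuous a} -> {for x, continuous b} -> {for x, continuous c} ->
  {for x, continuous (fun y => chart (a y) (b y) (c y))}.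
Proof.
move=> [_ _ _ cls] ca cb cc; pose f y := a y * b y * c y - (a y + b y + c y).
have cf : {for x, continuous f} by rewrite /f; cont.
case: cls => [[e _]|[e _ _]].
  apply: (continuous_near_eq (F1 := fun y => row2 (a y) (b y))); first exact: cont_row2.
  have : \forall y \near x, 0 < f y by apply: cvgr_gt (cf : f y @[y --> x] --> f x) _ _; rewrite /f; lra.
  by apply: filterS => y fy; rewrite /chart ifT //; move: fy; rewrite /f subr_gt0.
apply: (continuous_near_eq (F1 := fun y =>
  row2 (- escape (a y * b y + 3 - c y * (a y + b y + 2))) (a y - b y))).
  by apply: cont_row2; rewrite /escape; cont.
have : \forall y \near x, f y < 0 by apply: cvgr_lt (cf : f y @[y --> x] --> f x) _ _; rewrite /f; lra.
apply: filterS => y fy; rewrite /chart ifF //; apply/negbTE; rewrite -leNgt ltW //.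
by move: fy; rewrite /f subr_lt0.
Qed.

Lemma hexagon_moduli_triple (v : 'I_6 -> V) : negative_hexagon v ->
  moduli_triple (inv_x v) (inv_y v) (inv_z v).
Proof.
move=> hv; have [k [p [q [r [m1 [m2 [m3 [_ _ [x0 y0 z0] G]]]]]]]] := hexagon_gram hv.
by split => //; exact: gram_classification G.
Qed.

Definition hexagon_chart (v : 'I_6 -> V) := chart (inv_x v) (inv_y v) (inv_z v).

Lemma hexagon_chart_scale (v v' : 'I_6 -> V) (k : 'I_6 -> R) (h : 'M[R]_5) :
  negative_hexagon v -> isometry h -> (forall i, k i != 0) ->
  (forall i, v' i = k i *: (v i *m h)) -> hexagon_chart v' = hexagon_chart v.
Proof.
move=> hv ih k0 v'E; rewrite /hexagon_chart.
by have [-> -> ->] := inv_scale (hexagon_nonadj hv) ih k0 v'E.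
Qed.

Lemma hexagon_chart_continuous (X : topologicalType) (v : X -> 'I_6 -> V) (x : X) :
  negative_hexagon (v x) -> (forall i, {for x, continuous (v^~ i)}) ->
  {for x, continuous (fun y => hexagon_chart (v y))}.
Proof.
move=> hv cv; apply: chart_continuous; first exact: hexagon_moduli_triple.
all: by apply: inv6_continuous => //; exact: hexagon_nonadj.
Qed.

Lemma hexagon_chart_isometric (v v' : 'I_6 -> V) :
  negative_hexagon v -> negative_hexagon v' -> hexagon_chart v = hexagon_chart v' ->
  exists g k k', [/\ isometry g, forall i, 0 < k i, forall i, 0 < k' i &
    forall i, k' i *: v' i = (k i *: v i) *m g].
Proof.
move=> hv hv' E; have mt := hexagon_moduli_triple hv.
have [ex ey ez] := chart_inj mt (hexagon_moduli_triple hv') E.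
have [k [p [q [r [m1 [m2 [m3 [k0 kE _ G]]]]]]]] := hexagon_gram hv.
have [k' [p' [q' [r' [m1' [m2' [m3' [k'0 k'E _ G']]]]]]]] := hexagon_gram hv'.
rewrite -ex -ey -ez in G'.
have [g ig gE] := gram_isometric mt G G'.
by exists g, k, k'; split => // i; rewrite -kE -k'E gE.
Qed.

Variables w1 w2 w3 : V.
Hypothesis wneg : negative_definite_frame w1 w2 w3.
Local Notation Lifted := (lifted_space w1 w2 w3 6).

Definition lifted_vectors (L : Lifted) (i : 'I_6) : V := unit_rep (vertex_ray (val L) i).

Lemma lifted_vectors_continuous i : continuous (lifted_vectors^~ i).
Proof.
have c : continuous (@lifted_vertices R w1 w2 w3 6 : Lifted -> _) by exact: initial_continuous.
move=> L; apply: (@continuous_comp _ _ _ (fun L : Lifted => vertex_ray (val L) i) unit_rep).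
  apply: (@continuous_comp _ _ _ (@lifted_vertices R w1 w2 w3 6 : Lifted -> _)
    (@proj 'I_6 (fun=> EinHat R) i)); first exact: c.
  exact: proj_continuous.
exact: unit_rep_continuous.
Qed.

Lemma lifted_vectors_hexagon (L : Lifted) : exists x : 'I_6 -> null_vector R,
  [/\ negative_hexagon (fun i => val (x i)), polygon (val L) = hex_polygon x,
      hexagon_chart (lifted_vectors L) = hexagon_chart (fun i => val (x i)) &
      0 < dVol (val (x j0)) (val (x ('S j0))) w1 w2 w3] /\
  negative_hexagon (lifted_vectors L).
Proof.
have [x [hx pE rE d]] := lifted_polygon_hexagon (set_mem (valP L)).
have vE i : lifted_vectors L i = (tnorm (val (x i)))^-1 *: val (x i).
  by rewrite /lifted_vectors rE unit_rep_ray.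
have t0 i : 0 < (tnorm (val (x i)))^-1 by rewrite invr_gt0 tnorm_gt0 //; exact: null_valP.
exists x; split.
  split => //; apply: (@hexagon_chart_scale _ _ (fun i => (tnorm (val (x i)))^-1) 1%:M) => //.
  - exact: isometry1.
  - by move=> i; rewrite gt_eqF.
  - by move=> i; rewrite mulmx1 vE.
move=> i j; have := hx i j; rewrite !vE ipZl ipZr.
case: ifP => _; first by move=> ->; rewrite !mulr0.
by move=> lt0; rewrite !pmulr_rlt0.
Qed.

(** The chart is a complete invariant: equal charts give an isometry between rescaled vertices,
    which future-directedness puts in [SO0] up to sign. *)
Lemma tlp_relP (L M : Lifted) :
  tlp_rel L M <-> hexagon_chart (lifted_vectors L) = hexagon_chart (lifted_vectors M).
Proof.
have [x [[hx pL -> dx] _]] := lifted_vectors_hexagon L.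
have [y [[hy pM -> dy] _]] := lifted_vectors_hexagon M.
split=> [/asboolP[g Sg]|E].
  rewrite pL pM => E; have ig := SO0_isometry Sg; symmetry.
  have /choice[c cE] i : exists c, c != 0 /\ val (y i) = c *: (val (x i) *m g).
    have := congr1 (fun P => vertex P i) E; rewrite /= act_Ein_line // => /esym/lineP[c c0].
    by rewrite val_act_null // => yE; exists c.
  by apply: (hexagon_chart_scale hx ig (fun i => (cE i).1)) => i; exact: (cE i).2.
apply/asboolP; rewrite pL pM.
have [g [k [k' [ig k0 k'0 kE]]]] := hexagon_chart_isometric hx hy E.
exact: (hex_polygon_SO0 wneg hx dx dy ig k0 k'0 kE).
Qed.

Lemma lifted_chart_domain (L : Lifted) :
  hexagon_chart (lifted_vectors L) \in chart_domain.
Proof.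
have [x [_ hL]] := lifted_vectors_hexagon L.
exact: mem_set (chart_in_domain (hexagon_moduli_triple hL)).
Qed.

Definition lifted_chart (L : Lifted) : set_type (@chart_domain R) :=
  SigSub (lifted_chart_domain L).

Lemma lifted_chart_continuous : continuous lifted_chart.
Proof.
apply: continuous_into_set_type; apply: continuous_pointwise => L /=.
apply: hexagon_chart_continuous; first by have [x []] := lifted_vectors_hexagon L.
by move=> i; exact: lifted_vectors_continuous.
Qed.

Local Notation Quot := {eq_quot @tlp_equiv R w1 w2 w3 6}.

Definition tlp_chart (T : TLP w1 w2 w3 6) : set_type (@chart_domain R) :=
  lifted_chart (repr (T : Quot)).

Lemma tlp_chart_pi (L : Lifted) : tlp_chart (\pi_Quot L) = lifted_chart L.
Proof.
apply: val_inj; apply/tlp_relP; apply/(@eqmodP _ (@tlp_equiv R w1 w2 w3 6)).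
exact: reprK.
Qed.

Lemma tlp_chart_continuous : continuous tlp_chart.
Proof.
apply/quotient_continuous; rewrite (_ : _ \o _ = lifted_chart).
  exact: lifted_chart_continuous.
by apply/funext => L /=; exact: tlp_chart_pi.
Qed.

Lemma tlp_chart_inj : injective tlp_chart.
Proof.
move=> S T E; rewrite -(reprK (S : Quot)) -(reprK (T : Quot)).
apply/(@eqmodP _ (@tlp_equiv R w1 w2 w3 6)); apply/tlp_relP.
by have := congr1 val E.
Qed.

End ModuliChart.

(** * The model *)

Section Model.
Context {R : realType}.
Notation V := 'rV[R]_5.

Lemma cont_six (X : topologicalType) (p q r m1 m2 m3 : X -> V) (x : X) i :
  {for x, continuous p} -> {for x, continuous q} -> {for x, continuous r} ->
  {for x, continuous m1} -> {for x, continuous m2} -> {for x, continuous m3} ->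
  {for x, continuous (fun y => six (p y) (q y) (r y) (m1 y) (m2 y) (m3 y) i)}.
Proof.
move=> cp cq cr c1 c2 c3.
have sub (f g : X -> V) : {for x, continuous f} -> {for x, continuous g} ->
    {for x, continuous (fun y => f y - g y)}.
  move=> cf cg.
  have cN : {for x, continuous (fun y => -1 *: g y)} by apply: cont_scale; [exact: cont_cst|exact: cg].
  have -> : (fun y => f y - g y) = (fun y => f y + -1 *: g y).
    by apply/funext => y; rewrite scaleN1r.
  exact: cont_add_row cf cN.
move: i; apply: ord6_ind; rewrite /six /=.
- exact: cont_add_row cp c1.
- exact: sub cq c2.
- exact: cont_add_row cr c3.
- exact: sub cp c1.
- exact: cont_add_row cq c2.
- exact: sub cr c3.
Qed.

Definition two_six (e s t : R) : 'I_6 -> V :=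
  let x := two_x s t in let y := two_y s t in let n := two_n s t in
  six (two_p x s n) (two_q y s n) (two_r t n)
    (two_m1 e x s n) (two_m2 e y s n) (two_m3 e (two_z s t) n).

Definition one_six (e x y : R) : 'I_6 -> V :=
  let s := one_s x y in let n := one_n x y in
  six (one_p x s n) (one_q y s n) (one_r x y s n)
    (one_m1 e x s n) (one_m2 e y s n) (one_m3 e s n).

Lemma two_six_gram e s t : e * e = 1 -> exists p q r m1 m2 m3,
  two_six e s t = six p q r m1 m2 m3 /\
  gram (two_x s t) (two_y s t) (two_z s t) p q r m1 m2 m3.
Proof.
move=> e1; have [n0 n2 s2 st zn] := two_params s t.
by do 6 eexists; split; [reflexivity|exact: two_gram].
Qed.

Lemma one_six_gram e x y : e * e = 1 -> 0 < x -> 0 < y -> 1 < x * y ->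
  exists p q r m1 m2 m3, one_six e x y = six p q r m1 m2 m3 /\
  gram x y (one_z x y) p q r m1 m2 m3.
Proof.
move=> e1 x0 y0 xy; have [n0 n2 s0 s2 zs] := one_params x0 y0 xy.
by do 6 eexists; split; [reflexivity|exact: one_gram].
Qed.

Section NormalFormContinuity.
Variables (X : topologicalType) (a b c s t n : X -> R) (o : X) (e : R).
Hypotheses (ca : {for o, continuous a}) (cb : {for o, continuous b})
  (cc : {for o, continuous c}) (cs : {for o, continuous s})
  (ct : {for o, continuous t}) (cn : {for o, continuous n}) (n0 : 0 < n o).

Let cVn : {for o, continuous (fun y => (n y)^-1)}.
Proof. by apply: contV => //; rewrite gt_eqF. Qed.

Lemma two_form_continuous i : {for o, continuous (fun y =>
  six (two_p (a y) (s y) (n y)) (two_q (b y) (s y) (n y)) (two_r (t y) (n y))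
    (two_m1 e (a y) (s y) (n y)) (two_m2 e (b y) (s y) (n y)) (two_m3 e (c y) (n y)) i)}.
Proof.
have cV' : {for o, continuous (fun y => (n y + 2)^-1)}.
  by apply: contV; [rewrite gt_eqF // addr_gt0|cont].
by apply: cont_six; apply: cont_vec5; rewrite /nX /nY /nAp /nAm /nBp /nBm; cont.
Qed.

Lemma one_form_continuous i : 0 < s o -> {for o, continuous (fun y =>
  six (one_p (a y) (s y) (n y)) (one_q (b y) (s y) (n y)) (one_r (a y) (b y) (s y) (n y))
    (one_m1 e (a y) (s y) (n y)) (one_m2 e (b y) (s y) (n y)) (one_m3 e (s y) (n y)) i)}.
Proof.
move=> s0; have cVs : {for o, continuous (fun y => (s y)^-1)}.
  by apply: contV => //; rewrite gt_eqF.
have cV : {for o, continuous (fun y => (n y * s y)^-1)}.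
  by apply: contV; [rewrite mulf_neq0 // gt_eqF|cont].
by apply: cont_six; apply: cont_vec5; rewrite /nX /nY; cont.
Qed.

End NormalFormContinuity.

Section SixContinuity.
Variables (X : topologicalType) (f g : X -> R) (o : X) (e : R).
Hypotheses (cf : {for o, continuous f}) (cg : {for o, continuous g}).

Lemma two_six_continuous i : {for o, continuous (fun y => two_six e (f y) (g y) i)}.
Proof.
have n0 : 0 < two_n (f o) (g o) by have [] := two_params (f o) (g o).
have cw : {for o, continuous (fun y => two_w (f y) (g y))} by rewrite /two_w; cont.
have cn : {for o, continuous (fun y => two_n (f y) (g y))}.
  by rewrite /two_n; apply: cont_sqrt; apply: contD; [exact: cw|exact: cont_cst].
have cfg : {for o, continuous (fun y => f y * g y)} by exact: contM.
apply: (two_form_continuous _ _ _ cf cg cn n0).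
- apply: contM; last exact: cont_cst.
  by apply: contD; [exact: cw|exact: cfg].
- apply: contM; last exact: cont_cst.
  by apply: contD; [exact: cw|exact: contN].
- apply: contM; first by cont.
  by apply: contV; [rewrite expf_neq0 // gt_eqF|exact: contX].
Qed.

Lemma one_six_continuous i : 0 < f o -> 0 < g o -> 1 < f o * g o ->
  {for o, continuous (fun y => one_six e (f y) (g y) i)}.
Proof.
move=> f0 g0 fg; have [n0 _ s0 _ _] := one_params f0 g0 fg.
have cn : {for o, continuous (fun y => one_n (f y) (g y))} by rewrite /one_n; cont.
have cs : {for o, continuous (fun y => one_s (f y) (g y))} by rewrite /one_s; cont.
exact: one_form_continuous.
Qed.

End SixContinuity.

Section Future.
Variables (w1 w2 w3 : V) (e : R).
Hypothesis e1 : e = 1 \/ e = -1.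
Hypothesis eP : forall u u', isotropic_pair u u' ->
  0 < dVol u u' w1 w2 w3 <-> 0 < e * pdet u u'.

Let ee : e * e = 1. Proof. by case: e1 => ->; ring. Qed.

Lemma two_six_future s t (x : 'I_6 -> null_vector R) :
  (forall i, val (x i) = two_six e s t i) -> future_negative_lifted w1 w2 w3 (hex_lifted x).
Proof.
move=> xE; have [n0 n2 s2 st zn] := two_params s t; have [x0 y0 z0] := two_pos s t.
have X0 : 0 < nX (two_x s t) (two_n s t) by apply: divr_gt0; [lra|exact: n0].
have Y0 : 0 < nY (two_y s t) (two_n s t) by apply: divr_gt0; [lra|exact: n0].
have A0 : 0 < nAp s (two_n s t) by rewrite /nAp; have := sqr_ge0 (s / two_n s t); lra.
have B0 : nBp (two_z s t) (two_n s t) < 0.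
  have n2' : 0 < two_n s t + 2 by exact: addr_gt0.
  have a : 0 < two_z s t * two_n s t / (two_n s t + 2) by apply: divr_gt0 => //; exact: mulr_gt0.
  have b : 0 < (two_n s t + 2) / two_n s t by rewrite divr_gt0.
  by rewrite /nBp; lra.
apply: (six_future e1 X0 Y0 A0 B0 _ _ _ _ xE _ eP); rewrite ?vec5E //.
  by move=> w; rewrite !inE => /or3P[] /eqP->; rewrite !vec5E.
exact: gram_hexagon x0 y0 z0 (two_gram ee n0 n2 s2 st zn).
Qed.

Lemma one_six_future a b (x : 'I_6 -> null_vector R) : 0 < a -> 0 < b -> 1 < a * b ->
  (forall i, val (x i) = one_six e a b i) -> future_negative_lifted w1 w2 w3 (hex_lifted x).
Proof.
move=> a0 b0 ab xE; have [n0 n2 s0 s2 zs] := one_params a0 b0 ab.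
have z0 : 0 < one_z a b by have [[]] := one_triple a0 b0 ab.
have X0 : 0 < nX a (one_n a b) by apply: divr_gt0; [lra|exact: n0].
have Y0 : 0 < nY b (one_n a b) by apply: divr_gt0; [lra|exact: n0].
have A0 : 0 < one_s a b / one_n a b by rewrite divr_gt0.
have B0 : - (one_n a b / one_s a b) < 0 by rewrite oppr_lt0 divr_gt0.
apply: (six_future e1 X0 Y0 A0 B0 _ _ _ _ xE _ eP); rewrite ?vec5E //.
  by move=> w; rewrite !inE => /or3P[] /eqP->; rewrite !vec5E.
exact: gram_hexagon a0 b0 z0 (one_gram ee n0 n2 s0 s2 zs).
Qed.

End Future.

End Model.

(** * Hexagons over the half plane *)

Section ModelHexagons.
Context {R : realType}.
Notation V := 'rV[R]_5.
Local Notation H := (set_type (@half_plane_minus_hyperbola R)).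

(* The parameter t of the second normal form, rescaled so that the range
   s * t < 2 of the model corresponds to all values of the parameter. *)
Definition second_parameter (s t : R) : R := t / (1 - Num.max 0 (s * t / 2)).

Lemma second_parameterK (s t : R) : s * t < 2 ->
  t = second_parameter s t / (1 + Num.max 0 (s * second_parameter s t / 2)).
Proof.
move=> st; rewrite /second_parameter; have [p|p] := leP 0 (s * t / 2).
  have d : 0 < 1 - s * t / 2 by lra.
  rewrite (max_idPr (_ : 0 <= s * (t / (1 - s * t / 2)) / 2)).
    by field; rewrite ?pnatr_eq0 ?andbT /=; do ?[apply/andP; split]; apply/eqP => z; lra.
  by rewrite mulrA -(mulrAC (s * t)) divr_ge0 // ltW.
by rewrite subr0 divr1 (max_idPl (ltW p)) addr0 divr1.
Qed.

Lemma second_parameter_scaled (s t : R) :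
  second_parameter s (t / (1 + Num.max 0 (s * t / 2))) = t.
Proof.
rewrite /second_parameter; have [p|p] := leP 0 (s * t / 2).
  have d : 0 < 1 + s * t / 2 by lra.
  rewrite (max_idPr (_ : 0 <= s * (t / (1 + s * t / 2)) / 2)).
    by field; rewrite ?pnatr_eq0 ?andbT /=; do ?[apply/andP; split]; apply/eqP => z; lra.
  by rewrite mulrA -(mulrAC (s * t)) divr_ge0 // ltW.
by rewrite addr0 divr1 (max_idPl (ltW p)) subr0 divr1.
Qed.

(** Beyond the hyperbola the point stands for the first normal form with x = s and y = t / 2, for
    which s t > 2 is the condition x y > 1. *)
Definition model_six (e s t : R) : 'I_6 -> V :=
  if s * t < 2 then two_six e s (second_parameter s t) else one_six e s (t / 2).

Definition model_chart (s t : R) : 'rV[R]_2 :=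
  if s * t < 2 then let u := second_parameter s t in row2 (- escape (s ^+ 2 - u ^+ 2)) (s * u)
  else row2 s (t / 2).

Lemma half_plane_first_type (s t : R) : 0 <= s -> s * t != 2 -> (s * t < 2) = false ->
  [/\ 0 < s, 0 < t / 2 & 1 < s * (t / 2)].
Proof.
move=> s0 stN st; have st2 : 2 < s * t.
  by rewrite lt_neqAle eq_sym stN leNgt st.
have s0' : 0 < s.
  by rewrite lt0r s0 andbT; apply/eqP => z; move: st2; rewrite z mul0r => ?; lra.
have st0 : 0 < s * t by lra.
have t0 : 0 < t by rewrite pmulr_rgt0 in st0.
by split; lra.
Qed.

Lemma model_six_chart e s t : e * e = 1 -> 0 <= s -> s * t != 2 ->
  negative_hexagon (model_six e s t) /\ hexagon_chart (model_six e s t) = model_chart s t.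
Proof.
move=> ee s0 stN; rewrite /model_six /model_chart /hexagon_chart.
case: ifP => [st|/half_plane_first_type-/(_ s0 stN)[a0 b0 ab]].
  set u := second_parameter s t.
  have [p [q [r [m1 [m2 [m3 [-> G]]]]]]] := two_six_gram s u ee.
  have [x0 y0 z0] := two_pos s u.
  have [-> -> ->] := inv_six x0 y0 z0 G; have [_ ->] := two_triple u s0.
  by split => //; exact: gram_hexagon G.
have [p [q [r [m1 [m2 [m3 [-> G]]]]]]] := one_six_gram ee a0 b0 ab.
have [[_ _ z0 _] E] := one_triple a0 b0 ab.
have [-> -> ->] := inv_six a0 b0 z0 G.
by split => //; exact: gram_hexagon G.
Qed.

Lemma half_planeP (h : H) : 0 <= (val h).1 /\ (val h).1 * (val h).2 != 2.
Proof. exact: set_mem (valP h). Qed.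

Lemma cont_half_plane (h : H) : {for h, continuous (fun h : H => (val h).1)} /\
  {for h, continuous (fun h : H => (val h).2)}.
Proof.
have cv : {for h, continuous (val : H -> R * R)} by exact: val_continuous.
by split; [apply: cont_fst|apply: cont_snd].
Qed.

Lemma model_six_continuous e i (h : H) :
  {for h, continuous (fun h : H => model_six e (val h).1 (val h).2 i)}.
Proof.
have [c1 c2] := cont_half_plane h; have [s0 stN] := half_planeP h.
have cp : {for h, continuous (fun h : H => (val h).1 * (val h).2)} by exact: contM.
have cp' : (fun h : H => (val h).1 * (val h).2) y @[y --> h] --> (val h).1 * (val h).2 by exact: cp.
case: (boolP ((val h).1 * (val h).2 < 2)) => [lt2|/negbTE nlt2].
  apply: (continuous_near_eq (F1 := fun h : H =>
    two_six e (val h).1 (second_parameter (val h).1 (val h).2) i)).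
    apply: two_six_continuous => //; apply: contM => //; apply: contV.
      rewrite gt_eqF // subr_gt0 gt_max ltr01 /=; lra.
    apply: contD; first exact: cont_cst.
    apply: contN; apply: cont_max; first exact: cont_cst.
    by apply: contM; [exact: cp|exact: cont_cst].
  have : \forall y \near h, (val y).1 * (val y).2 < 2 by apply: cvgr_lt cp' _ _.
  by apply: filterS => y lt; rewrite /model_six lt.
have [a0 b0 ab] := half_plane_first_type s0 stN nlt2.
apply: (continuous_near_eq (F1 := fun h : H => one_six e (val h).1 ((val h).2 / 2) i)).
  by apply: one_six_continuous => //; apply: contM => //; exact: cont_cst.
have : \forall y \near h, 2 < (val y).1 * (val y).2 by apply: cvgr_gt cp' _ _; lra.
by apply: filterS => y gt; rewrite /model_six ltNge (ltW gt).
Qed.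

Lemma negative_hexagon_null (v : 'I_6 -> V) i : negative_hexagon v -> null_vectors (v i).
Proof.
move=> hv; split; last by have := hv i i; move: i; apply: ord6_ind.
apply/eqP => z; have no j : ~~ cyc_adj i j -> False.
  by move=> nij; have := hv i j; rewrite (negbTE nij) z ip0l ltxx.
by move: i z no; apply: ord6_ind => _ no;
  first [exact: (no j0 isT)|exact: (no j1 isT)|exact: (no j2 isT)|exact: (no j3 isT)].
Qed.

(** Below the hyperbola the chart determines s and, if s != 0, also t through the product of s and
    the parameter. If s = 0, only t ^ 2 remains, and this ambiguity is the folding. *)
Lemma fold_model_chart (h h' : H) :
  fold_rel h h' = (model_chart (val h).1 (val h).2 == model_chart (val h').1 (val h').2).
Proof.
have [s0 stN] := half_planeP h; have [s0' stN'] := half_planeP h'; rewrite /fold_rel.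
move: (val h) s0 stN (val h') s0' stN' => [s t] s0 stN [s' t'] s0' stN'; simpl in *.
apply/idP/idP => [/orP[/eqP E|/and3P[/eqP-> /eqP-> /eqP->]]|].
  by move: (congr1 fst E) (congr1 snd E) => /= -> ->.
  rewrite /model_chart !mul0r ltr0n /= /second_parameter !mul0r maxxx subr0 !divr1.
  by rewrite sqrrN.
move/eqP => E.
have E0 := congr1 (fun v : 'rV_2 => v 0 ord0) E.
have E1 := congr1 (fun v : 'rV_2 => v 0 ord_max) E.
move: E0 E1; rewrite /model_chart; case: ifP => st; case: ifP => st'; rewrite !row2E.
- move=> /oppr_inj/escape_inj Eq Ep.
  have [S T] : s ^+ 2 = s' ^+ 2 /\ second_parameter s t ^+ 2 = second_parameter s' t' ^+ 2.
    by apply: sum_diff_eq; [exact: sqr_ge0..|exact: Eq|rewrite -!exprMn Ep].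
  have ss : s = s' by move/eqP: S; rewrite eqrXn2 // => /eqP.
  rewrite -ss in s0' stN' st' Eq Ep S T *.
  have [sz|sN] := eqVneq s 0.
    move: T; rewrite sz /second_parameter !mul0r maxxx subr0 !divr1 => /eqP.
    by rewrite eqf_sqr eq_sym => /orP[/eqP->|/eqP->]; rewrite ?opprK ?eqxx ?orbT.
  have tt := mulfI sN Ep.
  by rewrite (second_parameterK st) (second_parameterK st') tt eqxx.
- have [a0 _ _] := half_plane_first_type s0' stN' st'.
  by have := (escapeP (s ^+ 2 - second_parameter s t ^+ 2)).1; lra.
- have [a0 _ _] := half_plane_first_type s0 stN st.
  by have := (escapeP (s' ^+ 2 - second_parameter s' t' ^+ 2)).1; lra.
- by move=> -> tt; rewrite (_ : t = t') ?eqxx //; lra.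
Qed.

(* A point of the model with a given chart: the second coordinate is determined
   up to a sign, which matters only if s != 0. *)
Definition model_coords (pos : bool) (v : 'rV[R]_2) : R * R :=
  let a := v 0 ord0 in let b := v 0 ord_max in
  if 0 < a then (a, 2 * b) else
  let q := (a^-1 - a) / 2 in let w := Num.sqrt (q ^+ 2 + 4 * b ^+ 2) in
  let sg := if pos then 1 else -1 in
  (Num.sqrt ((w + q) / 2),
   sg * Num.sqrt ((w - q) / 2) / (1 + Num.max 0 (sg * `|b| / 2))).

(** The real part and the absolute value of the imaginary part of a complex square root of q + 2 i
    b, whose modulus is [w]. *)
Lemma sqrt_half_sum (q b : R) (w := Num.sqrt (q ^+ 2 + 4 * b ^+ 2)) :
  [/\ Num.sqrt ((w + q) / 2) ^+ 2 - Num.sqrt ((w - q) / 2) ^+ 2 = q &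
      Num.sqrt ((w + q) / 2) * Num.sqrt ((w - q) / 2) = `|b|].
Proof.
have b2 := sqr_ge0 b; have q2 := sqr_ge0 q.
have w2 : w ^+ 2 = q ^+ 2 + 4 * b ^+ 2 by rewrite sqr_sqrtr //; lra.
have : `|q| <= w by rewrite -(sqrtr_sqr q) ler_wsqrtr //; lra.
rewrite ler_norml => /andP[w1 w1'].
split; first by rewrite !sqr_sqrtr; lra.
rewrite -sqrtrM; last by lra.
rewrite (_ : _ * _ = b ^+ 2) ?sqrtr_sqr //.
transitivity ((w ^+ 2 - q ^+ 2) / 4); first by field.
by rewrite w2; field.
Qed.

Lemma model_coords_domain pos (v : 'rV[R]_2) : chart_domain v ->
  half_plane_minus_hyperbola (model_coords pos v).
Proof.
rewrite /model_coords => dv; case: ifP => [a0|/negbT].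
  case: dv => [[_ b0 ab]|?]; last by lra.
  by split => /=; [exact: ltW|rewrite gt_eqF //; lra].
move=> _; set q := (_ - _) / 2; set sg := if pos then 1 else -1.
have [_ P] := sqrt_half_sum q (v 0 ord_max).
split => /=; first exact: sqrtr_ge0.
have m1 : 0 <= Num.max 0 (sg * `|v 0 ord_max| / 2) by rewrite le_max lexx.
have m2 : sg * `|v 0 ord_max| / 2 <= Num.max 0 (sg * `|v 0 ord_max| / 2).
  by rewrite le_max lexx orbT.
rewrite lt_eqF // mulrA mulrCA P ltr_pdivrMr; lra.
Qed.

Lemma escape_half_diff (u : R) : 0 < u -> escape ((u - u^-1) / 2) = u.
Proof.
move=> u0; have uN : u != 0 by rewrite gt_eqF.
have u'0 : 0 < u^-1 by rewrite invr_gt0.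
rewrite /escape (_ : _ + 1 = ((u + u^-1) / 2) ^+ 2); last by field.
by rewrite sqrtr_sqr ger0_norm; [field|lra].
Qed.

Lemma model_chart_coords (v : 'rV[R]_2) : chart_domain v ->
  model_chart (model_coords (0 <= v 0 ord_max) v).1
              (model_coords (0 <= v 0 ord_max) v).2 = v.
Proof.
move=> dv; rewrite /model_coords; case: ifP => [a0|/negbT a0].
  case: dv => [[_ b0 ab]|?]; last by exfalso; lra.
  rewrite /model_chart /= ifF; last by apply/negbTE; rewrite -leNgt; lra.
  by rewrite (_ : 2 * _ / 2 = v 0 ord_max) ?row2_eta //; field.
have {}a0 : v 0 ord0 < 0 by case: dv => [[a0' _ _]|//]; rewrite a0' in a0.
have [_ lt2] := model_coords_domain (0 <= v 0 ord_max) dv.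
move: lt2; rewrite /model_coords (_ : 0 < _ = false) /=; last by apply/negbTE; rewrite -leNgt ltW.
set q := (_ - _) / 2; set sg : R := if 0 <= v 0 ord_max then 1 else -1.
have [D P] := sqrt_half_sum q (v 0 ord_max).
have sgb : sg * `|v 0 ord_max| = v 0 ord_max.
  by rewrite /sg; have [b0|b0] := leP 0 (v 0 ord_max);
    rewrite ?(ger0_norm b0) ?(ltr0_norm b0) ?mul1r ?mulN1r ?opprK.
have sg2 : sg ^+ 2 = 1 by rewrite /sg; case: ifP => _; ring.
rewrite sgb.
set S := Num.sqrt _ in D P *; set T := Num.sqrt _ in D P *.
have b_eq : v 0 ord_max = S * (sg * T) by rewrite mulrCA P.
rewrite {1 2}b_eq /model_chart second_parameter_scaled => _.
rewrite ifT; last first.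
  have m1 : 0 <= Num.max 0 (S * (sg * T) / 2) by rewrite le_max lexx.
  have m2 : S * (sg * T) / 2 <= Num.max 0 (S * (sg * T) / 2) by rewrite le_max lexx orbT.
  by rewrite mulrA ltr_pdivrMr; lra.
rewrite -b_eq exprMn sg2 mul1r D.
rewrite (_ : q = (- v 0 ord0 - (- v 0 ord0)^-1) / 2); last first.
  by rewrite /q invrN opprK addrC.
by rewrite escape_half_diff ?oppr_gt0 // opprK row2_eta.
Qed.

Local Notation N := (set_type (@chart_domain R)).

Definition model_point (pos : bool) (v : N) : H :=
  SigSub (mem_set (model_coords_domain pos (set_mem (valP v)))).

Lemma model_point_continuous pos : continuous (model_point pos).
Proof.
apply: continuous_into_set_type; apply: continuous_pointwise => v /=.
have cv : {for v, continuous (val : N -> 'rV[R]_2)} by exact: val_continuous.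
have ca : {for v, continuous (fun v : N => val v 0 ord0)} by exact: cont_coord.
have cb : {for v, continuous (fun v : N => val v 0 ord_max)} by exact: cont_coord.
have ca' : (fun v : N => val v 0 ord0) y @[y --> v] --> val v 0 ord0 by exact: ca.
case: (set_mem (valP v)) => [[a0 _ _]|a0].
  apply: (continuous_near_eq (F1 := fun v : N => (val v 0 ord0, 2 * val v 0 ord_max))).
    by apply: cont_pair => //; apply: contM => //; exact: cont_cst.
  have : \forall y \near v, 0 < val (y : N) 0 ord0 by apply: cvgr_gt ca' _ _.
  by apply: filterS => y y0; rewrite /model_coords y0.
pose q (v : N) : R := ((val v 0 ord0)^-1 - val v 0 ord0) / 2.
pose w (v : N) : R := Num.sqrt (q v ^+ 2 + 4 * val v 0 ord_max ^+ 2).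
pose sg : R := if pos then 1 else -1.
have cq : {for v, continuous q}.
  apply: contM; last exact: cont_cst.
  by apply: contD; [apply: contV; rewrite ?lt_eqF|exact: contN].
have cw : {for v, continuous w}.
  apply: cont_sqrt; apply: contD; first exact: contX.
  by apply: contM; [exact: cont_cst|exact: contX].
apply: (continuous_near_eq (F1 := fun v : N => (Num.sqrt ((w v + q v) / 2),
   sg * Num.sqrt ((w v - q v) / 2) / (1 + Num.max 0 (sg * `|val v 0 ord_max| / 2))))).
  apply: cont_pair.
    apply: cont_sqrt; apply: contM; last exact: cont_cst.
    exact: contD.
  apply: contM.
    apply: contM; first exact: cont_cst.
    apply: cont_sqrt; apply: contM; last exact: cont_cst.
    by apply: contD => //; exact: contN.
  apply: contV.
    by rewrite gt_eqF // ltr_wpDr // le_max lexx.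
  apply: contD; first exact: cont_cst.
  apply: cont_max; first exact: cont_cst.
  apply: contM; last exact: cont_cst.
  by apply: contM; [exact: cont_cst|exact: cont_norm].
have : \forall y \near v, val (y : N) 0 ord0 < 0 by apply: cvgr_lt ca' _ _.
by apply: filterS => y y0; rewrite /model_coords ltNge (ltW y0).
Qed.

End ModelHexagons.

(** * The folded half plane *)

Section FoldedModel.
Context {R : realType}.
Notation V := 'rV[R]_5.
Local Notation H := (set_type (@half_plane_minus_hyperbola R)).
Local Notation N := (set_type (@chart_domain R)).
Local Notation Folded := (folded_half_plane_minus_hyperbola R).
Local Notation FQuot := {eq_quot fold_equiv R}.

Lemma fold_piP (h h' : H) : \pi_FQuot h = \pi_FQuot h' <->
  model_chart (val h).1 (val h).2 = model_chart (val h').1 (val h').2.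
Proof.
split=> [/(@eqmodP _ (fold_equiv R)) E|E].
  by apply/eqP; rewrite -fold_model_chart.
by apply/(@eqmodP _ (fold_equiv R)) => /=; rewrite fold_model_chart E eqxx.
Qed.

Definition folded_point (v : N) : Folded := \pi_FQuot (model_point (0 <= val v 0 ord_max) v).

Lemma model_chart_point (v : N) (h := model_point (0 <= val v 0 ord_max) v) :
  model_chart (val h).1 (val h).2 = val v.
Proof. exact: model_chart_coords (set_mem (valP v)). Qed.

(* Over the segment s = 0 the sign of the second coordinate jumps, but the two
   signs give points which are identified by folding. *)
Lemma folded_point_continuous : continuous folded_point.
Proof.
pose F pos (v : N) : Folded := \pi_FQuot (model_point pos v).
have cF pos : continuous (F pos).
  move=> v; apply: (@continuous_comp _ _ _ (model_point pos) (\pi_FQuot : H -> Folded)).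
    exact: model_point_continuous.
  exact: pi_continuous.
apply: continuous_pointwise => v.
have cv : {for v, continuous (val : N -> 'rV[R]_2)} by exact: val_continuous.
have cb : {for v, continuous (fun v : N => val v 0 ord_max)} by exact: cont_coord.
have cb' : (fun v : N => val v 0 ord_max) y @[y --> v] --> val v 0 ord_max by exact: cb.
have [b0|b0|b0] := ltgtP (val v 0 ord_max) 0.
- apply: (continuous_near_eq (cF false v)).
  have : \forall y \near v, val (y : N) 0 ord_max < 0 by apply: cvgr_lt cb' _ _.
  by apply: filterS => y y0; rewrite /folded_point leNgt y0.
- apply: (continuous_near_eq (cF true v)).
  have : \forall y \near v, 0 < val (y : N) 0 ord_max by apply: cvgr_gt cb' _ _.
  by apply: filterS => y y0; rewrite /folded_point ltW.
have E0 : folded_point v = F true v by rewrite /folded_point b0 lexx.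
apply: (continuous_at_either (cF true v) (cF false v)) => //.
  rewrite E0; apply/(@eqmodP _ (fold_equiv R)) => /=; rewrite /fold_rel /= /model_coords.
  have -> : (0 < val v 0 ord0) = false.
    apply/negbTE; rewrite -leNgt; case: (set_mem (valP v)) => [[_ + _]|/ltW //].
    by rewrite b0 ltxx.
  set q := (_ - _) / 2; have [_] := sqrt_half_sum q (val v 0 ord_max).
  rewrite b0 normr0 !mulr0 !mul0r !maxxx !addr0 !divr1 mul1r mulN1r => /eqP.
  (* As s |t| = 0 here, either s = 0 and the two points are identified by folding, or t = 0 and they
     coincide. *)
  rewrite mulf_eq0 => /orP[/eqP->|/eqP->]; last by rewrite oppr0 eqxx.
  by rewrite eqxx /= opprK eqxx orbT.
by apply: (@filterE _ (nbhs v)) => y; rewrite /folded_point; case: (0 <= _); [left|right].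
Qed.

Lemma folded_point_chart (h : H) (v : N) :
  val v = model_chart (val h).1 (val h).2 -> folded_point v = \pi_FQuot h.
Proof. by move=> E; apply/fold_piP; rewrite model_chart_point. Qed.

Section Polygons.
Variables (w1 w2 w3 : V) (e : R).
Hypothesis wneg : negative_definite_frame w1 w2 w3.
Hypothesis e1 : e = 1 \/ e = -1.
Hypothesis eP : forall u u', isotropic_pair u u' ->
  0 < dVol u u' w1 w2 w3 <-> 0 < e * pdet u u'.
Local Notation Lifted := (lifted_space w1 w2 w3 6).
Local Notation TLP6 := (TLP w1 w2 w3 6).
Local Notation TQuot := {eq_quot @tlp_equiv R w1 w2 w3 6}.

Let ee : e * e = 1. Proof. by case: e1 => ->; ring. Qed.

Lemma model_six_hexagon (h : H) : negative_hexagon (model_six e (val h).1 (val h).2).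
Proof. by have [s0 stN] := half_planeP h; have [] := model_six_chart ee s0 stN. Qed.

Definition model_vertex (h : H) (i : 'I_6) : null_vector R :=
  SigSub (mem_set (negative_hexagon_null i (model_six_hexagon h))).

Lemma model_future (h : H) : future_negative_lifted w1 w2 w3 (hex_lifted (model_vertex h)).
Proof.
have [s0 stN] := half_planeP h.
case: (boolP ((val h).1 * (val h).2 < 2)) => [st|/negbTE st].
  by apply: (two_six_future e1 eP) => i; rewrite /= /model_six st.
have [a0 b0 ab] := half_plane_first_type s0 stN st.
by apply: (one_six_future e1 eP a0 b0 ab) => i; rewrite /= /model_six st.
Qed.

Definition model_lifted (h : H) : Lifted := SigSub (mem_set (model_future h)).

Lemma model_lifted_continuous : continuous model_lifted.
Proof.
apply: continuous_comp_initial; apply: continuous_into_ptws => i h.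
apply: (@continuous_comp _ _ _ (model_vertex^~ i) (@ray R)); last exact: ray_continuous.
apply: (continuous_into_set_type (f := model_vertex^~ i)) => {}h.
exact: model_six_continuous.
Qed.

Lemma lifted_chart_model (h : H) :
  val (lifted_chart (model_lifted h)) = model_chart (val h).1 (val h).2.
Proof.
have [s0 stN] := half_planeP h; have [hx <-] := model_six_chart ee s0 stN.
apply: (@hexagon_chart_scale _ _ _ (fun i => (tnorm (val (model_vertex h i)))^-1) 1%:M) => //.
- exact: isometry1.
- by move=> i; rewrite invr_eq0 gt_eqF // tnorm_gt0 //; exact: null_valP.
- by move=> i; rewrite mulmx1 /lifted_vectors unit_rep_ray.
Qed.

Definition folded_polygon (x : Folded) : TLP6 := \pi_TQuot (model_lifted (repr (x : FQuot))).

(** Points identified by folding have the same chart, and the chart separates orbits; so the normal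
    forms descend to the folded half plane. *)
Lemma folded_polygon_pi (h : H) : folded_polygon (\pi_FQuot h) = \pi_TQuot (model_lifted h).
Proof.
apply: (tlp_chart_inj wneg); rewrite !(tlp_chart_pi wneg); apply: val_inj.
by rewrite !lifted_chart_model; apply/fold_piP; exact: reprK.
Qed.

Lemma folded_polygon_continuous : continuous folded_polygon.
Proof.
apply/quotient_continuous; rewrite (_ : _ \o _ = \pi_TQuot \o model_lifted).
  move=> h; apply: continuous_comp; first exact: model_lifted_continuous.
  exact: pi_continuous.
by apply/funext => h; exact: folded_polygon_pi.
Qed.

Lemma tlp_chart_folded (v : N) : @tlp_chart R w1 w2 w3 (folded_polygon (folded_point v)) = v.
Proof.
apply: val_inj; rewrite folded_polygon_pi (tlp_chart_pi wneg) lifted_chart_model.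
exact: model_chart_point.
Qed.

Lemma folded_tlp_chart (x : Folded) : folded_point (@tlp_chart R w1 w2 w3 (folded_polygon x)) = x.
Proof.
rewrite -(reprK (x : FQuot)); apply: folded_point_chart.
by rewrite folded_polygon_pi (tlp_chart_pi wneg) lifted_chart_model.
Qed.

Lemma tlp_homeomorphic_chart_domain : homeomorphic TLP6 N.
Proof.
exists (@tlp_chart R w1 w2 w3), (folded_polygon \o folded_point); split.
- exact: tlp_chart_continuous.
- move=> v; apply: continuous_comp; first exact: folded_point_continuous.
  exact: folded_polygon_continuous.
- by move=> T; apply: (tlp_chart_inj wneg); exact: tlp_chart_folded.
- exact: tlp_chart_folded.
Qed.

Lemma folded_homeomorphic_chart_domain : homeomorphic Folded N.
Proof.
exists (@tlp_chart R w1 w2 w3 \o folded_polygon), folded_point; split.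
- move=> x; apply: continuous_comp; first exact: folded_polygon_continuous.
  exact: tlp_chart_continuous.
- exact: folded_point_continuous.
- exact: folded_tlp_chart.
- exact: tlp_chart_folded.
Qed.

End Polygons.

Lemma chart_domain_open : open (@chart_domain R).
Proof.
have open_gt (f : 'rV[R]_2 -> R) : (forall v, {for v, continuous f}) -> open [set v | 0 < f v].
  by move=> cf; apply: (open_comp (D := [set r : R | 0 < r])) => [v _|]; [exact: cf|exact: open_gt].
have ca (v : 'rV[R]_2) : {for v, continuous (fun v : 'rV[R]_2 => v 0 ord0)} by cont.
have cb (v : 'rV[R]_2) : {for v, continuous (fun v : 'rV[R]_2 => v 0 ord_max)} by cont.
have -> : @chart_domain R = ([set v | 0 < v 0 ord0] `&` [set v | 0 < v 0 ord_max] `&`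
    [set v | 0 < v 0 ord0 * v 0 ord_max - 1]) `|` [set v | 0 < - v 0 ord0].
  apply/seteqP; split=> v; rewrite /chart_domain /= oppr_gt0 subr_gt0.
    by case=> [[]|]; [left|right].
  by case=> [[[]]|]; [left|right].
apply: openU; first apply: openI; first apply: openI.
all: apply: open_gt => v.
- exact: ca.
- exact: cb.
- by apply: contD; [exact: contM|exact: cont_cst].
- exact: contN.
Qed.

End FoldedModel.

Theorem proposition5p6 (R : realType) (w1 w2 w3 : 'rV[R]_5) :
  negative_definite_frame w1 w2 w3 ->
  topological_manifold R 2 (TLP w1 w2 w3 6) /\
  homeomorphic (TLP w1 w2 w3 6) (folded_half_plane_minus_hyperbola R).
Proof.
move=> wneg; have [e e1 eP] := time_orientation wneg.
have hom := tlp_homeomorphic_chart_domain wneg e1 eP.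
split; first exact: open_euclidean_manifold chart_domain_open hom.
apply: homeomorphic_trans hom (homeomorphic_sym _).
exact: folded_homeomorphic_chart_domain wneg e1 eP.
Qed.
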